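(* The $0$-smoothing invariant $\mathcal{F}(K)$ is a Vassiliev invariant of order one of virtual knotoids.
   Context: Virtual knotoid diagrams. A virtual knotoid diagram is a generic immersion of $[0,1]$ into the oriented sphere $S^2$ with finitely many transversal double points, each of which is either a classical crossing (with over/under information) or a virtual crossing (no such information). The images of $0$ and $1$ (tail and head) are distinct from each other and from all crossings; the diagram is oriented from tail to head. Two virtual knotoid diagrams are equivalent if they are related by a finite sequence of isotopies of $S^2$ and the following local moves (with all orientations), performed in disks away from the endpoints unless stated otherwise: the classical Reidemeister moves $\Omega_1,\Omega_2,\Omega_3$; the virtual Reidemeister moves $\Omega_1^v,\Omega_2^v,\Omega_3^v$ (the same moves with all crossings virtual); the mixed move $\Omega_3^m$ (an arc having two consecutive virtual crossings is moved across a classical crossing); and the move $\Omega_v$ (the tail or head is slid across a strand, creating or deleting a virtual crossing). Moving an endpoint across a strand so as to create or delete a classical crossing is not allowed. A virtual knotoid is an equivalence class. Flat virtual knotoids. A flat virtual knotoid diagram is obtained by forgetting the over/under information at every classical crossing (which becomes a flat crossing); virtual crossings remain. Flat equivalence is generated by isotopy of $S^2$ and the flat versions of all the moves above. Moving an endpoint across a strand so as to create or delete a flat crossing is not allowed, nor is moving an arc having two consecutive flat crossings across a virtual crossing. In the non-oriented version the orientation is forgotten (so the two endpoints are not distinguished). $[\,\cdot\,]$ denotes the flat equivalence class of a non-oriented flat diagram; a bar denotes non-oriented flattening. The invariant. For a classical crossing $c$, $\operatorname{sgn}(c)=+1$ if (direction of over-strand, direction of under-strand) is a positively oriented basis, and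 $-1$ otherwise; $w(D)=\sum_c\operatorname{sgn}(c)$. The $0$-smoothing $D_c$ of $D$ at a classical crossing $c$ removes the crossing and joins the two incoming strand ends to each other and the two outgoing strand ends to each other. For a virtual knotoid $K$ with diagram $D$, $$\mathcal{F}(K)=\sum_c\operatorname{sgn}(c)[\overline{D_c}]-w(D)[\overline{D}],$$ sum over all classical crossings of $D$, with values in the free $\mathbb{Z}$-module generated by non-oriented flat virtual knotoids; it is independent of the choice of $D$. Singular virtual knotoids and order. A singular virtual knotoid diagram is a virtual knotoid diagram which may have, in addition, finitely many singular crossings (marked transversal double points). Equivalence is generated by the moves above together with: $S_2$ (in a two-crossing twist of two strands consisting of a singular crossing and a classical crossing, the classical crossing is moved from one side of the singular crossing to the other), $S_3$ (an arc passing over, or under, both strands near a singular crossing is moved across that singular crossing), and $S_3^m$ (an arc with two consecutive virtual crossings is moved across a singular crossing). A virtual knotoid invariant $V$ with values in an abelian group is extended to singular virtual knotoids by $V^{(0)}=V$ and $V^{(n)}(K)=V^{(n-1)}(K_+)-V^{(n-1)}(K_-)$ for $K$ with $n\ge 1$ singular crossings, where $K_\pm$ is obtained by replacing one chosen singular crossing by a positive/negative classical crossing (the result does not depend on the order of resolution). $V$ is a Vassiliev invariant of order $\le n$ if this extension vanishes on all singular virtual knotoids with more than $n$ singular crossings; it is of order $n$ if it is of order $\le n$ and not of order $\le n-1$. *)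

(* Defs.v *)
From HB Require Import structures.
From Stdlib Require Import Relation_Operators.
From mathcomp Require Import all_boot all_order all_algebra perm zify.
From mathcomp Require Import generic_quotient boolp.
From mathcomp.multinomials Require Import freeg.

Set Implicit Arguments.
Unset Strict Implicit.
Unset Printing Implicit Defensive.

Import GRing.Theory.

(** * Planar words

    A generic immersed arc in the oriented sphere, up to isotopy of the sphere,
    is encoded by listing ALL its double points (classical, flat, virtual and
    singular ones) in the order in which they are met from tail to head, each
    of them being met twice.  A passage through the double point labelled [l]
    is recorded by [(l, b)], where [b = true] iff the strand met there crosses
    the strand being travelled from right to left, i.e. iff (direction of this
    strand, direction of the other strand) is a positive basis.  The two
    passages of a double point are therefore [(l, b)] and [(l, ~~ b)]. *)

Definition side := (nat * bool)%type.

Definition opp (p : side) : side := (p.1, ~~ p.2).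

Definition well_paired (g : seq side) :=
  uniq g && all (fun p => opp p \in g) g.

(** The arc is a plane graph: with [2 n] passages it has [2 n + 1] edges,
    edge [i] joining passage [i - 1] (the tail if [i = 0]) to passage [i] (the
    head if [i = 2 n]).  The dart [(i, true)] travels along edge [i] in the
    direction of the arc, [(i, false)] in the opposite one.  [turn g] follows
    the boundary of the face on the left of a dart: take the leftmost exit at
    double points, make a U-turn at tail and head. *)

Definition leave (g : seq side) (p : side) (fwd : bool) : nat * bool :=
  let j := index (opp p) g in
  if p.2 == fwd then (j.+1, true) else (j, false).

Definition turn (g : seq side) (d : nat * bool) : nat * bool :=
  let: (e, fwd) := d in
  if fwd then
    if e < size g then leave g (@nth side (0, false) g e) true else (e, false)
  else
    if 0 < e then leave g (@nth side (0, false) g e.-1) false else (e, true).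

Definition dart (g : seq side) := ('I_(size g).+1 * bool)%type.

Definition face (g : seq side) (d : dart g) : dart g :=
  let d' := turn g (val d.1, d.2) in (inord d'.1, d'.2).

Definition n_vertices (g : seq side) := (size g)./2 + 2.
Definition n_edges (g : seq side) := (size g).+1.
Definition n_faces (g : seq side) := fcard (@face g) predT.

(** Euler's formula: the surface carrying the (connected) graph is a sphere. *)
Definition planar (g : seq side) :=
  n_vertices g + n_faces g == n_edges g + 2.

(** ** Smoothing keeps words planar

    Smoothing a double point lowers the number of faces by at most one; hence,
    by induction, a word with [2 n] passages has at most [n + 1] faces, and the
    bound is attained after smoothing if it was before. *)

Local Notation gnth := (@nth side (0, false)).

Lemma oppK : involutive opp.
Proof. by case=> l b; rewrite /opp /= negbK. Qed.

Lemma opp_neq p : (opp p == p) = false.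
Proof. by case: p => l []; rewrite /opp xpair_eqE andbF. Qed.

Lemma mem_opp g p : well_paired g -> (opp p \in g) = (p \in g).
Proof.
case/andP=> _ /allP cl; apply/idP/idP => [/cl|/cl //].
by rewrite oppK.
Qed.

Lemma turn_le g d : well_paired g -> d.1 <= size g -> (turn g d).1 <= size g.
Proof.
move=> wg; have lv p fwd : p \in g -> (leave g p fwd).1 <= size g.
  rewrite -(mem_opp p wg) -index_mem /leave => lt_j.
  by case: ifP => _ /=; last exact: ltnW.
case: d => e [] /= le_e.
  by case: ifP => // lt_e; apply/lv/mem_nth.
by case: ifP => // e_gt0; apply/lv/mem_nth; case: e e_gt0 le_e.
Qed.

Lemma leave_inj g p p' f f' : well_paired g -> p \in g -> p' \in g ->
  leave g p f = leave g p' f' -> p = p' /\ f = f'.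
Proof.
move=> wg; rewrite -(mem_opp p wg) -(mem_opp p' wg) /leave => gp gp'.
have idx_inj : index (opp p) g = index (opp p') g -> p = p'.
  by move=> e; rewrite -(oppK p) -(nth_index (0, false) gp) e nth_index ?oppK.
case: ifP => bf; case: ifP => bf' // [] /idx_inj eq_p; split=> //; subst p'.
  by rewrite -(eqP bf) (eqP bf').
by case: (p.2) f f' bf bf' => [] [] [].
Qed.

Lemma turn_inj g d d' : well_paired g -> d.1 <= size g -> d'.1 <= size g ->
  turn g d = turn g d' -> d = d'.
Proof.
move=> wg.
have gi f e : (if f then e < size g else 0 < e <= size g) ->
    gnth g (if f then e else e.-1) \in g.
  by move=> lt_e; apply: mem_nth; case: f lt_e => //; case: e.
have ug : uniq g by case/andP: wg.
have nle p f : p \in g -> leave g p f != (0, true) /\ leave g p f != (size g, false).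
  rewrite -(mem_opp p wg) -index_mem /leave.
  by case: ifP => _ lt_j; rewrite !xpair_eqE ?andbF ?andbT //= (ltn_eqF lt_j).
have decomp (c : nat * bool) : c.1 <= size g ->
    [\/ c = (size g, true) /\ turn g c = (size g, false),
        c = (0, false) /\ turn g c = (0, true) |
        exists k, [/\ k < size g, c = (if c.2 then k else k.+1, c.2) &
                      turn g c = leave g (gnth g k) c.2]].
  case: c => e [] /= le_e.
    case: ltnP => [lt_e|ge_e]; first by constructor 3; exists e.
    by have -> : e = size g by [apply/eqP; rewrite eqn_leq le_e]; constructor 1.
  case: e le_e => [|e] le_e /=; first by constructor 2.
  by constructor 3; exists e.
move=> /decomp Dd /decomp Dd'.
case: Dd => [[-> ->]|[-> ->]|[k [lk -> ->]]];
  case: Dd' => [[-> ->]|[-> ->]|[k' [lk' -> ->]]] //= E.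
- by case: (nle _ d'.2 (mem_nth (0, false) lk')); rewrite -E eqxx.
- by case: (nle _ d'.2 (mem_nth (0, false) lk')); rewrite -E eqxx.
- by case: (nle _ d.2 (mem_nth (0, false) lk)); rewrite E eqxx.
- by case: (nle _ d.2 (mem_nth (0, false) lk)); rewrite E eqxx.
have [eqn ->] := leave_inj wg (mem_nth (0, false) lk) (mem_nth (0, false) lk') E.
by move/eqP: eqn; rewrite nth_uniq // => /eqP ->.
Qed.

Definition nat_dart g (d : dart g) : nat * bool := (val d.1, d.2).

Lemma nat_dart_inj g : injective (@nat_dart g).
Proof. by move=> [i f] [j k] [/val_inj -> ->]. Qed.

Lemma nat_dart_le g (d : dart g) : (nat_dart d).1 <= size g.
Proof. by rewrite /= -ltnS. Qed.

Definition mk_dart g (d : nat * bool) : dart g := (inord d.1, d.2).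

Lemma mk_dartK g d : d.1 <= size g -> nat_dart (mk_dart g d) = d.
Proof. by case: d => e f /= le_e; rewrite /nat_dart /= inordK. Qed.

Lemma nat_dart_face g d : well_paired g ->
  nat_dart (@face g d) = turn g (nat_dart d).
Proof. by move=> wg; apply: mk_dartK; apply: turn_le => //; apply: nat_dart_le. Qed.

Lemma face_inj g : well_paired g -> injective (@face g).
Proof.
move=> wg c c' E; apply: nat_dart_inj.
apply: (turn_inj wg); rewrite ?nat_dart_le //.
by rewrite -!nat_dart_face // E.
Qed.

Lemma fcard_porbits (T : finType) (f : T -> T) (injf : injective f) :
  fcard f predT = #|porbits (perm injf)|.
Proof.
have itE n y : iter n f y = iter n (perm injf) y.
  by elim: n => //= n ->; rewrite permE.
have mem_c x y : fconnect f x y = (y \in porbit (perm injf) x).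
  apply/idP/porbitP => [/iter_findex <-|[i ->]].
    by exists (findex f x y); rewrite permX itE.
  by rewrite permX -itE fconnect_iter.
have po_root x : porbit (perm injf) (froot f x) = porbit (perm injf) x.
  by apply/eqP; rewrite eq_porbit_mem -mem_c connect_root.
have -> : porbits (perm injf) = [set porbit (perm injf) x | x in froots f].
  apply/setP=> C; apply/imsetP/imsetP => [[x _ ->]|[x _ ->]]; last by exists x.
  exists (froot f x); last by rewrite po_root.
  by apply: roots_root; apply: fconnect_sym.
rewrite card_in_imset; last first.
  move=> x y rx ry /eqP; rewrite eq_porbit_mem -mem_c => cxy.
  move: cxy; rewrite -(root_connect (fconnect_sym injf)).
  by move: rx ry => /eqP -> /eqP -> /eqP.
by apply: eq_card => x; rewrite !inE andbT.
Qed.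

Lemma leq_porbits (T T' : finType) (u : {perm T}) (u' : {perm T'}) (h : T -> T') :
  (forall x y, h x = h y -> y \in porbit u x) ->
  (forall x, exists2 y, y \in porbit u x & h y = u' (h x)) ->
  #|porbits u| <= #|porbits u'|.
Proof.
move=> h_inj h_step.
have lift x n : exists2 y, y \in porbit u x & h y = iter n u' (h x).
  elim: n => [|n [y yx yE]]; first by exists x; rewrite ?porbit_id.
  have [z zy zE] := h_step y; exists z; last by rewrite zE yE.
  by move: yx zy; rewrite -!eq_porbit_mem => /eqP ->.
pose F (C : {set T}) := if [pick x in C] is Some x then porbit u' (h x) else set0.
have FE C : C \in porbits u -> exists2 x, C = porbit u x & F C = porbit u' (h x).
  case/imsetP=> x _ ->; rewrite /F; case: pickP => [y|/(_ x)]; last by rewrite porbit_id.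
  by rewrite -eq_porbit_mem => /eqP E; exists y.
rewrite -(@card_in_imset _ _ F); last first.
  move=> C C' /FE[x -> ->] /FE[y -> ->] /eqP.
  rewrite eq_porbit_mem porbit_sym => /porbitP[n]; rewrite permX => E.
  have [z zx] := lift x n; rewrite -E => /esym/h_inj.
  by move: zx; rewrite -!eq_porbit_mem => /eqP <- /eqP ->.
apply/subset_leq_card/subsetP=> _ /imsetP[C /FE[x _ ->] ->].
exact: imset_f.
Qed.

Definition smooth_side (b : seq side) (p : side) : side :=
  (p.1, p.2 (+) odd (count (fun t => t.1 == p.1) b)).

Definition smooth_sides (a b d : seq side) : seq side :=
  [seq smooth_side b t | t <- a] ++ rev [seq smooth_side b t | t <- b]
    ++ [seq smooth_side b t | t <- d].

Section Smoothing.
Variables (a b d : seq side) (x : nat) (s : bool).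
Let g := a ++ (x, s) :: b ++ (x, ~~ s) :: d.
Let g' := smooth_sides a b d.
Hypothesis wg : well_paired g.

Let sz : size g = size a + size b + size d + 2.
Proof. by rewrite /g !size_cat /= size_cat /=; lia. Qed.

Let sz' : size g' = size a + size b + size d.
Proof. by rewrite /g' !size_cat size_rev !size_map addnA. Qed.

Let ssj : injective (smooth_side b).
Proof.
move=> [l i] [l' i'] [<-]; rewrite /= => E; congr pair.
by case: i i' (odd _) E => [] [] [].
Qed.

Let opp_smooth t : opp (smooth_side b t) = smooth_side b (opp t).
Proof. by rewrite /opp /smooth_side /= addNb. Qed.

Let perm_g : perm_eq g ((x, s) :: (x, ~~ s) :: a ++ b ++ d).
Proof.
by apply/seq.permP=> P; rewrite /g /= !count_cat /= !count_cat /=; lia.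
Qed.

Let perm_g' : perm_eq g' [seq smooth_side b t | t <- a ++ b ++ d].
Proof. by rewrite /g' !map_cat /smooth_sides perm_cat2l perm_cat2r perm_rev. Qed.

Let ug : uniq g. Proof. by case/andP: wg. Qed.

Let u3 : uniq ((x, s) :: (x, ~~ s) :: a ++ b ++ d).
Proof. by rewrite -(perm_uniq perm_g). Qed.

Lemma smooth_paired : well_paired g'.
Proof.
have /and3P[x1 x2 u0] := u3.
apply/andP; split; first by rewrite (perm_uniq perm_g') map_inj_uniq.
apply/allP => y; rewrite (perm_mem perm_g') => /mapP[t tm ->].
rewrite (perm_mem perm_g') opp_smooth mem_map //.
have : opp t \in g by rewrite mem_opp // (perm_mem perm_g) !inE tm !orbT.
rewrite (perm_mem perm_g) !inE => /or3P[/eqP E|/eqP E|//].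
  by move: x2 tm; rewrite -(oppK t) E => /negP.
move: x1; rewrite inE negb_or => /andP[_ /negP].
by rewrite -(oppK t) E /opp /= negbK in tm.
Qed.

Definition pos k :=
  if k < size a then k
  else if k < (size a + size b).+1 then (size a).*2 + size b - k else k - 2.

Definition in_loop k := size a < k < (size a + size b).+1.

Definition hdart (c : nat * bool) : nat * bool :=
  if c.1 <= size a then c
  else if c.1 <= (size a + size b).+1
       then ((size a).*2 + size b + 1 - c.1, ~~ c.2) else (c.1 - 2, c.2).

Definition special k := (k == size a) || (k == (size a + size b).+1).

Let nth_pos k : k < size g -> ~~ special k ->
  gnth g' (pos k) = smooth_side b (gnth g k) /\ pos k < size g'.
Proof.
rewrite sz /special negb_or sz' => lt_k /andP[ka kb].
have dn : (size a).*2 = size a + size a by rewrite addnn.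
have [lka|gka] := ltnP k (size a).
  rewrite /pos lka /g' /g /smooth_sides !nth_cat size_map lka (@nth_map side (0, false) side) //.
  by split=> //; lia.
have [j ek] : exists j, k = size a + j.+1 by exists (k - size a).-1; lia.
have -> : gnth g k = gnth (b ++ (x, ~~ s) :: d) j.
  by rewrite /g nth_cat ltnNge gka /=; have -> : k - size a = j.+1 by lia.
have [lkb|gkb] := ltnP j (size b).
  have -> : pos k = size a + (size b - j.+1).
    by rewrite /pos ltnNge gka /= ifT; lia.
  rewrite /g' /smooth_sides nth_cat size_map ltnNge leq_addr /= addKn nth_cat.
  rewrite size_rev size_map ifT; last lia.
  rewrite nth_rev ?size_map; last lia.
  rewrite (@nth_map side (0, false) side); last lia.
  by rewrite nth_cat lkb; split; [congr (smooth_side b (nth _ _ _)); lia | lia].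
have [i ej] : exists i, j = size b + i.+1 by exists (j - size b).-1; lia.
have -> : pos k = size a + (size b + i).
  by rewrite /pos ltnNge gka /= ifF; lia.
rewrite /g' /smooth_sides nth_cat size_map ltnNge leq_addr /= addKn nth_cat.
rewrite size_rev size_map ltnNge leq_addr /= addKn (@nth_map side (0, false) side); last lia.
rewrite nth_cat ltnNge gkb /= ej addKn /=.
by split=> //; lia.
Qed.

Let mem_loop k : k < size g -> (gnth g k \in b) = in_loop k.
Proof.
move=> lt_k; rewrite /in_loop.
have nthb i : i < size b -> gnth g (size a + i.+1) = gnth b i.
  by move=> lt_i; rewrite /g nth_cat ltnNge leq_addr /= addKn /= nth_cat lt_i.
apply/idP/idP => [/(@nthP side _ _ (0, false))[i lt_i]|rg].
  have {}lt_i : i < @size side b by [].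
  rewrite -nthb // => /eqP; rewrite nth_uniq //; last by rewrite sz; lia.
  by move/eqP <-; lia.
have [i ek] : exists i, k = size a + i.+1 by exists (k - size a).-1; lia.
have lt_i : i < size b by lia.
by rewrite ek nthb // mem_nth.
Qed.

Let index_opp k : k < size g -> ~~ special k ->
  index (opp (gnth g k)) g < size g /\ ~~ special (index (opp (gnth g k)) g).
Proof.
move=> lt_k; set j := index _ _ => sk.
have gj : opp (gnth g k) \in g by rewrite mem_opp // mem_nth.
have lt_j : j < size g by rewrite index_mem.
split=> //; apply: contra sk => sj.
have eo : gnth g k = opp (gnth g j) by rewrite nth_index // oppK.
have n1 : gnth g (size a) = (x, s) by rewrite /g nth_cat ltnn subnn.
have n2 : gnth g (size a + size b).+1 = (x, ~~ s).
  rewrite -addnS /g nth_cat ltnNge leq_addr /= addKn /= nth_cat ltnn subnn //.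
have : gnth g k \in [:: gnth g (size a); gnth g (size a + size b).+1].
  rewrite eo; case/orP: sj => /eqP ->; rewrite n1 n2 !inE /opp /= ?eqxx ?orbT //.
  by rewrite negbK eqxx.
by rewrite !inE !nth_uniq // sz; lia.
Qed.

Let odd_loop k (j := index (opp (gnth g k)) g) : k < size g ->
  odd (count (fun t => t.1 == (gnth g k).1) b) = in_loop k (+) in_loop j.
Proof.
move=> lt_k.
have gj : opp (gnth g k) \in g by rewrite mem_opp // mem_nth.
have lt_j : j < size g by rewrite index_mem.
rewrite -!mem_loop // nth_index //.
have ub : uniq b.
  by have := ug; rewrite /g cat_uniq /= cat_uniq => /and5P[_ _ _ ->].
set t := gnth g k.
have -> : count (fun t' => t'.1 == t.1) b = (t \in b) + (opp t \in b).
  have I0 : count (predI (pred1 t) (pred1 (opp t))) b = 0.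
    rewrite -(count_pred0 b); apply: eq_count => u /=.
    by apply/negP=> /andP[/eqP -> ]; rewrite eq_sym opp_neq.
  have := count_predUI (pred1 t) (pred1 (opp t)) b.
  rewrite I0 addn0 !count_uniq_mem // => <-; apply: eq_count => -[l i] /=.
  by case: (t) => m n; rewrite /opp !xpair_eqE /=; case: eqP => // _; case: i n => [] [].
by rewrite oddD !oddb.
Qed.

Let hdart_before k f : k < size g -> ~~ special k ->
  hdart (k, f) = if in_loop k then ((pos k).+1, ~~ f) else (pos k, f).
Proof.
rewrite sz /special /hdart /in_loop /pos -addnn => lt_k sk /=.
case: (ltngtP k (size a)) (sk) => [lt|gt|->]; rewrite ?eqxx //= => ne.
case: (ltngtP k (size a + size b).+1) ne => // lt _.
by congr pair; lia.
Qed.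

Let hdart_after k f : k < size g -> ~~ special k ->
  hdart (k.+1, f) = if in_loop k then (pos k, ~~ f) else ((pos k).+1, f).
Proof.
rewrite sz /special /hdart /in_loop /pos -addnn => lt_k sk /=.
case: (ltngtP k (size a)) (sk) => [lt|gt|->]; rewrite ?eqxx //= => ne.
rewrite ltnS.
case: (ltngtP k (size a + size b).+1) ne => // [lt|gt'] _; last first.
  have -> : (k <= size a + size b) = false by lia.
  by congr pair; lia.
have -> : k <= size a + size b by lia.
by congr pair; lia.
Qed.

Let hdart_leave k f : k < size g -> ~~ special k ->
  hdart (leave g (gnth g k) f) = leave g' (gnth g' (pos k)) (f (+) in_loop k).
Proof.
move=> lt_k sk; have [lt_j sj] := index_opp lt_k sk.
have ug' : uniq g' by case/andP: smooth_paired.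
have [-> _] := nth_pos lt_k sk; rewrite /leave opp_smooth.
have [ej lt_pj] := nth_pos lt_j sj.
rewrite nth_index in ej; last by rewrite mem_opp // mem_nth.
rewrite -ej index_uniq // {1}/smooth_side /= odd_loop //.
move: lt_j sj {ej lt_pj}; set j := index _ g => lt_j sj.
have -> : (gnth g k).2 (+) (in_loop k (+) in_loop j) == f (+) in_loop k
        = ((gnth g k).2 (+) in_loop j == f).
  by case: ((gnth g k).2) (in_loop k) (in_loop j) f => [] [] [] [].
have hb := hdart_before _ lt_j sj; have ha := hdart_after _ lt_j sj.
case: eqP => [<-|ne]; rewrite ?ha ?hb.
  by case: ((gnth g k).2) (in_loop j) => [] [].
by case: ((gnth g k).2) f ne (in_loop j) => [] [] // _ [].
Qed.

Let turn_smooth (c : nat * bool) : c.1 <= size g ->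
  (c.2 -> ~~ special c.1) -> (~~ c.2 -> 0 < c.1 -> ~~ special c.1.-1) ->
  hdart (turn g c) = turn g' (hdart c).
Proof.
have after k f : k < size g -> ~~ special k ->
    leave g' (gnth g' (pos k)) (f (+) in_loop k) =
    turn g' (hdart (if f then k else k.+1, f)).
  move=> lt_k sk; have [_ lt_p] := nth_pos lt_k sk.
  case: f; [rewrite hdart_before // | rewrite hdart_after //];
    by case: (in_loop k) => /=; rewrite ?lt_p.
case: c => e [] /= le_e.
  move=> /(_ isT) se _; case: ltnP => [lt_e|ge_e].
    by rewrite hdart_leave // after.
  have -> : e = size g by apply/eqP; rewrite eqn_leq le_e.
  have hE f : hdart (size g, f) = (size g', f).
    rewrite /hdart sz sz' /=.
    have -> : (size a + size b + size d + 2 <= size a) = false by lia.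
    have -> : (size a + size b + size d + 2 <= (size a + size b).+1) = false by lia.
    by congr pair; lia.
  by rewrite !hE /= ltnn.
move=> _ /(_ isT) se; case: e le_e se => [|e] lt_e /= se; first by [].
have {}se := se isT.
by rewrite hdart_leave // after.
Qed.

Let sw (c : nat * bool) : nat * bool :=
  let: (i, o) := if s then (size a, (size a).+1)
    else ((size a + size b).+1, (size a + size b).+2) in
  if c == (i, true) then (o, false) else if c == (o, false) then (i, true) else c.

Let N c := turn g (sw c).

Let isspec (c : nat * bool) :=
  if c.2 then special c.1 else (0 < c.1) && special c.1.-1.

Let g1 : gnth g (size a) = (x, s).
Proof. by rewrite /g nth_cat ltnn subnn. Qed.

Let g2 : gnth g (size a + size b).+1 = (x, ~~ s).
Proof. by rewrite -addnS /g nth_cat ltnNge leq_addr /= addKn /= nth_cat ltnn subnn. Qed.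

Let i1 : index ((x, s) : side) g = size a.
Proof. by rewrite -g1 index_uniq // sz; lia. Qed.

Let i2 : index ((x, ~~ s) : side) g = (size a + size b).+1.
Proof. by rewrite -g2 index_uniq // sz; lia. Qed.

Let neqs : ((size a == (size a + size b).+1) = false) *
  (((size a + size b).+1 == size a) = false) *
  (((size a).+1 == (size a + size b).+2) = false) *
  (((size a + size b).+2 == (size a).+1) = false).
Proof. by do !split; lia. Qed.

Let lts : (size a < size g) * ((size a + size b).+1 < size g).
Proof. by split; rewrite sz; lia. Qed.

Let NE : [/\ N (size a, true) = ((size a + size b).+1, false),
  N ((size a).+1, false) = ((size a + size b).+2, true),
  N ((size a + size b).+1, true) = (size a, false) &
  N ((size a + size b).+2, false) = ((size a).+1, true)].
Proof.
rewrite /N /sw; case: (s) g1 g2 i1 i2 => /= h1 h2 e1 e2; split;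
  rewrite !xpair_eqE ?eqxx ?neqs ?andbF /= ?h1 ?h2 ?lts /leave /opp /= ?h1 ?h2 /=;
  by rewrite ?e1 ?e2.
Qed.

Let isspecP c : isspec c -> [\/ c = (size a, true), c = ((size a).+1, false),
  c = ((size a + size b).+1, true) | c = ((size a + size b).+2, false)].
Proof.
case: c => e []; rewrite /isspec /special /=.
  by case/orP=> /eqP ->; [constructor 1 | constructor 3].
case: e => //= e; case/orP=> /eqP ->; [constructor 2 | constructor 4]; by [].
Qed.

Let N_spec c : isspec c -> hdart (N c) = hdart c.
Proof.
have [E1 E2 E3 E4] := NE.
have h1 f : hdart (size a, f) = (size a, f) by rewrite /hdart /= leqnn.
have h2 f : hdart ((size a).+1, f) = (size a + size b, ~~ f).
  by rewrite /hdart /= ltnn ltnS leq_addr -addnn; congr pair; lia.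
have h3 f : hdart ((size a + size b).+1, f) = (size a, ~~ f).
  rewrite /hdart /= leqnn -addnn ifF; first by congr pair; lia.
  by lia.
have h4 f : hdart ((size a + size b).+2, f) = (size a + size b, f).
  rewrite /hdart /= ltnn ifF; first by congr pair; lia.
  by lia.
by case/isspecP=> ->; rewrite ?E1 ?E2 ?E3 ?E4 ?h1 ?h2 ?h3 ?h4.
Qed.

Let N_nspec c : c.1 <= size g -> ~~ isspec c -> hdart (N c) = turn g' (hdart c).
Proof.
move=> le_c ns; have -> : N c = turn g c.
  congr turn; rewrite /sw; move: ns; rewrite /isspec /special; case: (c) => e f /=.
  case: (s); rewrite !xpair_eqE; case: f => /=; rewrite ?andbF ?andbT /=.
  - by rewrite negb_or => /andP[/negbTE -> _].
  - by case: e => //= e; rewrite eqSS negb_or => /andP[/negbTE -> _].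
  - by rewrite negb_or => /andP[_ /negbTE ->].
  - by case: e => //= e; rewrite eqSS negb_or => /andP[_ /negbTE ->].
apply: turn_smooth => // [c2|c2 c1]; move: ns; rewrite /isspec.
  by rewrite c2.
by rewrite (negbTE c2) c1.
Qed.
Let N_le c : c.1 <= size g -> (N c).1 <= size g.
Proof.
have [l1 l2] := lts.
move=> le_c; apply: turn_le => //; rewrite /sw.
by case: (s); case: ifP => _ /=; [lia | case: ifP => _ /=; [lia|] | lia |
  case: ifP => _ /=; [lia|]].
Qed.

Let leave_spec c : c.1 <= size g ->
  exists n, ~~ isspec (iter n N c) /\ hdart (iter n N c) = hdart c.
Proof.
move=> le_c; have [E1 E2 E3 E4] := NE.
have [sc|] := boolP (isspec c); last by exists 0.
have [sc1|] := boolP (isspec (N c)); last by exists 1; rewrite N_spec.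
exists 2; rewrite /= !N_spec //; split=> //.
move: sc1; case/isspecP: sc => ->; rewrite ?E1 ?E2 ?E3 ?E4 => /isspecP[] [] // e;
  try (exfalso; lia).
  by rewrite e E2 /isspec /special /=; lia.
by rewrite e E3 /isspec /special /=; lia.
Qed.

Let hdart_inj c c' : c.1 <= size g -> c'.1 <= size g -> hdart c = hdart c' ->
  exists n, iter n N c = c' \/ iter n N c' = c.
Proof.
have [E1 E2 E3 E4] := NE.
wlog le : c c' / c.1 <= c'.1.
  move=> H le_c le_c' E; have [le|lt] := leqP c.1 c'.1; first exact: H.
  have [||||n [|]] := H c' c => //; first exact: ltnW.
    by exists n; right.
  by exists n; left.
case: c c' le => e f [e' f'] /= le le_e le_e'; rewrite /hdart /=.
have dn : (size a).*2 = size a + size a by rewrite addnn.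
case: (leqP e (size a)) => [A|nA]; case: (leqP e' (size a)) => [A'|nA'].
- by case=> -> ->; exists 0; left.
- case: ifP => [B'|nB'] [ee ->].
    have -> : e = size a by lia.
    have -> : e' = (size a + size b).+1 by lia.
    by exists 1; case: f' => /=; [right | left].
  have b0 : size b = 0 by lia.
  have -> : e = size a by lia.
  have -> : e' = (size a + size b).+2 by lia.
  exists 2; case: f' => /=; [left | right].
    by rewrite E1 -E2 b0 addn0.
  by rewrite E4 -E3 b0 addn0.
- by exfalso; lia.
- case: ifP => [B|nB]; case: ifP => [B'|nB'] [ee ef].
  + have -> : e = e' by lia.
    by exists 0; left; congr pair; case: f f' ef => [] [].
  + have -> : e = (size a).+1 by lia.
    have -> : e' = (size a + size b).+2 by lia.
    by exists 1; rewrite -ef; case: (f) => /=; [right | left].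
  + by exfalso; lia.
  + by rewrite ef; exists 0; left; congr pair; lia.
Qed.

Let iO : nat * bool := if s then (size a, true) else ((size a + size b).+1, true).
Let oO : nat * bool :=
  if s then ((size a).+1, false) else ((size a + size b).+2, false).

Lemma n_faces_smooth : n_faces g <= (n_faces g').+1.
Proof.
have wg' := smooth_paired.
rewrite /n_faces (fcard_porbits (face_inj wg)) (fcard_porbits (face_inj wg')).
set phi := perm _; set phi' := perm _.
pose u := mk_dart g iO; pose v := mk_dart g oO; pose psi := (tperm u v * phi)%g.
have [l1 l2] := lts.
have uE : nat_dart u = iO by apply: mk_dartK; rewrite /iO; case: (s) => /=; lia.
have vE : nat_dart v = oO by apply: mk_dartK; rewrite /oO; case: (s) => /=; lia.
have psiE z : nat_dart (psi z) = N (nat_dart z).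
  rewrite /psi permM permE nat_dart_face // /N; congr turn.
  rewrite permE /= /sw -(inj_eq (@nat_dart_inj g) z u) -(inj_eq (@nat_dart_inj g) z v).
  move: uE vE; rewrite /iO /oO => uE vE; rewrite uE vE; move: uE vE; by case: (s) => uE vE; do 2?[case: ifP => _].
have psin n z : nat_dart (iter n psi z) = iter n N (nat_dart z).
  by elim: n => //= n <-; rewrite psiE.
have hle c : c.1 <= size g -> (hdart c).1 <= size g'.
  rewrite /hdart sz sz' -addnn; case: ifP => // A; first by lia.
  by case: ifP => B /=; lia.
pose h (z : dart g) := mk_dart g' (hdart (nat_dart z)).
have hE z : nat_dart (h z) = hdart (nat_dart z) by apply/mk_dartK/hle/nat_dart_le.
apply: (@leq_trans (#|porbits psi|.+1)).
  have := porbits_mul_tperm psi u v; rewrite /= /psi mulgA tperm2 mul1g.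
  by case: (u != v); lia.
rewrite ltnS; apply: (leq_porbits (h := h)) => [y z E|y].
  have : hdart (nat_dart y) = hdart (nat_dart z) by rewrite -!hE E.
  case/hdart_inj; rewrite ?nat_dart_le // => n []; rewrite -psin => /nat_dart_inj <-.
    by rewrite -permX mem_porbit.
  by rewrite porbit_sym -permX mem_porbit.
have [n [ns En]] := leave_spec (nat_dart_le y).
exists (iter n.+1 psi y); first by rewrite -permX mem_porbit.
apply: nat_dart_inj; rewrite hE psin /= N_nspec ?En //; last first.
  by rewrite -psin nat_dart_le.
by rewrite permE nat_dart_face // hE.
Qed.

Lemma size_smooth : size g = (size g').+2.
Proof. by rewrite sz sz'; lia. Qed.

End Smoothing.

Lemma well_paired_split g p : well_paired g -> p \in g ->
  exists (a b d : seq side) (s : bool), g = a ++ (p.1, s) :: b ++ (p.1, ~~ s) :: d.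
Proof.
move=> wg gp; have [ug _] := andP wg.
wlog lt : p gp / index p g < index (opp p) g.
  move=> H; have [|lt|E] := ltngtP (index p g) (index (opp p) g); first exact: H.
    by apply: (H (opp p)); rewrite ?mem_opp ?oppK.
  have := opp_neq p; rewrite -[opp p](nth_index p (s := g)) ?mem_opp //.
  by rewrite -E nth_index // eqxx.
case/splitPr: gp ug wg lt => a c; rewrite cat_uniq => /and3P[_ /= na uc] wg.
have nap : p \notin a by apply: contra na => ->.
rewrite index_cat (negbTE nap) /= eqxx addn0 index_cat.
have : opp p \in a ++ p :: c by rewrite mem_opp // mem_cat mem_head orbT.
rewrite mem_cat inE opp_neq /=; case: ifP => [ap _ |_ /= pc _].
  by rewrite ltnNge ltnW // index_mem.
case/splitPr: pc => b d; exists a, b, d, p.2; by case: (p).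
Qed.

Lemma n_faces_nil : n_faces [::] = 1.
Proof.
rewrite /n_faces -[RHS](n_comp_connect (fconnect_sym (@face_inj [::] isT)) (ord0, true)).
apply: eq_n_comp_r => -[i f]; rewrite !inE (ord1 i); apply/esym.
case: f; first exact: connect0.
by apply: connect1; rewrite /= /face /= xpair_eqE eqxx andbT; apply/eqP/val_inj; rewrite /= inordK.
Qed.

Lemma euler_bound g : well_paired g -> n_faces g <= (size g)./2.+1.
Proof.
move: {2}(size g) (leqnn (size g)) => n; elim: n g => [|n IHn] g.
  by rewrite leqn0 size_eq0 => /eqP -> _; rewrite n_faces_nil.
case: g => [|p g] le_n wg; first by rewrite n_faces_nil.
have [a [b [d [s E]]]] := well_paired_split wg (mem_head p g).
rewrite {}E in wg le_n *.
have Esz := size_smooth wg.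
have le_n' : size (smooth_sides a b d) <= n.
  by move: le_n; rewrite Esz ltnS => /ltnW.
apply: leq_trans (n_faces_smooth wg) _; rewrite Esz.
exact: IHn _ le_n' (smooth_paired wg).
Qed.

Lemma smooth_planar a b d x s (g := a ++ (x, s) :: b ++ (x, ~~ s) :: d) :
  well_paired g -> planar g -> planar (smooth_sides a b d).
Proof.
move=> wg; rewrite /planar /n_vertices /n_edges => /eqP E.
have le1 := n_faces_smooth wg.
have le2 := euler_bound (smooth_paired wg).
have le3 := euler_bound wg.
have Esz := size_smooth wg.
apply/eqP; move: le1 le2 le3 E; rewrite -/g Esz /=; lia.
Qed.

(** * Diagrams *)

(** [Over] and [Under] mark the two passages of a classical crossing; the other
    marks are shared by both passages of a double point. *)
Inductive mark := Over | Under | Flat | Virtual | Singular.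

Definition nat_of_mark (m : mark) : nat :=
  match m with Over => 0 | Under => 1 | Flat => 2 | Virtual => 3 | Singular => 4 end.

Definition mark_of_nat (n : nat) : mark :=
  match n with 0 => Over | 1 => Under | 2 => Flat | 3 => Virtual | _ => Singular end.

Lemma nat_of_markK : cancel nat_of_mark mark_of_nat.
Proof. by case. Qed.

HB.instance Definition _ := Countable.copy mark (can_type nat_of_markK).

Definition dual (m : mark) : mark :=
  match m with Over => Under | Under => Over | _ => m end.

Definition classical (m : mark) := (m == Over) || (m == Under).

Definition passage := (side * mark)%type.

Definition label (t : passage) : nat := t.1.1.
Definition sense (t : passage) : bool := t.1.2.

(** The passage through the same double point along the other strand. *)
Definition co (t : passage) : passage := (opp t.1, dual t.2).

Definition sides (w : seq passage) : seq side := [seq t.1 | t <- w].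

Definition is_diagram (A : seq mark) (w : seq passage) :=
  [&& well_paired (sides w), planar (sides w),
      all (fun t => co t \in w) w & all (fun t => t.2 \in A) w].

Record diagram (A : seq mark) := Diagram {
  word :> seq passage;
  diagramP : is_diagram A word
}.

HB.instance Definition _ A := [isSub for @word A].
HB.instance Definition _ A := [Choice of diagram A by <:].

Definition virtual_marks := [:: Over; Under; Virtual].
Definition singular_marks := [:: Over; Under; Virtual; Singular].
Definition flat_marks := [:: Flat; Virtual].

Notation virtual_diagram := (diagram virtual_marks).
Notation singular_diagram := (diagram singular_marks).
Notation flat_diagram := (diagram flat_marks).

(** * Moves *)

Definition ordered (o : bool) (t u : passage) :=
  if o then [:: t; u] else [:: u; t].

(** Marks allowed in a triangle move on strands 1, 2, 3, where [mij] is the mark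
    on strand [i] of its crossing with strand [j]: three classical crossings,
    the strands being stacked in some order; three flat crossings; at least two
    virtual crossings; one singular crossing, the third strand passing over, or
    under, both of its strands. *)
Definition triangle_marks (m12 m13 m23 : mark) :=
  [|| [&& classical m12, classical m13, classical m23
        & (m12 == m13) || (m13 == m23)],
      [&& m12 == Flat, m13 == Flat & m23 == Flat],
      2 <= count (pred1 Virtual) [:: m12; m13; m23],
      [&& m12 == Singular, classical m13 & m23 == m13],
      [&& m23 == Singular, classical m12 & m13 == m12]
    | [&& m13 == Singular, classical m12 & m23 == dual m12]].

(** The local moves, read on words.  Every move is applied below between
    diagrams, i.e. planar words, only; a pattern on the word then occurs in a
    disk of the sphere:
    - [xx] is a monogon;
    - two edges joining [x] to [y] bound a bigon iff, along one of the two
      strands, the other one crosses in opposite senses at [x] and [y];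
    - three edges joining pairwise [x] (on strands 1, 2), [y] (on strands 1, 3)
      and [z] (on strands 2, 3) bound a triangle iff the equations on senses in
      [Omega3] hold, where [o1] says that [x] comes before [y] on strand 1,
      [o2] that [x] comes before [z] on strand 2, and [o3] that [y] comes
      before [z] on strand 3. The move reverses these three orders.
    The marks determine whether the move is a classical, flat, virtual, mixed
    or singular one: [Omega1] and [Omega2] stand for the moves Omega_1, Omega_2,
    their flat and their virtual versions; [Omega3] for Omega_3, its flat and
    virtual versions, the (flat) mixed move Omega_3^m, and S_3, S_3^m.
    In [S2], moving a classical crossing through a singular one along a twist
    preserves its sign, so the strand that was over is under afterwards. *)
Inductive move : seq passage -> seq passage -> Prop :=
| Omega1 p q x of x.2 != Singular :
    move (p ++ [:: x; co x] ++ q) (p ++ q)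
| Omega2 p q r x y o of
    x.2 != Singular & y.2 = x.2 & sense y = ~~ sense x :
    move (p ++ [:: x; y] ++ q ++ ordered o (co x) (co y) ++ r) (p ++ q ++ r)
| Omega3 p q r u x y z o1 o2 o3 of
    triangle_marks x.2 y.2 z.2
    & sense x (+) o1 (+) o2 = sense y (+) o1 (+) o3
    & sense y (+) o1 (+) o3 = sense z (+) o2 (+) o3 :
    move (p ++ ordered o1 x y ++ q ++ ordered o2 (co x) z
            ++ r ++ ordered o3 (co y) (co z) ++ u)
         (p ++ ordered (~~ o1) x y ++ q ++ ordered (~~ o2) (co x) z
            ++ r ++ ordered (~~ o3) (co y) (co z) ++ u)
| OmegaV_tail p q x of x.2 = Virtual :
    move (x :: p ++ co x :: q) (p ++ q)
| OmegaV_head p q x of x.2 = Virtual :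
    move (p ++ x :: q ++ [:: co x]) (p ++ q)
| S2 p q r i j b m o (s : passage := ((i, b), Singular))
    (s' : passage := ((i, ~~ b), Singular))
    (c : passage := ((j, ~~ b), m)) (c' : passage := ((j, b), dual m)) of
    classical m :
    move (p ++ [:: s; c] ++ q ++ ordered o (co s) (co c) ++ r)
         (p ++ [:: c'; s'] ++ q ++ ordered o (co c') (co s') ++ r).

(** Words are considered up to relabelling: this is isotopy of the sphere. *)
Definition relabel (f : nat -> nat) (t : passage) : passage :=
  ((f (label t), sense t), t.2).

Definition step A (D D' : diagram A) : Prop :=
  move D D' \/
  exists2 f, {in map label D &, injective f} & word D' = map (relabel f) D.

(** Travelling from head to tail reverses both strands at each double point,
    hence does not change senses. *)
Definition unoriented_step A (D D' : diagram A) : Prop :=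
  step D D' \/ word D' = rev D.

Section Generated.
Variables (T : choiceType) (R : T -> T -> Prop).

Definition generated : rel T := fun x y => `[< clos_refl_sym_trans T R x y >].

Lemma generated_refl : reflexive generated.
Proof. by move=> x; apply/asboolP/rst_refl. Qed.

Lemma generated_sym : symmetric generated.
Proof. by move=> x y; apply/asboolP/asboolP; apply: rst_sym. Qed.

Lemma generated_trans : transitive generated.
Proof. by move=> y x z /asboolP xy /asboolP yz; apply/asboolP/rst_trans/yz. Qed.

Canonical generated_equiv :=
  EquivRel generated generated_refl generated_sym generated_trans.

End Generated.

Definition virtual_knotoid := {eq_quot (generated (@step virtual_marks))}%qT.
Definition singular_knotoid := {eq_quot (generated (@step singular_marks))}%qT.
Definition flat_knotoid := {eq_quot (generated (@unoriented_step flat_marks))}%qT.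

HB.instance Definition _ := Choice.on virtual_knotoid.
HB.instance Definition _ := Choice.on singular_knotoid.
HB.instance Definition _ := Choice.on flat_knotoid.

Definition virtual_class (D : virtual_diagram) : virtual_knotoid :=
  (\pi_virtual_knotoid D)%qT.
Definition singular_class (D : singular_diagram) : singular_knotoid :=
  (\pi_singular_knotoid D)%qT.
Definition flat_class (D : flat_diagram) : flat_knotoid := (\pi_flat_knotoid D)%qT.

(** * Operations on diagrams *)

Lemma map_diagram A B (f : passage -> passage) w :
  (forall t, (f t).1 = t.1) -> (forall t, co (f t) = f (co t)) ->
  (forall t, t.2 \in A -> (f t).2 \in B) ->
  is_diagram A w -> is_diagram B (map f w).
Proof.
move=> f1 fco fAB /and4P[wp pl cl mA].
have sE : sides (map f w) = sides w by rewrite /sides -map_comp; apply: eq_map.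
apply/and4P; split; rewrite ?sE //; apply/allP => _ /mapP[t tw ->].
  by rewrite fco map_f // (allP cl).
exact/fAB/(allP mA).
Qed.

Definition flatten_passage (t : passage) : passage :=
  (t.1, if classical t.2 then Flat else t.2).

Lemma flatten_subproof (D : virtual_diagram) :
  is_diagram flat_marks (map flatten_passage D).
Proof. by apply: map_diagram (diagramP D); case=> [[l b] []]. Qed.

Definition flatten (D : virtual_diagram) : flat_diagram :=
  Diagram (flatten_subproof D).

Lemma to_singular_subproof (D : virtual_diagram) : is_diagram singular_marks D.
Proof.
by rewrite -[word D]map_id; apply: map_diagram (diagramP D) => //; case=> [[l b] []].
Qed.

Definition to_singular (D : virtual_diagram) : singular_diagram :=
  Diagram (to_singular_subproof D).

(** The sign of a classical crossing is the sense of its over-passage. *)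
Definition resolve_passage (x : nat) (positive : bool) (t : passage) : passage :=
  if (label t == x) && (t.2 == Singular)
  then (t.1, if sense t == positive then Over else Under) else t.

Lemma resolve_subproof x positive (D : singular_diagram) :
  is_diagram singular_marks (map (resolve_passage x positive) D).
Proof.
apply: map_diagram (diagramP D) => [t|[[l b] m]|t]; rewrite /resolve_passage.
- by case: ifP.
- rewrite /co /opp /label /sense /=.
  by case: eqP => //= _; case: m; case: b; case: positive.
- by case: ifP => //; case: ifP.
Qed.

Definition resolve (x : nat) (positive : bool) (D : singular_diagram) :=
  Diagram (resolve_subproof x positive D).

Definition is_singular_crossing (x : nat) (D : singular_diagram) :=
  has (fun t => (label t == x) && (t.2 == Singular)) D.

Definition n_singular (D : singular_diagram) : nat :=
  (count (fun t => t.2 == Singular) D)./2.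

(** Smoothing [w = a x b x d] at [x] yields [a (rev b) d]: the loop [b] gets
    travelled backwards, which changes the sense at the double points that [b]
    goes through exactly once (see [smooth_side]). *)
Definition smooth_passage (b : seq passage) (t : passage) : passage :=
  (smooth_side (sides b) t.1, t.2).

Definition smooth_word (x : nat) (w : seq passage) : seq passage :=
  let i := index x (map label w) in
  let a := take i w in
  let w' := drop i.+1 w in
  let j := index x (map label w') in
  let b := take j w' in
  let d := drop j.+1 w' in
  map (smooth_passage b) a ++ rev (map (smooth_passage b) b)
    ++ map (smooth_passage b) d.

Lemma sides_smooth_word (a b d : seq passage) :
  sides (map (smooth_passage b) a ++ rev (map (smooth_passage b) b)
           ++ map (smooth_passage b) d)
  = smooth_sides (sides a) (sides b) (sides d).
Proof.
have sE w : sides (map (smooth_passage b) w) = map (smooth_side (sides b)) (sides w).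
  by rewrite /sides -!map_comp; apply: eq_map.
by rewrite /smooth_sides /sides !map_cat map_rev -!/(sides _) !sE.
Qed.

Lemma label_split x w : x \in map label w ->
  exists a t c, [/\ w = a ++ t :: c, label t = x &
                    x \notin map label a].
Proof.
elim: w => //= t w IHw; rewrite inE; case: eqP => [-> _|ne].
  by exists [::], t, w.
case/IHw=> a [u [c [-> xu na]]]; exists (t :: a), u, c; split=> //=.
by rewrite inE negb_or na andbT; apply/eqP.
Qed.

Lemma smooth_subproof A x (D : diagram A) : is_diagram A (smooth_word x D).
Proof.
case: D => w /= /and4P[wp pl cl mA]; rewrite /smooth_word.
have [xw|nxw] := boolP (x \in map label w); last first.
  have -> : index x (map label w) = size w by rewrite memNindex ?size_map.
  rewrite take_size drop_oversize //= cats0.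
  have -> : map (smooth_passage [::]) w = w.
    by rewrite -[RHS]map_id; apply: eq_map => -[[l b] m]; rewrite /smooth_passage /smooth_side addbF.
  exact/and4P.
have idx (v v' : seq passage) r : label r = x -> x \notin map label v ->
    index x (map label (v ++ r :: v')) = size v.
  by move=> rx nv; rewrite map_cat index_cat (negbTE nv) /= rx eqxx addn0 size_map.
have [a [t [c [ew tx na]]]] := label_split xw; rewrite {}ew in wp pl cl mA {xw} *.
rewrite idx // take_size_cat // -cat_rcons drop_size_cat ?size_rcons //.
have ctw : co t \in a ++ t :: c by apply: (allP cl); rewrite mem_cat mem_head orbT.
have xc : x \in map label c.
  move: ctw; rewrite mem_cat inE => /or3P[cta|/eqP E|ctc].
  - by case/negP: na; rewrite -tx -[label t]/(label (co t)) map_f.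
  - by have := opp_neq t.1; rewrite -{2}E eqxx.
  - by rewrite -tx -[label t]/(label (co t)) map_f.
have [b [u [d [ec ux nb]]]] := label_split xc; rewrite {}ec in wp pl cl mA {xc ctw} *.
rewrite idx // take_size_cat // -cat_rcons drop_size_cat ?size_rcons //.
have perm_w : perm_eq (a ++ t :: b ++ u :: d) (t :: u :: a ++ b ++ d).
  by apply/seq.permP=> P; rewrite /= !count_cat /= !count_cat /=; lia.
have us : uniq (t.1 :: u.1 :: sides (a ++ b ++ d)).
  by rewrite -(perm_uniq (perm_map fst perm_w)); case/andP: wp.
have etu : u.1 = opp t.1.
  case/andP: us; rewrite inE negb_or => /andP[ntu _] _.
  case: t u tx ux ntu {wp pl cl mA perm_w} => [[l i] m] [[l' i'] m'].
  by rewrite /label /opp /= => -> ->; rewrite xpair_eqE eqxx; case: i i' => [] [].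
have nx v : v \in a ++ b ++ d -> label v != x.
  move=> vw; apply/eqP=> vx.
  have v1 : v.1 \in sides (a ++ b ++ d) by apply: map_f.
  have : v.1 = t.1 \/ v.1 = u.1.
    rewrite etu; case: t v tx vx {us perm_w wp pl cl mA etu vw v1} => [[l i] m] [[l' i'] m'].
    by rewrite /label /opp /= => -> ->; case: i i' => [] []; auto.
  by case=> E; move: us; rewrite /= inE -E v1 ?orbT ?andbF.
pose s := smooth_passage b.
have perm_s : perm_eq (map s a ++ rev (map s b) ++ map s d) (map s (a ++ b ++ d)).
  by rewrite !map_cat perm_cat2l perm_cat2r perm_rev.
have sw : sides (a ++ t :: b ++ u :: d)
    = sides a ++ (x, sense t) :: sides b ++ (x, ~~ sense t) :: sides d.
  rewrite /sides map_cat /= map_cat /= etu.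
  by case: t tx {us perm_w wp pl cl mA etu} => [[l i] m] /= <-.
rewrite sw in wp pl.
apply/and4P; split.
- by rewrite sides_smooth_word; apply: smooth_paired wp.
- by rewrite sides_smooth_word; apply: smooth_planar wp pl.
- apply/allP=> r; rewrite (perm_mem perm_s) => /mapP[v vw ->].
  rewrite (perm_mem perm_s).
  have -> : co (s v) = s (co v) by rewrite /co /s /smooth_passage /smooth_side /opp /= addNb.
  apply: map_f.
  have : co v \in a ++ t :: b ++ u :: d.
    by apply: (allP cl); rewrite (perm_mem perm_w) !inE vw !orbT.
  have := nx _ vw; rewrite -[label v]/(label (co v)) (perm_mem perm_w) !inE => nv.
  by case/or3P=> // /eqP E; move: nv; rewrite E ?tx ?ux eqxx.
- apply/allP=> r; rewrite (perm_mem perm_s) => /mapP[v vw ->] /=.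
  by apply: (allP mA); rewrite (perm_mem perm_w) !inE vw !orbT.
Qed.

Definition smooth A (x : nat) (D : diagram A) : diagram A :=
  Diagram (smooth_subproof x D).

(** * The invariant *)

Local Open Scope ring_scope.

Definition crossing_sign (over : passage) : int := if sense over then 1 else -1.

(** A classical crossing is referred to by its over-passage. *)
Definition writhe (D : virtual_diagram) : int :=
  \sum_(t <- D | t.2 == Over) crossing_sign t.

Definition smoothing_sum (D : virtual_diagram) : {freeg flat_knotoid / int} :=
  \sum_(t <- D | t.2 == Over)
     << crossing_sign t *g flat_class (flatten (smooth (label t) D)) >>
  - << writhe D *g flat_class (flatten D) >>.

(** Computed on some diagram of [K]. *)
Definition smoothing_invariant (K : virtual_knotoid) : {freeg flat_knotoid / int} :=
  smoothing_sum (repr K).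

(** * Vassiliev invariants *)

(** [W] restricted to diagrams with [n] singular crossings is [V^(n)]; such a [W]
    is unique, and resolving at every singular crossing [x] makes the order of
    resolution irrelevant. *)
Definition is_extension (G : zmodType) (V : virtual_knotoid -> G)
    (W : singular_knotoid -> G) : Prop :=
  (forall D, W (singular_class (to_singular D)) = V (virtual_class D)) /\
  (forall D x, is_singular_crossing x D ->
     W (singular_class D) = W (singular_class (resolve x true D))
                            - W (singular_class (resolve x false D))).

Definition Vassiliev_order_le (G : zmodType) (V : virtual_knotoid -> G) (n : int) :=
  exists2 W, is_extension V W
    & forall D, n < (n_singular D)%:Z -> W (singular_class D) = 0.

Definition Vassiliev_of_order (G : zmodType) (V : virtual_knotoid -> G) (n : int) :=
  Vassiliev_order_le V n /\ ~ Vassiliev_order_le V (n - 1).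

(* Main.v *)
(** Writing [F (D)] as the sum of [sgn c * ([D_c] - [D])] over the classical
    crossings [c], where [[D_c] - [D]] only depends on the flat word of [D] and on
    [c], invariance is checked move by move. A crossing that is not involved in a
    move can be smoothed before or after it. The crossing of Omega_1 smooths to
    [D] itself; the two crossings of Omega_2 have opposite signs and equivalent
    smoothings; the smoothings of corresponding crossings on both sides of Omega_3
    are related by two moves Omega_2 or by an isotopy.

    Since flattening forgets crossing changes, the derivative of [F] at one singular
    crossing [c] is [2 ([D_c] - [D])], which does not depend on the other classical
    crossings; hence the second derivative vanishes. The first one does not: the
    signed number of flat crossings with an odd number of passages between their
    two passages is, up to sign, an invariant of flat virtual knotoids, and it
    separates [D_c] from [D] on an example. *)

From HB Require Import structures.
From Stdlib Require Import Relation_Operators.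
Require Import Defs.
From mathcomp Require Import all_boot all_order all_algebra perm zify.
From mathcomp Require Import generic_quotient boolp.
From mathcomp.multinomials Require Import freeg.

Set Implicit Arguments.
Unset Strict Implicit.
Unset Printing Implicit Defensive.

Import GRing.Theory.

(** * Words *)

(** The obstacle is that moves relate planar words only, while classes have to be compared after a
    smoothing that reverses part of the word. Patterns are therefore described independently of
    their place: adjacency carries a Boolean order, deletions filter by label, and Omega3 permutes
    letters. In this form they commute with smoothing up to explicit changes of orders and senses.
    Planarity of the target of a move is then inherited from [smooth_subproof], by exhibiting the
    target as a smoothing. The delicate point is deleting a bigon: planarity is derived when its
    sides are antiparallel, and the triangle case has to be arranged so that one such bigon is
    available. The extension to singular diagrams is not built by successive resolutions. It is the
    single formula [weight], whose coefficients [kappa n] depend on the number [n] of singular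
    crossings. Each move is checked for all [n] at once; the diagrams with no singular crossing then
    give the invariance of F itself, and the resolution formula is a computation with
    coefficients. *)

Lemma coK : involutive co.
Proof. by case=> [[l []] []]. Qed.

Lemma label_co t : label (co t) = label t. Proof. by []. Qed.

Lemma sense_co t : sense (co t) = ~~ sense t. Proof. by []. Qed.

Lemma co_neq t : (co t == t) = false.
Proof. by apply/negP=> /eqP/(congr1 sense); rewrite /sense /=; case: t.1.2. Qed.

Definition paired (w : seq passage) :=
  uniq (sides w) && all (fun t => co t \in w) w.

Lemma diagram_paired A w : is_diagram A w -> paired w.
Proof. by case/and4P=> /andP[uw _] _ cw _; apply/andP. Qed.

Lemma paired_uniq w : paired w -> uniq w.
Proof. by case/andP=> /map_uniq. Qed.

Lemma mem_co w t : paired w -> (co t \in w) = (t \in w).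
Proof.
case/andP=> _ /allP cw; apply/idP/idP => [/cw|/cw //].
by rewrite coK.
Qed.

(** In a paired word the sides are distinct, not only the passages; hence label and sense determine
    a passage, mark included, and the other sense belongs to [co t]. *)
Lemma label_eq w t u : paired w -> t \in w -> u \in w ->
  label u = label t -> u = t \/ u = co t.
Proof.
move=> pw tw uw E.
have inj1 (v v' : passage) : v \in w -> v' \in w -> v.1 = v'.1 -> v = v'.
  move=> vw vw' E1; have us : uniq (sides w) by case/andP: pw.
  rewrite -(nth_index v vw) -[RHS](nth_index v vw'); congr nth; apply/eqP.
  rewrite -(nth_uniq v.1 _ _ us) ?size_map ?index_mem //.
  by rewrite !(nth_map v) ?index_mem // !nth_index // E1.
have [e|ne] := eqVneq (sense u) (sense t); [left | right].
  apply: inj1 => //; move: E e; rewrite /label /sense.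
  by case: (t) (u) => [[l b] m] [[l' b'] m'] /= -> ->.
apply: inj1 => //; rewrite ?mem_co //; move: E ne; rewrite /label /sense.
case: (t) (u) => [[l b] m] [[l' b'] m'] /= ->; rewrite /opp /=.
by case: b b' => [] [].
Qed.

Lemma paired_perm w w' : perm_eq w w' -> paired w = paired w'.
Proof.
move=> pw; rewrite /paired /sides (perm_uniq (perm_map _ pw)) (perm_all _ pw).
by congr andb; apply: eq_all => t; rewrite (perm_mem pw).
Qed.

Lemma notin_label w t : paired w -> forall v, {subset v <= w} ->
  t \in w -> (label t \notin map label v) = (t \notin v) && (co t \notin v).
Proof.
move=> pw v vw tw; rewrite -negb_or; congr negb.
apply/mapP/orP => [[u uv E]|[tv|tv]]; last 2 first.
- by exists t.
- by exists (co t).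
by case: (label_eq pw tw (vw _ uv) (esym E)) => <-; [left | right].
Qed.

(** Each label occurs exactly twice, on a passage and on its [co]. This is the normal form on which
    smoothings are computed, [b] being the loop that gets reversed. *)
Lemma paired_cut w l : paired w -> l \in map label w ->
  exists a t b d, [/\ w = a ++ t :: b ++ co t :: d, label t = l
    & [/\ l \notin map label a, l \notin map label b & l \notin map label d]].
Proof.
move=> pw /label_split[a [t [c [E tl la]]]].
have uw := paired_uniq pw; have tw : t \in w by rewrite E mem_cat mem_head orbT.
have : co t \in w by rewrite mem_co.
rewrite {1}E mem_cat inE co_neq /=; case/orP=> [ta|].
  by case/negP: la; rewrite -tl -[label t]/(label (co t)) map_f.
move=> tc; have [b [d Ec]] : exists b d, c = b ++ co t :: d.
  by case/splitPr: tc => b d; exists b, d.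
exists a, t, b, d; rewrite -{1}Ec; split=> //; rewrite -tl.
have sub v : {subset v <= a ++ t :: c} -> {subset v <= w} by rewrite -E.
move: uw; rewrite E Ec.
rewrite cat_uniq /= mem_cat inE cat_uniq /= !negb_or.
case/and3P=> _ _ /andP[/and3P[tb _ td] /and3P[_ /andP[cb _] /andP[cd _]]].
rewrite tl la -tl !(notin_label pw) ?tb ?td ?cb ?cd //; apply: sub => u ud;
  by rewrite Ec !(mem_cat, inE) ud ?orbT.
Qed.

Definition smoothing (a b d : seq passage) : seq passage :=
  map (smooth_passage b) a ++ rev (map (smooth_passage b) b)
    ++ map (smooth_passage b) d.

Lemma smooth_wordE l a t b u d : label t = l -> label u = l ->
  l \notin map label a -> l \notin map label b ->
  smooth_word l (a ++ t :: b ++ u :: d) = smoothing a b d.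
Proof.
move=> tl ul la lb.
have idx (v v' : seq passage) r : label r = l -> l \notin map label v ->
    index l (map label (v ++ r :: v')) = size v.
  by move=> rx nv; rewrite map_cat index_cat (negbTE nv) /= rx eqxx addn0 size_map.
rewrite /smooth_word idx // take_size_cat // -cat_rcons drop_size_cat ?size_rcons //.
by rewrite idx // take_size_cat // -cat_rcons drop_size_cat ?size_rcons.
Qed.

Definition loop l w :=
  let w' := drop (index l (map label w)).+1 w in take (index l (map label w')) w'.

Lemma loopE l a t b u d : label t = l -> label u = l ->
  l \notin map label a -> l \notin map label b -> loop l (a ++ t :: b ++ u :: d) = b.
Proof.
move=> tl ul la lb; rewrite /loop.
have idx (v v' : seq passage) r : label r = l -> l \notin map label v ->
    index l (map label (v ++ r :: v')) = size v.
  by move=> rx nv; rewrite map_cat index_cat (negbTE nv) /= rx eqxx addn0 size_map.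
by rewrite idx // -cat_rcons drop_size_cat ?size_rcons // idx // take_size_cat.
Qed.

(** Where the reversed loop [b] passes once, just one of the two strands changes direction and the
    senses change; where it passes twice they are restored. Only the parity of the visits
    matters. *)
Definition flips (b : seq passage) (l : nat) := odd (count (fun u => label u == l) b).

Lemma smooth_passageE b t :
  smooth_passage b t = ((label t, sense t (+) flips b (label t)), t.2).
Proof. by rewrite /smooth_passage /smooth_side /flips /sides count_map. Qed.

Lemma label_smooth b t : label (smooth_passage b t) = label t.
Proof. by []. Qed.

Lemma sense_smooth b t :
  sense (smooth_passage b t) = sense t (+) flips b (label t).
Proof. by rewrite smooth_passageE. Qed.

Lemma smooth_passage_co b t : smooth_passage b (co t) = co (smooth_passage b t).
Proof. by rewrite /co /opp !smooth_passageE /sense /= addNb. Qed.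

Lemma smooth_passage_inj b : injective (smooth_passage b).
Proof.
move=> t u; rewrite !smooth_passageE => -[] El + Em; rewrite El.
move=> /addIb Es; case: t u El Es Em => [[l s] m] [[l' s'] m'].
by rewrite /label /sense /= => -> -> ->.
Qed.

Lemma eq_flips b b' l :
  perm_eq (filter (fun u => label u == l) b) (filter (fun u => label u == l) b') ->
  flips b l = flips b' l.
Proof. by move/perm_size; rewrite /flips -!size_filter => ->. Qed.

Lemma flips_notin b l : l \notin map label b -> flips b l = false.
Proof.
move=> lb; rewrite /flips; have /eqP -> : count (fun u => label u == l) b == 0.
  rewrite -leqn0 leqNgt -has_count; apply: contra lb => /hasP[u ub /eqP <-].
  exact: map_f.
by [].
Qed.

Lemma flips_mem w b t : paired w -> uniq b -> {subset b <= w} -> t \in w ->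
  flips b (label t) = (t \in b) (+) (co t \in b).
Proof.
move=> pw ub bw tw; rewrite /flips.
have -> : count (fun u => label u == label t) b = (t \in b) + (co t \in b).
  have I0 : count (predI (pred1 t) (pred1 (co t))) b = 0.
    rewrite -(count_pred0 b); apply: eq_count => u /=.
    by apply/negP=> /andP[/eqP -> ]; rewrite eq_sym co_neq.
  have := count_predUI (pred1 t) (pred1 (co t)) b.
  rewrite I0 addn0 !count_uniq_mem // => <-; apply: eq_in_count => u ub' /=.
  apply/eqP/orP => [/(label_eq pw tw (bw _ ub'))[->|->]|[/eqP->|/eqP->] //].
    by left.
  by right.
by rewrite oddD !oddb.
Qed.

Lemma eq_smooth_passage b b' t : flips b (label t) = flips b' (label t) ->
  smooth_passage b t = smooth_passage b' t.
Proof. by rewrite !smooth_passageE => ->. Qed.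

(** * Adjacent passages *)

(** As in [ordered], [o] tells whether [x] comes before [y]. *)
Definition adj (o : bool) (x y : passage) (w : seq passage) : Prop :=
  exists p q, w = p ++ ordered o x y ++ q.

Lemma adjC o x y w : adj o x y w <-> adj (~~ o) y x w.
Proof. by case: o. Qed.

Lemma ordered_map f o x y : map f (ordered o x y) = ordered o (f x) (f y).
Proof. by case: o. Qed.

Lemma ordered_rev o x y : rev (ordered o x y) = ordered (~~ o) x y.
Proof. by case: o. Qed.

Lemma orderedC o x y : ordered (~~ o) x y = ordered o y x.
Proof. by case: o. Qed.

Lemma mem_ordered o x y t : (t \in ordered o x y) = (t == x) || (t == y).
Proof. by case: o; rewrite !inE // orbC. Qed.

Lemma adj_mem o x y w : adj o x y w -> x \in w /\ y \in w.
Proof.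
by case=> p [q ->]; rewrite !mem_cat !mem_ordered !eqxx ?orbT.
Qed.

Lemma adj_rev o x y w : adj o x y w -> adj (~~ o) x y (rev w).
Proof.
case=> p [q ->]; exists (rev q), (rev p).
by rewrite !rev_cat ordered_rev catA.
Qed.

Lemma adj_map f o x y w : adj o x y w -> adj o (f x) (f y) (map f w).
Proof.
by case=> p [q ->]; exists (map f p), (map f q); rewrite !map_cat ordered_map.
Qed.

Lemma adj_catl o x y v w : adj o x y w -> adj o x y (v ++ w).
Proof. by case=> p [q ->]; exists (v ++ p), q; rewrite !catA. Qed.

Lemma adj_catr o x y v w : adj o x y w -> adj o x y (w ++ v).
Proof. by case=> p [q ->]; exists p, (q ++ v); rewrite -!catA. Qed.

Lemma adj_cut o x y t a c : t != x -> t != y ->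
  adj o x y (a ++ t :: c) -> adj o x y a \/ adj o x y c.
Proof.
move=> tx ty [p [q]].
wlog -> : o x y tx ty / o = true.
  move=> H; case: o; first exact: H.
  by move=> E; case: (H true y x ty tx erefl E) => h; [left | right]; apply/adjC.
elim: a p => [|u a IHa] [|v p] /=.
- by case=> tx'; rewrite tx' eqxx in tx.
- by case=> _ ->; right; exists p, q.
- case=> ->; case: a {IHa} => [|u' a] /= [].
    by move=> tx'; rewrite tx' eqxx in ty.
  by move=> -> _; left; exists [::], a.
by case=> -> /IHa[]; [case=> p' [q' ->]; left; exists (v :: p'), q' | right].
Qed.

Lemma perm_ordered_pair o x y : perm_eq (ordered o x y) [:: x; y].
Proof. by case: o => //; apply/(@seq.permPl _ [:: y; x] [:: x; y]); apply: (perm_catC [:: y]). Qed.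

Lemma perm_ordered o x y p q : perm_eq (p ++ ordered o x y ++ q) (x :: y :: p ++ q).
Proof. by apply/seq.permP=> P; rewrite !count_cat /= !count_cat; case: o => /=; lia. Qed.

Lemma uniq_ordered o x y p q : uniq (p ++ ordered o x y ++ q) ->
  [/\ x != y, x \notin p ++ q, y \notin p ++ q & uniq (p ++ q)].
Proof.
rewrite (perm_uniq (perm_ordered _ _ _ _ _)) /= inE negb_or.
by case/and3P=> /andP[].
Qed.

Section AdjSmoothing.
Variables (a b d : seq passage) (t : passage).
Let w := a ++ t :: b ++ co t :: d.
Hypothesis pw : paired w.

Lemma uniq_cut : [/\ uniq b, {subset a <= w}, {subset b <= w} & {subset d <= w}].
Proof.
have uw := paired_uniq pw; split.
- by move: uw; rewrite cat_uniq /= cat_uniq => /and5P[].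
- by move=> u ua; rewrite mem_cat ua.
- by move=> u ub; rewrite !(mem_cat, inE) ub !orbT.
- by move=> u ud; rewrite !(mem_cat, inE) ud !orbT.
Qed.

(** Neither passage is at the smoothed crossing, so the pair lies inside one of [a], [b], [d]. Only
    [b] is reversed, so the order changes exactly when the pair is in the loop. *)
Lemma adj_smoothing o x y : adj o x y w -> label x != label t -> label y != label t ->
  adj (o (+) (x \in b)) (smooth_passage b x) (smooth_passage b y) (smoothing a b d)
  /\ (x \in b) = (y \in b).
Proof.
move=> xy lx ly; have uw := paired_uniq pw.
have ne r u : label r != label t -> label u = label t -> u != r.
  by move=> lr lu; apply: contra_neq lr => <-.
have nb u : u \in a ++ d -> u \notin b.
  have /perm_uniq : perm_eq w (t :: co t :: b ++ (a ++ d)).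
    by apply/seq.permP=> P; rewrite /w /= !count_cat /= !count_cat /=; lia.
  rewrite uw => /esym/= /and3P[_ _]; rewrite cat_uniq => /and3P[_ /hasPn nb _] uad.
  exact: nb.
rewrite /smoothing.
have [xy'|{}xy] := adj_cut (ne _ _ lx erefl) (ne _ _ ly erefl) xy.
  have [xa ya] := adj_mem xy'.
  rewrite (negbTE (nb x _)) ?mem_cat ?xa // (negbTE (nb y _)) ?mem_cat ?ya //.
  by rewrite addbF; split=> //; apply/adj_catr/adj_map.
have [xy'|xy'] := adj_cut (ne _ (co t) lx erefl) (ne _ (co t) ly erefl) xy;
  have [xa ya] := adj_mem xy'.
  by rewrite xa ya addbT; split=> //; apply/adj_catl/adj_catr/adj_rev/adj_map.
rewrite (negbTE (nb x _)) ?mem_cat ?xa ?orbT // (negbTE (nb y _)) ?mem_cat ?ya ?orbT //.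
by rewrite addbF; split=> //; apply/adj_catl/adj_catl/adj_map.
Qed.

End AdjSmoothing.

(** * Swapping and deleting passages *)

Definition swp (T : eqType) (x y t : T) :=
  if t == x then y else if t == y then x else t.

Lemma swp_id (T : eqType) (x y : T) w : x \notin w -> y \notin w -> map (swp x y) w = w.
Proof.
move=> xw yw; rewrite -[RHS]map_id; apply/eq_in_map => u uw.
by rewrite /swp (negbTE (memPn xw _ uw)) (negbTE (memPn yw _ uw)).
Qed.

Lemma swp_ordered o x y p q : x \notin p ++ q -> y \notin p ++ q ->
  map (swp x y) (p ++ ordered o x y ++ q) = p ++ ordered (~~ o) x y ++ q.
Proof.
rewrite !mem_cat => /norP[xp xq] /norP[yp yq].
rewrite !map_cat ordered_map !swp_id // /swp !eqxx.
by case: eqP => [->|_]; case: o.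
Qed.

Lemma swp_inj (T T' : eqType) (f : T -> T') x y t :
  injective f -> f (swp x y t) = swp (f x) (f y) (f t).
Proof. by move=> fi; rewrite /swp !inj_eq //; case: ifP => // _; case: ifP. Qed.

Lemma swpK (T : eqType) (x y : T) : involutive (swp x y).
Proof.
move=> t; rewrite /swp; case: (eqVneq t x) => [->|tx]; last first.
  case: (eqVneq t y) => [->|ty]; first by rewrite eqxx.
  by rewrite (negbTE tx) (negbTE ty).
by case: (eqVneq y x) => // _; rewrite eqxx.
Qed.

Lemma adj_perm o x y w : uniq w -> adj o x y w ->
  [/\ perm_eq (map (swp x y) w) w & adj (~~ o) x y (map (swp x y) w)].
Proof.
move=> uw [p [q E]]; move: uw; rewrite {}E => uw.
have [_ xpq ypq _] := uniq_ordered uw.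
rewrite swp_ordered //; split; last by exists p, q.
rewrite perm_cat2l perm_cat2r; apply/seq.permP=> P.
by case: o {uw} => /=; lia.
Qed.

Lemma smooth_adj l w o x y : paired w -> l \in map label w ->
  adj o x y w -> label x != l -> label y != l ->
  adj (o (+) (x \in loop l w)) (smooth_passage (loop l w) x)
    (smooth_passage (loop l w) y) (smooth_word l w)
  /\ (x \in loop l w) = (y \in loop l w).
Proof.
move=> pw lw xy; have [a [t [b [d [E <- [la lb ld]]]]]] := paired_cut pw lw.
rewrite {}E in pw xy *; rewrite loopE // smooth_wordE // => lx ly.
exact: (adj_smoothing pw xy).
Qed.

Lemma flips_loop l w t : paired w -> l \in map label w -> t \in w ->
  flips (loop l w) (label t) = (t \in loop l w) (+) (co t \in loop l w).
Proof.
move=> pw lw tw; have [a [u [b [d [E <- [la lb ld]]]]]] := paired_cut pw lw.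
rewrite {}E in pw tw *; rewrite loopE //; have [ub _ bw _] := uniq_cut pw.
exact: flips_mem tw.
Qed.

(** The exchanged passages lie in the same piece of the cut, so the loop keeps the same elements and
    all sense changes stay the same. The last two conclusions allow swaps to be composed, as in
    [tri_swap]. *)
Lemma smooth_swap l w o x y : paired w -> l \in map label w ->
  adj o x y w -> label x != l -> label y != l ->
  [/\ smooth_word l (map (swp x y) w)
       = map (swp (smooth_passage (loop l w) x) (smooth_passage (loop l w) y))
           (smooth_word l w),
     flips (loop l (map (swp x y) w)) =1 flips (loop l w) &
     forall t, (t \in loop l (map (swp x y) w)) = (t \in loop l w)].
Proof.
move=> pw lw xy lx ly; have [_ xyb] := smooth_adj pw lw xy lx ly.
have [a [t [b [d [E tl [la lb ld]]]]]] := paired_cut pw lw.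
rewrite -{}tl in lx ly la lb ld lw xyb *.
rewrite {}E in pw xy xyb *; rewrite loopE // in xyb; rewrite loopE //.
have [ub _ bw _] := uniq_cut pw.
have st u : label u = label t -> swp x y u = u.
  move=> ut; rewrite /swp; case: eqP => [ux|_]; first by rewrite -ux ut eqxx in lx.
  by case: eqP => // uy; rewrite -uy ut eqxx in ly.
have sl v : label t \notin map label v -> label t \notin map label (map (swp x y) v).
  move=> tv; apply/mapP=> -[_ /mapP[u uv ->]]; rewrite /swp.
  case: eqP => _; first by move/eqP; rewrite eq_sym (negbTE ly).
  case: eqP => _; first by move/eqP; rewrite eq_sym (negbTE lx).
  by move=> tu; rewrite tu map_f in tv.
have mb : perm_eq (map (swp x y) b) b.
  have [xb|xb] := boolP (x \in b); last first.
    have yb : y \notin b by rewrite -xyb.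
    by rewrite swp_id.
  apply: uniq_perm; rewrite ?(map_inj_uniq (inv_inj (swpK x y))) //.
  have sb u : u \in b -> swp x y u \in b.
    by rewrite /swp; case: eqP => // _; [rewrite -xyb | case: eqP].
  move=> u; apply/mapP/idP => [[u' /sb u'b ->] //|/sb ub'].
  by exists (swp x y u); rewrite ?swpK.
rewrite map_cat /= map_cat /= !st // loopE ?sl // !smooth_wordE ?sl //.
have fl : flips (map (swp x y) b) =1 flips b.
  by move=> l'; apply: eq_flips; apply: perm_filter.
split=> //; last by move=> u; rewrite (perm_mem mb).
rewrite /smoothing !map_cat map_rev -!map_comp.
have sE u : (smooth_passage (map (swp x y) b) \o swp x y) u =
    (swp (smooth_passage b x) (smooth_passage b y) \o smooth_passage b) u.
  rewrite /= -(swp_inj _ _ _ (@smooth_passage_inj b)).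
  exact: eq_smooth_passage.
by rewrite !(eq_map sE).
Qed.

(** * Flat classes of words *)

Notation is_flat := (is_diagram flat_marks).

Lemma is_flat_nil : is_flat [::].
Proof. by rewrite /is_diagram /planar /n_vertices n_faces_nil. Qed.

(** Words that are not flat diagrams are sent to the class of the empty diagram. *)
Definition cls (w : seq passage) : flat_knotoid :=
  flat_class (insubd (Diagram is_flat_nil) w).

Lemma cls_diagram (D : flat_diagram) : cls D = flat_class D.
Proof. by rewrite /cls (valKd (Diagram is_flat_nil) D). Qed.

Lemma flat_class_eq (D D' : flat_diagram) :
  step D D' -> flat_class D = flat_class D'.
Proof.
by move=> st; apply/eqmodP/asboolP/rst_step; left.
Qed.

Lemma cls_move w w' : is_flat w -> is_flat w' -> move w w' -> cls w = cls w'.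
Proof.
move=> fw fw' mv; rewrite (cls_diagram (Diagram fw)) (cls_diagram (Diagram fw')).
by apply: flat_class_eq; left.
Qed.

Lemma cls_relabel f w : is_flat w -> is_flat (map (relabel f) w) ->
  {in map label w &, injective f} -> cls (map (relabel f) w) = cls w.
Proof.
move=> fw fw' inj_f.
rewrite (cls_diagram (Diagram fw)) (cls_diagram (Diagram fw')).
by apply/esym/flat_class_eq; right; exists f.
Qed.

Lemma flat_paired w : is_flat w -> paired w.
Proof. exact: diagram_paired. Qed.

Lemma flat_smooth l w : is_flat w -> is_flat (smooth_word l w).
Proof. by move=> fw; apply: (smooth_subproof l (Diagram fw)). Qed.

Lemma flat_mark w t : is_flat w -> t \in w -> t.2 = Flat \/ t.2 = Virtual.
Proof.
case/and4P=> _ _ _ /allP mw /mw; rewrite !inE.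
by case/orP=> /eqP; [left | right].
Qed.

Lemma flat_co w t : is_flat w -> t \in w -> (co t).2 = t.2.
Proof. by move=> fw /(flat_mark fw)[] /= ->. Qed.

(** * Order-free moves *)

Lemma label_neq x y : label x != label y -> (x == y) = false.
Proof. by apply: contra_neqF => /eqP ->. Qed.

(** The deletions of Omega1, Omega2 and OmegaV, written as a filter on labels so that they commute
    with concatenation, reversal and smoothing. *)
Definition del (L : seq nat) (w : seq passage) : seq passage :=
  filter ((fun l => l \notin L) \o label) w.

Lemma del_cat L w w' : del L (w ++ w') = del L w ++ del L w'.
Proof. exact: filter_cat. Qed.

Lemma del_id L w : {in w, forall t, label t \notin L} -> del L w = w.
Proof. by move=> Lw; apply/all_filterP/allP. Qed.

Lemma flips_del L b l : l \notin L -> flips (del L b) l = flips b l.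
Proof.
move=> lL; apply: eq_flips; rewrite -filter_predI.
rewrite (@eq_filter _ _ (fun u => label u == l)) // => u /=.
by case: eqP => //= ->.
Qed.

(** Deleting other labels from the loop does not change how often it visits a remaining one, so the
    surviving passages undergo the same sense changes. *)
Lemma del_smoothing L a b d :
  del L (smoothing a b d) = smoothing (del L a) (del L b) (del L d).
Proof.
have dE v : del L (map (smooth_passage b) v) = map (smooth_passage (del L b)) (del L v).
  rewrite /del filter_map (@eq_filter _ (preim _ _) ((fun l => l \notin L) \o label)) //.
  apply/eq_in_map => t; rewrite mem_filter => /andP[/= tL _].
  by apply: eq_smooth_passage; rewrite -/(del L b) flips_del.
by rewrite /smoothing !del_cat /del filter_rev -!/(del L _) !dE.
Qed.

Lemma smooth_del L l w : paired w -> l \in map label w -> l \notin L ->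
  smooth_word l (del L w) = del L (smooth_word l w).
Proof.
move=> pw lw lL; have [a [t [b [d [E tl [la lb _]]]]]] := paired_cut pw lw.
have lD v : l \notin map label v -> l \notin map label (del L v).
  by apply: contra => /mapP[u]; rewrite mem_filter => /andP[_ uv] ->; apply: map_f.
have dt u : label u = l -> del L [:: u] = [:: u] by rewrite /del /= => ->; rewrite lL.
have -> : del L w = del L a ++ t :: del L b ++ co t :: del L d.
  by rewrite E -[t :: _]cat1s -[co t :: _]cat1s !del_cat !dt.
by rewrite E !smooth_wordE ?lD // del_smoothing.
Qed.

Lemma del1_id w x v : paired w -> x \in w -> {subset v <= w} ->
  x \notin v -> co x \notin v -> del [:: label x] v = v.
Proof.
move=> pw xw vw xv cxv; apply: del_id => u uv; rewrite inE.
by apply/negP=> /eqP/(label_eq pw xw (vw _ uv))[eu|eu]; rewrite eu ?(negbTE xv) ?(negbTE cxv) in uv.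
Qed.

Lemma smoothing_nil a d : smoothing a [::] d = a ++ d.
Proof.
have sE v : map (smooth_passage [::]) v = v.
  rewrite -[RHS]map_id; apply: eq_map => -[[l s] m].
  by rewrite /smooth_passage /smooth_side addbF.
by rewrite /smoothing !sE.
Qed.

Lemma del_monogon o x w p q : paired w -> w = p ++ ordered o x (co x) ++ q ->
  del [:: label x] w = p ++ q.
Proof.
move=> pw E; have xx : adj o x (co x) w by exists p, q.
have [xw _] := adj_mem xx; have : uniq w by apply: paired_uniq.
rewrite {1}E => /uniq_ordered[_ + + _]; rewrite !mem_cat => /norP[xp xq] /norP[cxp cxq].
have [sp sq] : {subset p <= w} /\ {subset q <= w}.
  by rewrite E; split=> u uv; rewrite !mem_cat uv ?orbT.
rewrite E !del_cat (del1_id pw xw sp) // (del1_id pw xw sq) //.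
by case: (o); rewrite /del /= !inE eqxx.
Qed.

Lemma smooth_monogon o x w : paired w -> adj o x (co x) w ->
  smooth_word (label x) w = del [:: label x] w.
Proof.
move=> pw xx; have [p [q E]] := xx; rewrite (del_monogon pw E).
have [xw _] := adj_mem xx; have uw := paired_uniq pw.
have sp : {subset p <= w} by rewrite E => u up; rewrite !mem_cat up.
have := uw; rewrite E => /uniq_ordered[_ + + _].
rewrite !mem_cat => /norP[xp xq] /norP[cxp cxq].
have lp : label x \notin map label p by rewrite (notin_label pw) // xp.
by case: (o); rewrite /= (@smooth_wordE _ p _ [::]) // smoothing_nil.
Qed.

(** Smoothing a monogon reverses an empty loop, hence is its deletion; planarity is inherited from
    smoothing. *)
Lemma flat_del_monogon o x w : is_flat w -> adj o x (co x) w ->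
  is_flat (del [:: label x] w).
Proof.
by move=> fw xx; rewrite -(smooth_monogon (flat_paired fw) xx); apply: flat_smooth.
Qed.

Lemma monogon_cls o x w : is_flat w -> adj o x (co x) w -> cls w = cls (del [:: label x] w).
Proof.
wlog -> : o x / o = true.
  move=> H fw; case: o => [|xx]; first exact: H.
  by rewrite (H true (co x)) // coK.
move=> fw xx; have [xw _] := adj_mem xx; have fw' := flat_del_monogon fw xx.
have [p [q E]] := xx; have dE := del_monogon (flat_paired fw) E.
rewrite dE in fw' *; apply: cls_move => //; rewrite E; apply: Omega1.
by case: (flat_mark fw xw) => ->.
Qed.

Lemma adj_cut_ordered o o' x y z u p q : uniq [:: x; y; z; u] ->
  adj o' z u (p ++ ordered o x y ++ q) -> adj o' z u p \/ adj o' z u q.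
Proof.
rewrite /= !inE !negb_or -!andbA; case/and5P=> _ + + + /andP[+ _].
wlog -> : o x y / o = true.
  move=> H; case: o => [|xz xu yz yu h]; first exact: H.
  exact: (H true y x).
move=> xz xu yz yu h; have [|{}h] := adj_cut xz xu h; first by left.
have [[p' [q' E]]|] := @adj_cut _ _ _ _ [::] _ yz yu h; last by right.
by move: E; case: (o') p' => [] [|? ?].
Qed.

Lemma two_blocks o o' x y z u w : uniq [:: x; y; z; u] ->
  adj o x y w -> adj o' z u w -> exists p q r,
    w = p ++ ordered o x y ++ q ++ ordered o' z u ++ r \/
    w = p ++ ordered o' z u ++ q ++ ordered o x y ++ r.
Proof.
move=> U [p [q ->]] /(adj_cut_ordered U)[] [p' [q' ->]].
  by exists p', q', q; right; rewrite -!catA.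
by exists p, p', q'; left.
Qed.

Lemma perm_blocks (T : eqType) (a b c a' b' c' p q r u : seq T)
    (N := a' ++ b' ++ c' ++ p ++ q ++ r ++ u) :
  perm_eq a a' -> perm_eq b b' -> perm_eq c c' ->
  [/\ [/\ perm_eq (p ++ a ++ q ++ b ++ r ++ c ++ u) N,
          perm_eq (p ++ a ++ q ++ c ++ r ++ b ++ u) N &
          perm_eq (p ++ c ++ q ++ a ++ r ++ b ++ u) N],
      perm_eq (p ++ b ++ q ++ a ++ r ++ c ++ u) N,
      perm_eq (p ++ b ++ q ++ c ++ r ++ a ++ u) N &
      perm_eq (p ++ c ++ q ++ b ++ r ++ a ++ u) N].
Proof.
move=> /seq.permP ha /seq.permP hb /seq.permP hc.
by split; first split; apply/seq.permP=> P; rewrite !count_cat ha hb hc; lia.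
Qed.

(** * Bigons *)

Lemma co_uniq x y : label x != label y -> uniq [:: x; y; co x; co y].
Proof.
move=> lxy; rewrite /= !inE !negb_or -!andbA (eq_sym x (co x)) (eq_sym y (co y)).
by rewrite !co_neq !label_neq // eq_sym.
Qed.

(** The pattern of Omega2, without prescribing which strand is met first nor which vertex comes
    first on it. The strands are parallel if [o' = o] and antiparallel otherwise. *)
Record bigon (x y : passage) (o o' : bool) (w : seq passage) : Prop := Bigon {
  bigon_labels : label x != label y;
  bigon_adj : adj o x y w;
  bigon_adj_co : adj o' (co x) (co y) w;
  bigon_mark : y.2 = x.2;
  bigon_sense : sense y = ~~ sense x
}.

Lemma bigonC x y o o' w : bigon x y o o' w -> bigon y x (~~ o) (~~ o') w.
Proof.
case=> lxy /adjC a /adjC a' m s; split=> //; first by rewrite eq_sym.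
by rewrite s negbK.
Qed.

Lemma bigon_co x y o o' w : is_flat w -> bigon x y o o' w -> bigon (co x) (co y) o' o w.
Proof.
move=> fw [lxy a a' m s]; have [xw yw] := adj_mem a.
by split; rewrite ?coK ?(flat_co fw) // !sense_co s.
Qed.

(** Exchanging the two vertices, or the two strands, brings any bigon to the form read by [Omega2]:
    [x y] first, in this order. *)
Lemma bigon_wlog (P : passage -> passage -> bool -> bool -> Prop) w : is_flat w ->
  (forall x y o o', P y x (~~ o) (~~ o') -> P x y o o') ->
  (forall x y o o', P (co x) (co y) o' o -> P x y o o') ->
  (forall x y o' p q r, bigon x y true o' w ->
     w = p ++ [:: x; y] ++ q ++ ordered o' (co x) (co y) ++ r -> P x y true o') ->
  forall x y o o', bigon x y o o' w -> P x y o o'.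
Proof.
move=> fw PC Pco PT x y o o' B.
have PB x' y' o1 o2 p q r : bigon x' y' o1 o2 w ->
    w = p ++ ordered o1 x' y' ++ q ++ ordered o2 (co x') (co y') ++ r -> P x' y' o1 o2.
  case: o1 => B' E; first exact: PT B' E.
  by apply: PC; apply: (PT _ _ _ p q r (bigonC B')); rewrite orderedC.
have [p [q [r [E|E]]]] := two_blocks (co_uniq (bigon_labels B)) (bigon_adj B) (bigon_adj_co B).
  exact: PB B E.
by apply: Pco; apply: (PB _ _ _ _ p q r (bigon_co fw B)); rewrite !coK.
Qed.

Lemma label_neqP w x y : paired w -> x \in w -> y \in w -> y != x -> y != co x ->
  label x != label y.
Proof.
move=> pw xw yw yx ycx; apply/eqP => /esym/(label_eq pw xw yw)[] /eqP.
  by rewrite (negbTE yx).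
by rewrite (negbTE ycx).
Qed.

Lemma bigon_form o' x y w p q r : paired w ->
  w = p ++ [:: x; y] ++ q ++ ordered o' (co x) (co y) ++ r ->
  [/\ label x != label y, {subset p ++ q ++ r <= w},
      {in p ++ q ++ r, forall t, label t \notin [:: label x; label y]}
    & del [:: label x; label y] w = p ++ q ++ r].
Proof.
move=> pw E; have pe : perm_eq w ([:: x; y; co x; co y] ++ p ++ q ++ r).
  rewrite E; have := perm_blocks p q r [::] (perm_ordered_pair true x y)
    (perm_ordered_pair o' (co x) (co y)) (perm_refl [::]).
  by case=> -[+ _ _] _ _ _; rewrite /= !cats0.
have mw t : t \in [:: x; y; co x; co y] -> t \in w.
  by rewrite (perm_mem pe) mem_cat => ->.
have xw : x \in w by apply: mw; rewrite mem_head.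
have yw : y \in w by apply: mw; rewrite !inE eqxx orbT.
have := paired_uniq pw; rewrite (perm_uniq pe) cat_uniq has_sym => /and3P[uxy np _].
have lxy : label x != label y.
  move: uxy; rewrite /= !inE !negb_or => /and3P[/and3P[xy _ _] /andP[ycx _] _].
  by apply: label_neqP pw xw yw _ ycx; rewrite eq_sym.
have sw : {subset p ++ q ++ r <= w} by move=> u uv'; rewrite (perm_mem pe) mem_cat uv' orbT.
have lN : {in p ++ q ++ r, forall t, label t \notin [:: label x; label y]}.
  move=> t tv; rewrite !inE; apply: contra np => tl; apply/hasP; exists t => //.
  rewrite /= !inE; case/orP: tl => /eqP; [case/(label_eq pw xw (sw _ tv)) => ->
    | case/(label_eq pw yw (sw _ tv)) => ->]; by rewrite eqxx ?orbT.
have dv v : {subset v <= p ++ q ++ r} -> del [:: label x; label y] v = v.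
  by move=> vs; apply: del_id => u /vs/lN.
have [sp sq sr] : [/\ {subset p <= p ++ q ++ r}, {subset q <= p ++ q ++ r}
    & {subset r <= p ++ q ++ r}].
  by split=> u uv'; rewrite !mem_cat uv' ?orbT.
split=> //; rewrite E !del_cat (dv _ sp) (dv _ sq) (dv _ sr).
by rewrite /del; case: (o'); rewrite /= !inE !eqxx ?orbT.
Qed.

Lemma delC x y w : del [:: label y; label x] w = del [:: label x; label y] w.
Proof. by apply: eq_filter => u; rewrite /= !inE orbC. Qed.

(** Planarity of the deleted word is left as a hypothesis, to be supplied by each use: by the other
    side of a move, by a smoothing of it, or by [flat_del_bigon]. *)
Lemma bigon_cls o o' x y w : is_flat w -> bigon x y o o' w ->
  is_flat (del [:: label x; label y] w) -> cls w = cls (del [:: label x; label y] w).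
Proof.
move=> fw; move: x y o o'.
apply: (bigon_wlog fw) => [x y o o'|//|x y o' p q r [lxy xy cxy mxy sxy] E fw'].
  by rewrite delC.
have [_ _ _ dE] := bigon_form (flat_paired fw) E; rewrite dE in fw' *.
apply: cls_move => //; rewrite E; apply: Omega2 => //.
by case: (flat_mark fw (adj_mem xy).1) => ->.
Qed.

(** When the two sides of a bigon are antiparallel, smoothing both of its
    vertices deletes it, hence deleting it preserves planarity. *)
Lemma flat_del_bigon x y o o' w : is_flat w -> bigon x y o o' w -> o' = ~~ o ->
  is_flat (del [:: label x; label y] w).
Proof.
move=> fw; move: x y o o'.
apply: (bigon_wlog fw) => [x y o o' + E|x y o o' + E|x y o' p q r [lxy _ _ _ _] E oF].
- by rewrite delC E; apply.
- by rewrite E negbK; apply.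
rewrite {}oF /= in E; have pw := flat_paired fw.
have [_ _ lN ->] := bigon_form pw (E : w = p ++ [:: x; y] ++ q ++ ordered false _ _ ++ r).
have [sp sq sr] : [/\ {subset p <= p ++ q ++ r}, {subset q <= p ++ q ++ r}
    & {subset r <= p ++ q ++ r}].
  by split=> u uv'; rewrite !mem_cat uv' ?orbT.
have lx v : {subset v <= p ++ q ++ r} -> label x \notin map label v.
  by move=> vs; apply/mapP=> -[u /vs/lN + e]; rewrite -e mem_head.
have ly v : {subset v <= p ++ q ++ r} -> label y \notin map label v.
  by move=> vs; apply/mapP=> -[u /vs/lN + e]; rewrite -e !inE eqxx orbT.
have := flat_smooth (label y) (flat_smooth (label x) fw).
have -> : w = p ++ x :: (y :: rcons q (co y)) ++ co x :: r.
  by rewrite E -cats1 /= -!catA.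
rewrite (@smooth_wordE (label x)) ?(lx _ sp) //; last first.
  by rewrite map_cons inE map_rcons mem_rcons inE label_co (negbTE lxy) (negbTE (lx _ sq)).
rewrite /smoothing /= map_rcons rev_cons rev_rcons -!cats1 /= -catA.
set b := y :: _; have sl v : map label (map (smooth_passage b) v) = map label v.
  by rewrite -map_comp; apply: eq_map.
rewrite (@smooth_wordE (label y)) ?sl ?map_rev ?mem_rev ?sl ?ly //.
(* The first loop is [y q (co y)], the second one is the reversed [q]. Away from [x] and [y] they
   have the same visits modulo 2, so the two successive sense changes cancel. *)
have s2 v : {subset v <= p ++ q ++ r} ->
    map (smooth_passage (rev (map (smooth_passage b) q))) (map (smooth_passage b) v) = v.
  move=> vs; rewrite -map_comp -[RHS]map_id; apply/eq_in_map => t /vs/lN tl /=.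
  have fl : flips b (label t) = flips q (label t).
    rewrite /flips /b /= count_cat /= label_co addn0.
    by move: tl; rewrite !inE negb_or ![label t == _]eq_sym => /andP[_ /negbTE ->]; rewrite addn0.
  have fq : flips (rev (map (smooth_passage b) q)) (label t) = flips q (label t).
    by rewrite /flips count_rev count_map.
  rewrite [LHS]smooth_passageE label_smooth sense_smooth fq fl addbK.
  by case: (t) => [[]].
by rewrite /smoothing !s2 // -[rev (map _ (rev _))]map_rev revK s2.
Qed.

Lemma del_tail x w p q : paired w -> w = x :: p ++ co x :: q ->
  del [:: label x] w = p ++ q.
Proof.
move=> pw E; have := paired_uniq pw; rewrite E /= mem_cat inE cat_uniq /= !negb_or.
case/andP=> /and3P[xp _ xq] /and3P[_ /andP[cxp _] /andP[cxq _]].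
have [xw sp sq] : [/\ x \in w, {subset p <= w} & {subset q <= w}].
  by rewrite E; split=> [|u uv|u uv]; rewrite !(mem_cat, inE) ?uv ?eqxx ?orbT.
rewrite -[x :: _]cat1s -[co x :: q]cat1s !del_cat.
rewrite (del1_id pw xw sp) // (del1_id pw xw sq) //.
by rewrite /del /= !inE eqxx.
Qed.

Lemma del_head x w p q : paired w -> w = p ++ x :: q ++ [:: co x] ->
  del [:: label x] w = p ++ q.
Proof.
move=> pw E; have uw := paired_uniq pw.
have pe : perm_eq w (x :: co x :: p ++ q).
  have [[+ _ _] _ _ _] := perm_blocks p q [::] [::] (perm_refl [:: x]) (perm_refl [:: co x])
    (perm_refl [::]).
  by rewrite -E /= !cats0.
move: uw; rewrite (perm_uniq pe) /= inE !mem_cat !negb_or.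
case/and3P=> /and3P[_ xp xq] /andP[cxp cxq] _.
have [xw sp sq] : [/\ x \in w, {subset p <= w} & {subset q <= w}].
  by rewrite E; split=> [|u uv|u uv]; rewrite !(mem_cat, inE) ?uv ?eqxx ?orbT.
rewrite E -[x :: _]cat1s !del_cat (del1_id pw xw sp) // (del1_id pw xw sq) //.
by rewrite /del /= !inE eqxx /= cats0.
Qed.

Lemma virtual_tail_cls x w : is_flat (x :: w) -> is_flat (del [:: label x] (x :: w)) ->
  x.2 = Virtual -> cls (x :: w) = cls (del [:: label x] (x :: w)).
Proof.
move=> fw fw' vx; have pw := flat_paired fw.
have : co x \in x :: w by rewrite mem_co // mem_head.
rewrite inE co_neq orFb => cxw; have [p [q E]] : exists p q, w = p ++ co x :: q.
  by case/splitPr: cxw => p q; exists p, q.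
have dE : del [:: label x] (x :: w) = p ++ q by apply: del_tail pw _; rewrite E.
rewrite dE in fw' *; apply: cls_move => //; rewrite E.
exact: OmegaV_tail.
Qed.

Lemma virtual_head_cls x w : is_flat (rcons w x) -> is_flat (del [:: label x] (rcons w x)) ->
  x.2 = Virtual -> cls (rcons w x) = cls (del [:: label x] (rcons w x)).
Proof.
move=> fw fw' vx; have pw := flat_paired fw.
have : co x \in rcons w x by rewrite mem_co // mem_rcons mem_head.
rewrite mem_rcons inE co_neq orFb => cxw.
have [p [q E]] : exists p q, w = p ++ co x :: q.
  by case/splitPr: cxw => p q; exists p, q.
have wE : rcons w x = p ++ co x :: q ++ [:: co (co x)] by rewrite coK E -cats1 -catA.
have dE : del [:: label x] (rcons w x) = p ++ q by apply: del_head pw wE.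
rewrite dE in fw' *; apply: cls_move => //; rewrite wE.
by apply: OmegaV_head; rewrite /= vx.
Qed.

(** * Triangles *)

(** What remains of [triangle_marks] after flattening. Two flat crossings with one virtual crossing
    are left out: this is the forbidden move. *)
Definition flat_triangle_marks (m12 m13 m23 : mark) :=
  [&& m12 == Flat, m13 == Flat & m23 == Flat]
  || (1 < count (pred1 Virtual) [:: m12; m13; m23]).

(** The data of Omega3 without prescribing in which order the three strands are met. Strand 1
    carries [x, y], strand 2 carries [co x, z], strand 3 carries [co y, co z]. *)
Record triangle (x y z : passage) (o1 o2 o3 : bool) (w : seq passage) : Prop := Triangle {
  triangle_labels : [/\ label x != label y, label x != label z & label y != label z];
  triangle_flat : flat_triangle_marks x.2 y.2 z.2;
  triangle_adj1 : adj o1 x y w;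
  triangle_adj2 : adj o2 (co x) z w;
  triangle_adj3 : adj o3 (co y) (co z) w;
  triangle_sense1 : sense x (+) o1 (+) o2 = sense y (+) o1 (+) o3;
  triangle_sense2 : sense y (+) o1 (+) o3 = sense z (+) o2 (+) o3
}.

(** Omega_3 exchanges the letters of three pairs of adjacent passages, wherever
    these pairs are in the word; this form commutes with smoothing. *)
Definition tri_swap (x y z : passage) (w : seq passage) :=
  map (swp x y) (map (swp (co x) z) (map (swp (co y) (co z)) w)).

Lemma tri_swap_cat x y z w w' :
  tri_swap x y z (w ++ w') = tri_swap x y z w ++ tri_swap x y z w'.
Proof. by rewrite /tri_swap !map_cat. Qed.

Lemma tri_swap_id x y z w :
  ~~ has (mem w) [:: x; y; co x; z; co y; co z] -> tri_swap x y z w = w.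
Proof.
rewrite /= !negb_or => /and5P[xw yw cxw zw /and3P[cyw czw _]].
by rewrite /tri_swap !swp_id.
Qed.

Lemma tri_uniq x y z : [/\ label x != label y, label x != label z & label y != label z] ->
  uniq [:: x; y; co x; z; co y; co z].
Proof.
case=> xy xz yz; rewrite /= !inE !negb_or (eq_sym x (co x)) (eq_sym y (co y)).
rewrite (eq_sym z (co z)) !co_neq !label_neq // eq_sym //.
Qed.

Lemma tri_swap_ordered x y z : uniq [:: x; y; co x; z; co y; co z] ->
  [/\ forall o, tri_swap x y z (ordered o x y) = ordered (~~ o) x y,
      forall o, tri_swap x y z (ordered o (co x) z) = ordered (~~ o) (co x) z &
      forall o, tri_swap x y z (ordered o (co y) (co z)) = ordered (~~ o) (co y) (co z)].
Proof.
rewrite /= !inE !negb_or -!andbA.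
do 14!(case/andP=> ?); case/andP=> ? _.
have sym (u v : passage) : u != v -> ((u == v) = false) * ((v == u) = false).
  by move=> uv; rewrite [v == u]eq_sym (negbTE uv).
by split=> -[]; rewrite /tri_swap /ordered /= /swp;
  repeat match goal with
  | |- context [?u == ?u] => rewrite eqxx
  | H : is_true (?u != ?v) |- _ => progress rewrite !(sym _ _ H)
  end.
Qed.

Lemma three_blocks o1 o2 o3 x1 y1 x2 y2 x3 y3 w : uniq [:: x1; y1; x2; y2; x3; y3] ->
  adj o1 x1 y1 w -> adj o2 x2 y2 w -> adj o3 x3 y3 w -> exists p q r u,
  let A := ordered o1 x1 y1 in let B := ordered o2 x2 y2 in let C := ordered o3 x3 y3 in
    (w = p ++ A ++ q ++ B ++ r ++ C ++ u \/ w = p ++ A ++ q ++ C ++ r ++ B ++ u \/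
     w = p ++ C ++ q ++ A ++ r ++ B ++ u) \/
    (w = p ++ B ++ q ++ A ++ r ++ C ++ u \/ w = p ++ B ++ q ++ C ++ r ++ A ++ u \/
     w = p ++ C ++ q ++ B ++ r ++ A ++ u).
Proof.
move=> U a1 a2 a3; have U4 : uniq [:: x1; y1; x2; y2] := mask_uniq U [:: true; true; true; true].
have U13 : uniq [:: x1; y1; x3; y3] :=
  mask_uniq U [:: true; true; false; false; true; true].
have U23 : uniq [:: x2; y2; x3; y3] := mask_uniq U [:: false; false; true; true; true; true].
have [p [q [r []]]] := two_blocks U4 a1 a2 => E; rewrite E in a3.
  have [[p' [q' Ep]]|{}a3] := adj_cut_ordered U13 a3.
    by exists p', q', q, r; left; right; right; rewrite E Ep -!catA.
  have [[p' [q' Ep]]|[p' [q' Ep]]] := adj_cut_ordered U23 a3.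
    by exists p, p', q', r; left; right; left; rewrite E Ep -!catA.
  by exists p, q, p', q'; left; left; rewrite E Ep -?catA.
have [[p' [q' Ep]]|{}a3] := adj_cut_ordered U23 a3.
  by exists p', q', q, r; right; right; right; rewrite E Ep -!catA.
have [[p' [q' Ep]]|[p' [q' Ep]]] := adj_cut_ordered U13 a3.
  by exists p, p', q', r; right; right; left; rewrite E Ep -!catA.
by exists p, q, p', q'; right; left; rewrite E Ep -?catA.
Qed.

Lemma flat_triangle_marksP m12 m13 m23 : flat_triangle_marks m12 m13 m23 ->
  (m12 = Flat \/ m12 = Virtual) -> (m13 = Flat \/ m13 = Virtual) ->
  (m23 = Flat \/ m23 = Virtual) ->
  [/\ [/\ triangle_marks m12 m13 m23, triangle_marks m12 m23 m13
      & triangle_marks m13 m12 m23], triangle_marks m13 m23 m12,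
      triangle_marks m23 m12 m13 & triangle_marks m23 m13 m12].
Proof. by move=> h [] ? [] ? [] ?; subst; move: h. Qed.

Ltac check_senses s1 s2 x y z o1 o2 o3 := move: s1 s2; case: (sense x); case: (sense y);
  case: (sense z); case: (o1); case: (o2); case: (o3).

Lemma tri_swap_form x y z w p q r u : paired w ->
  [/\ label x != label y, label x != label z & label y != label z] ->
  perm_eq w ([:: x; y; co x; z; co y; co z] ++ p ++ q ++ r ++ u) ->
  [/\ tri_swap x y z p = p, tri_swap x y z q = q, tri_swap x y z r = r
    & tri_swap x y z u = u].
Proof.
move=> pw lab pe; have := paired_uniq pw; rewrite (perm_uniq pe) cat_uniq.
case/and3P=> _ /hasPn np _.
by split; apply: tri_swap_id; rewrite has_sym; apply/hasPn => t tp; apply: np;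
  rewrite !mem_cat tp ?orbT.
Qed.

Lemma triangle_form x y z o1 o2 o3 w p q r u : paired w ->
  w = p ++ ordered o1 x y ++ q ++ ordered o2 (co x) z ++ r ++ ordered o3 (co y) (co z) ++ u ->
  [/\ label x != label y, label x != label z & label y != label z] /\
  tri_swap x y z w = p ++ ordered (~~ o1) x y ++ q ++ ordered (~~ o2) (co x) z ++ r
    ++ ordered (~~ o3) (co y) (co z) ++ u.
Proof.
move=> pw E.
have pe : perm_eq w ([:: x; y; co x; z; co y; co z] ++ p ++ q ++ r ++ u).
  by rewrite E; have [[]] := perm_blocks p q r u (perm_ordered_pair o1 x y)
    (perm_ordered_pair o2 (co x) z) (perm_ordered_pair o3 (co y) (co z)).
have mw t : t \in [:: x; y; co x; z; co y; co z] -> t \in w.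
  by move=> tl; rewrite (perm_mem pe) mem_cat tl.
have xw : x \in w by apply: mw; rewrite !inE eqxx ?orbT.
have yw : y \in w by apply: mw; rewrite !inE eqxx ?orbT.
have zw : z \in w by apply: mw; rewrite !inE eqxx ?orbT.
have lab : [/\ label x != label y, label x != label z & label y != label z].
  have := paired_uniq pw; rewrite (perm_uniq pe) cat_uniq => /andP[+ _].
  rewrite /= !inE !negb_or -!andbA; do 14!(case/andP=> ?); case/andP=> ? _.
  by split; apply: (label_neqP pw) => //; rewrite eq_sym.
split=> //; have [T1 T2 T3] := tri_swap_ordered (tri_uniq lab).
by rewrite E !tri_swap_cat T1 T2 T3; have [-> -> -> ->] := tri_swap_form pw lab pe.
Qed.

(** [Omega3] numbers the strands in their order of appearance. In each of the six orders the strands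
    are renumbered: the new [x', y', z'] are passages of the same crossings on the renumbered
    strands, and an order is negated when the two crossings on its strand exchange names. *)
Lemma triangle_cls x y z o1 o2 o3 w : is_flat w -> is_flat (tri_swap x y z w) ->
  triangle x y z o1 o2 o3 w -> cls w = cls (tri_swap x y z w).
Proof.
move=> fw fw' [lab mk a1 a2 a3 s1 s2]; have pw := flat_paired fw.
have uxyz := tri_uniq lab.
have [xw yw] := adj_mem a1; have [cxw zw] := adj_mem a2; have [cyw czw] := adj_mem a3.
have [[t123 t132 t213] t231 t312 t321] :=
  flat_triangle_marksP mk (flat_mark fw xw) (flat_mark fw yw) (flat_mark fw zw).
have fcx := flat_co fw xw; have fcy := flat_co fw yw; have fcz := flat_co fw zw.
have [T1 T2 T3] := tri_swap_ordered uxyz.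
have mv p q r u x' y' z' o1' o2' o3' w' : w' = tri_swap x y z w ->
    triangle_marks x'.2 y'.2 z'.2 ->
    sense x' (+) o1' (+) o2' = sense y' (+) o1' (+) o3' ->
    sense y' (+) o1' (+) o3' = sense z' (+) o2' (+) o3' ->
    w = p ++ ordered o1' x' y' ++ q ++ ordered o2' (co x') z' ++ r
          ++ ordered o3' (co y') (co z') ++ u ->
    w' = p ++ ordered (~~ o1') x' y' ++ q ++ ordered (~~ o2') (co x') z' ++ r
          ++ ordered (~~ o3') (co y') (co z') ++ u ->
    cls w = cls (tri_swap x y z w).
  move=> Ew' mk' s1' s2' E E'; apply: cls_move => //.
  by rewrite -Ew' E E'; apply: Omega3.
have [p [q [r [u]]]] := three_blocks uxyz a1 a2 a3.
have pe : perm_eq w ([:: x; y; co x; z; co y; co z] ++ p ++ q ++ r ++ u) ->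
    [/\ tri_swap x y z p = p, tri_swap x y z q = q, tri_swap x y z r = r
      & tri_swap x y z u = u] by apply: tri_swap_form.
have [ss1 ss2 ss3] : [/\ sense (co x) = ~~ sense x, sense (co y) = ~~ sense y
  & sense (co z) = ~~ sense z] by [].
case=> [[|[]]|[|[]]] E;
  (have [|ip iq ir iu] := pe; first by rewrite E; have [[]] := perm_blocks p q r u
     (perm_ordered_pair o1 x y) (perm_ordered_pair o2 (co x) z) (perm_ordered_pair o3 (co y) (co z)));
  have Ew' := congr1 (tri_swap x y z) E;
  rewrite !tri_swap_cat !(T1, T2, T3) ip iq ir iu in Ew'.
- by apply: (mv p q r u x y z o1 o2 o3 _ (erefl _)).
- by apply: (mv p q r u y x (co z) (~~ o1) o3 o2 _ (erefl _));
    rewrite ?coK ?orderedC ?Ew' ?fcx ?fcy ?fcz ?negbK ?ss1 ?ss2 ?ss3 //;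
    check_senses s1 s2 x y z o1 o2 o3.
- by apply: (mv p q r u (co y) (co z) x o3 (~~ o1) (~~ o2) _ (erefl _));
    rewrite ?coK ?orderedC ?Ew' ?fcx ?fcy ?fcz ?negbK ?ss1 ?ss2 ?ss3 //;
    check_senses s1 s2 x y z o1 o2 o3.
- by apply: (mv p q r u (co x) z y o2 o1 (~~ o3) _ (erefl _));
    rewrite ?coK ?orderedC ?Ew' ?fcx ?fcy ?fcz ?negbK ?ss1 ?ss2 ?ss3 //;
    check_senses s1 s2 x y z o1 o2 o3.
- by apply: (mv p q r u z (co x) (co y) (~~ o2) (~~ o3) o1 _ (erefl _));
    rewrite ?coK ?orderedC ?Ew' ?fcx ?fcy ?fcz ?negbK ?ss1 ?ss2 ?ss3 //;
    check_senses s1 s2 x y z o1 o2 o3.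
- by apply: (mv p q r u (co z) (co y) (co x) (~~ o3) (~~ o2) (~~ o1) _ (erefl _));
    rewrite ?coK ?orderedC ?Ew' ?fcx ?fcy ?fcz ?negbK ?ss1 ?ss2 ?ss3 //;
    check_senses s1 s2 x y z o1 o2 o3.
Qed.

Lemma swpC (T : eqType) (x y : T) : swp x y =1 swp y x.
Proof. by move=> t; rewrite /swp; case: eqP => [->|//]; case: eqP => // ->. Qed.

Lemma swp_comm (T : eqType) (x y z u : T) : uniq [:: x; y; z; u] ->
  forall t, swp x y (swp z u t) = swp z u (swp x y t).
Proof.
rewrite /= !inE !negb_or -!andbA => /and5P[_ xz xu yz /andP[yu _]] t.
rewrite /swp; case: (eqVneq t z) => [->|tz].
  by rewrite ![_ == x]eq_sym ![_ == y]eq_sym (negbTE xz) (negbTE xu) (negbTE yz) (negbTE yu) eqxx.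
case: (eqVneq t u) => [->|tu].
  rewrite ![_ == x]eq_sym ![_ == y]eq_sym (negbTE xz) (negbTE xu) (negbTE yz) (negbTE yu) eqxx.
  by case: eqP => // ->.
case: (eqVneq t x) => [_|tx]; first by rewrite (negbTE yz) (negbTE yu).
case: (eqVneq t y) => [_|ty]; first by rewrite (negbTE xz) (negbTE xu).
by rewrite (negbTE tz) (negbTE tu).
Qed.

(** * Smoothing away from a move *)

Lemma label_mem w t : t \in w -> label t \in map label w.
Proof. exact: map_f. Qed.

Lemma perm_adj_swp o x y w : uniq w -> adj o x y w -> perm_eq (map (swp x y) w) w.
Proof. by move=> uw /(adj_perm uw)[]. Qed.

Lemma adj_swp o x y z u w : uniq [:: x; y; z; u] -> adj o x y w ->
  adj o x y (map (swp z u) w).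
Proof.
rewrite /= !inE !negb_or -!andbA => /and5P[_ xz xu yz /andP[yu _]].
by move/(adj_map (swp z u)); rewrite /swp (negbTE xz) (negbTE xu) (negbTE yz) (negbTE yu).
Qed.

Section TriangleSwap.
Variables (x y z : passage) (o1 o2 o3 : bool) (w : seq passage).
Hypothesis (pw : paired w) (T : triangle x y z o1 o2 o3 w).
Let w1 := map (swp (co y) (co z)) w.
Let w2 := map (swp (co x) z) w1.

Let U : uniq [:: x; y; co x; z; co y; co z].
Proof. by apply: tri_uniq; case: T. Qed.
Let U12 : uniq [:: x; y; co x; z] := mask_uniq U [:: true; true; true; true].
Let U13 : uniq [:: x; y; co y; co z] :=
  mask_uniq U [:: true; true; false; false; true; true].
Let U23 : uniq [:: co x; z; co y; co z] :=
  mask_uniq U [:: false; false; true; true; true; true].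
Let U32 : uniq [:: co y; co z; co x; z].
Proof. by rewrite -(rot_uniq 2). Qed.
Let U21 : uniq [:: co x; z; x; y].
Proof. by rewrite -(rot_uniq 2). Qed.
Let U31 : uniq [:: co y; co z; x; y].
Proof. by rewrite -(rot_uniq 2). Qed.

Let uw : uniq w. Proof. exact: paired_uniq. Qed.

Let p1 : perm_eq w1 w.
Proof. by apply: perm_adj_swp uw _; apply: triangle_adj3 T. Qed.

Let a21 : adj o2 (co x) z w1.
Proof. by apply: adj_swp U23 _; apply: triangle_adj2 T. Qed.
Let a11 : adj o1 x y w1.
Proof. by apply: adj_swp U13 _; apply: triangle_adj1 T. Qed.

Let p2 : perm_eq w2 w.
Proof. by apply: perm_trans p1; apply: perm_adj_swp a21; rewrite (perm_uniq p1). Qed.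

Let a12 : adj o1 x y w2.
Proof. exact: adj_swp U12 a11. Qed.

Lemma perm_tri_swap : perm_eq (tri_swap x y z w) w.
Proof. by apply: perm_trans p2; apply: perm_adj_swp a12; rewrite (perm_uniq p2). Qed.

(** The move is its own inverse: negating the three orders adds two negations to each side of the
    sense equations. *)
Lemma triangle_tri_swap : triangle x y z (~~ o1) (~~ o2) (~~ o3) (tri_swap x y z w).
Proof.
case: T => lab mk a1 a2 a3 s1 s2; split=> //.
- by apply: (adj_perm _ a12).2; rewrite (perm_uniq p2).
- by apply: adj_swp U21 _; apply: (adj_perm _ a21).2; rewrite (perm_uniq p1).
- by apply: adj_swp U31 _; apply: adj_swp U32 _; apply: (adj_perm uw a3).2.
- by rewrite !addbN !addNb s1 ?addbN ?addNb.
- by rewrite !addbN !addNb s2 ?addbN ?addNb.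
Qed.

Lemma tri_swap_sym : tri_swap (co x) z y w = tri_swap x y z w.
Proof.
rewrite /tri_swap -!map_comp; apply: eq_map => t /=.
rewrite coK (swpC (co z)) (swp_comm U12); congr swp; congr swp.
Qed.

(** Exchange of strands 1 and 2; the two crossings on strand 3 then exchange names, whence
    [~~ o3]. *)
Lemma triangle_sym : triangle (co x) z y o2 o1 (~~ o3) w.
Proof.
case: T => -[xy xz yz] mk a1 a2 a3 s1 s2; split; rewrite ?coK //.
- by split; rewrite // eq_sym.
- move: mk; rewrite /flat_triangle_marks /=; clear.
  by case: (x.2) (y.2) (z.2) => [] [] [].
- exact: (adjC _ _ _ _).1.
- by move: s1 s2; rewrite sense_co;
    case: (sense x) (sense y) (sense z) o1 o2 o3 => [] [] [] [] [] [].
- by move: s1 s2; case: (sense x) (sense y) (sense z) o1 o2 o3 => [] [] [] [] [] [].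
Qed.

Lemma tri_swap_sym23 : tri_swap y x (co z) w = tri_swap x y z w.
Proof.
rewrite /tri_swap -!map_comp; apply: eq_map => t.
by rewrite /= coK -(swp_comm U23) swpC.
Qed.

(** Exchange of strands 2 and 3. With [triangle_sym] it generates all renumberings of the strands,
    so that any vertex can play the role of [x]. *)
Lemma triangle_sym23 : triangle y x (co z) (~~ o1) o3 o2 w.
Proof.
case: T => -[xy xz yz] mk a1 a2 a3 s1 s2; split; rewrite ?coK //.
- by split; rewrite // eq_sym.
- move: mk; rewrite /flat_triangle_marks /=; clear.
  by case: (x.2) (y.2) (z.2) => [] [] [].
- exact: (adjC _ _ _ _).1.
- by move: s1 s2; case: (sense x) (sense y) (sense z) o1 o2 o3 => [] [] [] [] [] [].
- by move: s1 s2; rewrite sense_co;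
    case: (sense x) (sense y) (sense z) o1 o2 o3 => [] [] [] [] [] [].
Qed.

Variable l : nat.
Hypotheses (lw : l \in map label w) (lx : label x != l) (ly : label y != l)
  (lz : label z != l).
Let s := smooth_passage (loop l w).

(** The two passages on a strand are together in the loop or together outside. If [ei] says that
    strand [i] is in it, the order on strand [i] changes by [ei] and the sense at the crossing of
    strands [i] and [j] by [ei (+) ej], so each side of the sense equations is unchanged. *)
Lemma triangle_smooth :
  triangle (s x) (s y) (s z) (o1 (+) (x \in loop l w)) (o2 (+) (z \in loop l w))
    (o3 (+) (co y \in loop l w)) (smooth_word l w).
Proof.
case: T => lab mk a1 a2 a3 s1 s2.
have [b1 e1] := smooth_adj pw lw a1 lx ly.
have [b2 e2] := smooth_adj pw lw a2 lx lz.
have [b3 e3] := smooth_adj pw lw a3 ly lz.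
have [xw yw] := adj_mem a1; have [_ zw] := adj_mem a2.
split; rewrite /s -?smooth_passage_co //; first by rewrite -e2.
- rewrite !sense_smooth !(flips_loop pw lw) // -e1 e2; move: s1; clear.
  by case: (sense x) (sense y) o1 o2 o3 (x \in _) (z \in _) (co y \in _) => [] [] [] [] [] [] [] [].
- rewrite !sense_smooth !(flips_loop pw lw) // -e1 e3; move: s2; clear.
  by case: (sense y) (sense z) o1 o2 o3 (x \in _) (z \in _) (co z \in _) => [] [] [] [] [] [] [] [].
Qed.

Lemma tri_swap_smooth :
  smooth_word l (tri_swap x y z w) = tri_swap (s x) (s y) (s z) (smooth_word l w).
Proof.
have pw1 : paired w1 by rewrite (paired_perm p1).
have pw2 : paired w2 by rewrite (paired_perm p2).
have lw1 : l \in map label w1 by rewrite (perm_mem (perm_map label p1)).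
have lw2 : l \in map label w2 by rewrite (perm_mem (perm_map label p2)).
have a3 := triangle_adj3 T.
have [E1 f1 _] := smooth_swap pw lw a3 ly lz.
have [E2 f2 _] := smooth_swap pw1 lw1 a21 lx lz.
have [E3 f3 _] := smooth_swap pw2 lw2 a12 lx ly.
have s1 t : smooth_passage (loop l w1) t = s t by apply: eq_smooth_passage; rewrite f1.
have s2 t : smooth_passage (loop l w2) t = s t.
  by rewrite -s1; apply: eq_smooth_passage; rewrite f2.
by rewrite /tri_swap E3 E2 E1 !s1 !s2 /s !smooth_passage_co.
Qed.

End TriangleSwap.

Lemma cls_smooth_triangle l x y z o1 o2 o3 w : is_flat w -> is_flat (tri_swap x y z w) ->
  triangle x y z o1 o2 o3 w -> l \in map label w -> label x != l -> label y != l ->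
  label z != l -> cls (smooth_word l w) = cls (smooth_word l (tri_swap x y z w)).
Proof.
move=> fw fw' T lw lx ly lz; have pw := flat_paired fw.
have := triangle_smooth pw T lw lx ly lz; have := flat_smooth l fw'.
by rewrite (tri_swap_smooth pw T) //; apply/triangle_cls/flat_smooth.
Qed.

Lemma cls_smooth_monogon l o x w : is_flat w -> adj o x (co x) w ->
  l \in map label w -> label x != l ->
  cls (smooth_word l w) = cls (smooth_word l (del [:: label x] w)).
Proof.
move=> fw xx lw lx; have pw := flat_paired fw.
have [b _] := smooth_adj pw lw xx lx lx; rewrite smooth_passage_co in b.
have lL : l \notin [:: label x] by rewrite inE eq_sym.
by rewrite (smooth_del pw lw lL) (monogon_cls (flat_smooth l fw) b).
Qed.

(** Both vertices lie on the same two strands, so they undergo the same sense change and their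
    senses remain opposite. *)
Lemma bigon_smooth l o o' x y w (s := smooth_passage (loop l w)) : paired w ->
  bigon x y o o' w -> l \in map label w -> label x != l -> label y != l ->
  bigon (s x) (s y) (o (+) (x \in loop l w)) (o' (+) (co x \in loop l w)) (smooth_word l w).
Proof.
move=> pw [lxy xy cxy mxy sxy] lw lx ly; have [xw yw] := adj_mem xy.
have [b1 e1] := smooth_adj pw lw xy lx ly.
have [b2 e2] := smooth_adj pw lw cxy lx ly; rewrite /s !smooth_passage_co in b2 *.
split=> //; by rewrite !sense_smooth !(flips_loop pw lw) // -e1 -e2 sxy addNb.
Qed.

(** Deletion commutes with smoothing at [l]; hence the planarity that [bigon_cls] asks for is that
    of a smoothing of the deleted word. *)
Lemma cls_smooth_bigon l o o' x y w : is_flat w -> bigon x y o o' w ->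
  is_flat (del [:: label x; label y] w) ->
  l \in map label w -> label x != l -> label y != l ->
  cls (smooth_word l w) = cls (smooth_word l (del [:: label x; label y] w)).
Proof.
move=> fw B fw' lw lx ly; have pw := flat_paired fw.
have lL : l \notin [:: label x; label y] by rewrite !inE negb_or ![l == _]eq_sym lx.
have := flat_smooth l fw'; rewrite smooth_del //.
exact/(bigon_cls (flat_smooth l fw) (bigon_smooth pw B lw lx ly)).
Qed.

(** The first passage is not at the smoothed crossing, so it belongs to the initial piece, which
    smoothing leaves in place. It is still next to the tail afterwards. *)
Lemma cls_smooth_tail l x w : is_flat (x :: w) -> is_flat (del [:: label x] (x :: w)) ->
  x.2 = Virtual -> l \in map label w -> label x != l ->
  cls (smooth_word l (x :: w)) = cls (smooth_word l (del [:: label x] (x :: w))).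
Proof.
move=> fw fw' vx lw lx; have pw := flat_paired fw.
have lxw : l \in map label (x :: w) by rewrite inE lw orbT.
have := flat_smooth l fw'; have := flat_smooth l fw.
have lL : l \notin [:: label x] by rewrite inE eq_sym.
rewrite (smooth_del pw lxw lL).
have [a [t [b [d [E tl [la lb ld]]]]]] := paired_cut pw lxw.
rewrite E smooth_wordE //; case: a E la => [|x' a] /= [xt _] la.
  by rewrite xt tl eqxx in lx.
rewrite -xt /smoothing /= => f f'; exact: (virtual_tail_cls f f').
Qed.

Lemma cls_smooth_head l x w : is_flat (rcons w x) -> is_flat (del [:: label x] (rcons w x)) ->
  x.2 = Virtual -> l \in map label w -> label x != l ->
  cls (smooth_word l (rcons w x)) = cls (smooth_word l (del [:: label x] (rcons w x))).
Proof.
move=> fw fw' vx lw lx; have pw := flat_paired fw.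
have lxw : l \in map label (rcons w x) by rewrite map_rcons mem_rcons inE lw orbT.
have := flat_smooth l fw'; have := flat_smooth l fw.
have lL : l \notin [:: label x] by rewrite inE eq_sym.
rewrite (smooth_del pw lxw lL).
have [a [t [b [d [E tl [la lb ld]]]]]] := paired_cut pw lxw.
rewrite E smooth_wordE //; case/lastP: d E ld => [|d x'] E ld.
  have := congr1 (last x) E; rewrite last_rcons last_cat /= last_cat /= => xt.
  by rewrite xt label_co tl eqxx in lx.
have -> : x' = x.
  by have := congr1 (last x) E; rewrite last_rcons last_cat /= last_cat /= last_rcons.
rewrite /smoothing map_rcons -!rcons_cat => f f'; exact: (virtual_head_cls f f').
Qed.

Lemma smooth_relabel f l w : paired w -> l \in map label w ->
  {in map label w &, injective f} ->
  smooth_word (f l) (map (relabel f) w) = map (relabel f) (smooth_word l w).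
Proof.
move=> pw lw fi; have [a [t [b [d [E tl [la lb ld]]]]]] := paired_cut pw lw.
have [_ sa sb sd] : [/\ uniq b, {subset a <= w}, {subset b <= w} & {subset d <= w}].
  by rewrite E in pw *; apply: uniq_cut pw.
have lf v : {subset v <= w} -> l \notin map label v -> f l \notin map label (map (relabel f) v).
  move=> vw; apply: contra => /mapP[_ /mapP[u uv ->] ful].
  have -> : l = label u by apply: fi => //; apply/label_mem/vw.
  exact: label_mem.
rewrite E map_cat /= map_cat /= (smooth_wordE _ tl (tl : label (co t) = l)) //.
have [tf ctf] : label (relabel f t) = f l /\ label (relabel f (co t)) = f l by rewrite -tl.
rewrite (smooth_wordE _ tf ctf) ?lf //.
have sE v : {subset v <= w} -> map (smooth_passage (map (relabel f) b)) (map (relabel f) v)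
    = map (relabel f) (map (smooth_passage b) v).
  move=> vw; rewrite -!map_comp; apply/eq_in_map => u uv /=.
  rewrite !smooth_passageE /relabel /label /sense /= -/(label u) -/(sense u).
  congr ((_, _ (+) _), _); rewrite /flips count_map; congr odd; apply: eq_in_count => u' ub /=.
  rewrite /label /= -/(label u') -/(label u); apply/eqP/eqP => [|-> //].
  by apply: fi; apply: label_mem; [apply: sb | apply: vw].
by rewrite /smoothing !sE // !map_cat map_rev.
Qed.

(** * Smoothing inside a move *)

Lemma eq_map_smooth b b' v : {in v, forall t, flips b (label t) = flips b' (label t)} ->
  map (smooth_passage b) v = map (smooth_passage b') v.
Proof. by move=> e; apply/eq_in_map => t /e/eq_smooth_passage. Qed.

Lemma map_label_smooth b v : map label (map (smooth_passage b) v) = map label v.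
Proof. by rewrite -map_comp; apply: eq_map. Qed.

Lemma relabel_smooth f b t : relabel f (smooth_passage b t) =
  ((f (label t), sense t (+) flips b (label t)), t.2).
Proof. by rewrite smooth_passageE. Qed.

Lemma relabel_co f t : relabel f (co t) = co (relabel f t).
Proof. by []. Qed.

(** If the strands are parallel, smoothing one vertex turns the other into a monogon, and deleting
    this monogon gives the same word in both cases. If they are antiparallel, the two smoothings
    differ only by exchanging the labels of [x] and [y]. *)
Lemma cls_smooth_bigon_vertices x y o o' w : is_flat w -> bigon x y o o' w ->
  cls (smooth_word (label x) w) = cls (smooth_word (label y) w).
Proof.
move=> fw; move: x y o o'.
apply: (bigon_wlog fw) => // x y o' p q r [lxy xy cxy mxy sxy] E.
have [_ _ lN _] := bigon_form (flat_paired fw) E.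
have [xw yw] := adj_mem xy.
have [sp sq sr] : [/\ {subset p <= p ++ q ++ r}, {subset q <= p ++ q ++ r}
    & {subset r <= p ++ q ++ r}].
  by split=> u uv'; rewrite !mem_cat uv' ?orbT.
have lx v : {subset v <= p ++ q ++ r} -> label x \notin map label v.
  by move=> vs; apply/mapP=> -[u /vs/lN + e]; rewrite -e mem_head.
have ly v : {subset v <= p ++ q ++ r} -> label y \notin map label v.
  by move=> vs; apply/mapP=> -[u /vs/lN + e]; rewrite -e !inE eqxx orbT.
have lyx : label y != label x by rewrite eq_sym.
have F1 := flat_smooth (label x) fw; have F2 := flat_smooth (label y) fw.
(* Passages at [x] or [y] inside the loop have no effect on other labels, so outside the bigon both
   loops act as [q]. *)
have fq b : filter (fun t => label t \notin [:: label x; label y]) b = q ->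
    forall v, {subset v <= p ++ q ++ r} -> map (smooth_passage b) v = map (smooth_passage q) v.
  move=> fb v vs; apply: eq_map_smooth => t tv; rewrite -fb.
  exact/esym/(flips_del b (lN _ (vs _ tv))).
have qq : filter (fun t => label t \notin [:: label x; label y]) q = q.
  by apply/all_filterP/allP => t tq; apply/lN/sq.
case: o' cxy E => cxy E.
  have E1 : w = p ++ x :: (y :: q) ++ co x :: (co y :: r) by rewrite E.
  have E2 : w = rcons p x ++ y :: (rcons q (co x)) ++ co y :: r.
    by rewrite E -!cats1 -!catA.
  move: F1 F2.
  rewrite {1 3}E1 {1 2}E2 (@smooth_wordE (label x)) ?(lx _ sp) //; last first.
    by rewrite map_cons inE (negbTE lxy) (lx _ sq).
  rewrite (@smooth_wordE (label y)) //; last 2 first.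
  - by rewrite map_rcons mem_rcons inE (negbTE lyx) (ly _ sp).
  - by rewrite map_rcons mem_rcons inE (negbTE lyx) (ly _ sq).
  rewrite /smoothing !map_rcons rev_rcons !map_cons rev_cons !smooth_passage_co.
  set t1 := smooth_passage _ y; set t2 := smooth_passage _ x.
  rewrite !(fq (y :: q)) //= ?inE ?eqxx ?orbT ?qq //.
  rewrite !(fq (rcons q (co x))) // ?filter_rcons ?inE ?eqxx ?orbT ?qq //.
  set P := map _ p; set Q := rev _; set R := map _ r => F1 F2.
  have a1 : adj true t1 (co t1) (P ++ rcons Q t1 ++ co t1 :: R).
    by exists (P ++ Q), R; rewrite -cats1 -!catA.
  have a2 : adj true t2 (co t2) (rcons P t2 ++ (co t2 :: Q) ++ R).
    by exists P, (Q ++ R); rewrite -cats1 -!catA.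
  rewrite (monogon_cls F1 a1) (monogon_cls F2 a2); congr cls.
  have dP l v : l \in [:: label x; label y] -> {subset v <= p ++ q ++ r} ->
      del [:: l] (map (smooth_passage q) v) = map (smooth_passage q) v.
    move=> ll vs; apply: del_id => _ /mapP[t tv ->]; rewrite label_smooth inE.
    by apply: contraNneq (lN _ (vs _ tv)) => ->.
  have dQ l : l \in [:: label x; label y] -> del [:: l] Q = Q.
    by move=> ll; rewrite /Q /del filter_rev -/(del _ _) dP.
  have lxL : label x \in [:: label x; label y] by rewrite mem_head.
  have lyL : label y \in [:: label x; label y] by rewrite !inE eqxx orbT.
  rewrite -!cats1 -(cat1s (co t1)) -(cat1s (co t2)) !del_cat !label_smooth.
  rewrite ![del _ P]dP // ![del _ R]dP // !dQ // /del /= !inE.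
  by rewrite /t1 /t2 !label_smooth !eqxx cats0 /= cats0.
have E1 : w = p ++ x :: (y :: rcons q (co y)) ++ co x :: r.
  by rewrite E /= -cats1 -!catA.
have E2 : w = rcons p x ++ y :: q ++ co y :: (co x :: r).
  by rewrite E -!cats1 -!catA.
move: F1 F2.
rewrite {1 3}E1 {1 2}E2 (@smooth_wordE (label x)) ?(lx _ sp) //; last first.
  by rewrite map_cons inE map_rcons mem_rcons inE (negbTE lxy) (lx _ sq).
rewrite (@smooth_wordE (label y)) ?(ly _ sq) //; last first.
  by rewrite map_rcons mem_rcons inE (negbTE lyx) (ly _ sp).
rewrite /smoothing !map_cons !map_rcons rev_cons rev_rcons !smooth_passage_co.
rewrite !(fq (y :: rcons q (co y))) //= ?filter_rcons ?inE ?eqxx ?orbT ?qq //.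
set t1 := smooth_passage _ y; set t2 := smooth_passage _ x.
set P := map _ p; set Q := rev _; set R := map _ r => F1 F2.
pose f := swp (label x) (label y).
have fP v : {subset v <= p ++ q ++ r} ->
    map (relabel f) (map (smooth_passage q) v) = map (smooth_passage q) v.
  move=> vs; rewrite -[RHS]map_id; apply/eq_in_map => _ /mapP[t tv ->].
  rewrite relabel_smooth /f /swp; have := lN _ (vs _ tv); rewrite !inE negb_or.
  by case/andP=> /negbTE -> /negbTE ->; rewrite [RHS]smooth_passageE.
(* The loop visits [y] twice, so its sense is kept, and it is the sense of [co x] since the senses
   in a bigon are opposite. *)
have t1E : relabel f t1 = co t2.
  rewrite relabel_smooth /f /swp (negbTE lyx) eqxx /flips /= -cats1 count_cat /=.
  rewrite label_co eqxx addn0 addn1 add1n /= negbK -/(flips q (label y)).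
  rewrite flips_notin ?(ly _ sq) // addbF /co /t2 smooth_passageE flips_notin ?(lx _ sq) //.
  by rewrite /Defs.opp /= addbF -sxy mxy -[dual x.2]/((co x).2) (flat_co fw xw).
have t1E' : relabel f (co t1) = t2 by rewrite -[t2]coK -t1E.
have fQ : map (relabel f) Q = Q by rewrite map_rev fP.
have E3 : map (relabel f) (P ++ (co t1 :: rcons Q t1) ++ R) = rcons P t2 ++ Q ++ co t2 :: R.
  by rewrite !(map_cat, map_cons, map_rcons) fQ !fP // t1E t1E' -!cats1 /= -!catA.
rewrite -E3 in F2 *; rewrite (cls_relabel F1 F2) // => l l' _ _.
exact: (inv_inj (swpK _ _)).
Qed.

Definition tri (x y z t : passage) := swp x y (swp (co x) z (swp (co y) (co z) t)).

Lemma tri_swapE x y z w : tri_swap x y z w = map (tri x y z) w.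
Proof. by rewrite /tri_swap -!map_comp. Qed.

Lemma triK x y z : uniq [:: x; y; co x; z; co y; co z] -> involutive (tri x y z).
Proof.
move=> U t.
have U12 : uniq [:: x; y; co x; z] := mask_uniq U [:: true; true; true; true].
have U13 : uniq [:: x; y; co y; co z] :=
  mask_uniq U [:: true; true; false; false; true; true].
have U23 : uniq [:: co x; z; co y; co z] :=
  mask_uniq U [:: false; false; true; true; true; true].
rewrite /tri -(swp_comm U13) -(swp_comm U12) swpK.
by rewrite -(swp_comm U23) !swpK.
Qed.

(** * Smoothing the crossing [x] of strands 1 and 2 of a triangle, the third strand being anywhere
    in [P], [Q], [R] *)

Section TriangleVertex.
Variables (x y z : passage) (o2 o3 : bool) (P Q R : seq passage).
Let w := P ++ [:: x; y] ++ Q ++ ordered o2 (co x) z ++ R.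
Let w' := tri_swap x y z w.
Hypotheses (fw : is_flat w) (fw' : is_flat w').
Hypotheses (T : triangle x y z true o2 o3 w) (xF : x.2 = Flat).
Local Notation L := [:: label y; label z].
Local Notation ti := (tri_swap x y z).

Let pw : paired w := flat_paired fw.
Let uw : uniq w := paired_uniq pw.
Let pw' : paired w' := flat_paired fw'.

Let U : uniq [:: x; y; co x; z; co y; co z].
Proof. by apply: tri_uniq; case: T. Qed.

Let lxy : label x != label y. Proof. by case: T => -[]. Qed.
Let lxz : label x != label z. Proof. by case: T => -[]. Qed.
Let lyz : label y != label z. Proof. by case: T => -[]. Qed.
Let lyx : label y != label x. Proof. by rewrite eq_sym. Qed.
Let lzx : label z != label x. Proof. by rewrite eq_sym. Qed.

Let perm_w : perm_eq w ([:: x; y; co x; z] ++ P ++ Q ++ R).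
Proof.
have := perm_blocks P Q R [::] (perm_ordered_pair true x y)
    (perm_ordered_pair o2 (co x) z) (perm_refl [::]).
by case=> -[+ _ _] _ _ _; rewrite /= !cats0.
Qed.

Let xw : x \in w. Proof. by rewrite (perm_mem perm_w) mem_cat !inE eqxx. Qed.
Let yw : y \in w. Proof. by rewrite (perm_mem perm_w) mem_cat !inE eqxx ?orbT. Qed.
Let zw : z \in w. Proof. by rewrite (perm_mem perm_w) mem_cat !inE eqxx ?orbT. Qed.

Let sub_w : {subset P ++ Q ++ R <= w}.
Proof. by move=> t tv; rewrite (perm_mem perm_w) mem_cat tv orbT. Qed.

Let notin t : t \in P ++ Q ++ R -> t \notin [:: x; y; co x; z].
Proof.
move=> tv; apply/negP=> tl; have := uw; rewrite (perm_uniq perm_w) cat_uniq.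
by case/and3P=> _ /hasPn/(_ t tv); rewrite /= tl.
Qed.

Let TO := tri_swap_ordered U.

(** Strands 1 and 2 are displayed in [w], so only strand 3 is left in [P], [Q], [R]: there the move
    exchanges [co y] with [co z] and fixes everything else. *)
Let triP t : t \in P ++ Q ++ R ->
  [\/ t = co y /\ tri x y z t = co z, t = co z /\ tri x y z t = co y |
      [/\ label t != label x, label t \notin L & tri x y z t = t]].
Proof.
move=> tv; have [E1 E2 E3] := TO.
have [ty|ty] := eqVneq t (co y).
  by constructor 1; split=> //; have := E3 true; rewrite tri_swapE /= ty => -[].
have [tz|tz] := eqVneq t (co z).
  by constructor 2; split=> //; have := E3 true; rewrite tri_swapE /= tz => -[].
constructor 3; have := notin tv; rewrite !inE !negb_or => /and4P[tx ty' tcx tz'].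
have tw := sub_w tv; split.
- by apply/eqP=> /(label_eq pw xw tw)[] /eqP; rewrite ?(negbTE tx) ?(negbTE tcx).
- apply/andP; split; apply/eqP.
    by case/(label_eq pw yw tw) => /eqP; rewrite ?(negbTE ty) ?(negbTE ty').
  by case/(label_eq pw zw tw) => /eqP; rewrite ?(negbTE tz) ?(negbTE tz').
by rewrite /tri /swp (negbTE ty) (negbTE tz) (negbTE tcx) (negbTE tz') (negbTE tx) (negbTE ty').
Qed.

Let lx_notin v : {subset v <= P ++ Q ++ R} -> label x \notin map label v.
Proof.
move=> vs; apply/mapP=> -[t tv].
case: (triP (vs _ tv)) => [[-> _]|[-> _]|[+ _ _]] /eqP; rewrite ?label_co.
- by rewrite (negbTE lxy).
- by rewrite (negbTE lxz).
by rewrite eq_sym => /negbTE ->.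
Qed.

Let del_ti v : {subset v <= P ++ Q ++ R} -> del L (ti v) = del L v.
Proof.
elim: v => [//|t v IHv] vs; rewrite -[t :: v]cat1s tri_swap_cat !del_cat.
rewrite IHv => [|u uv]; last by apply: vs; rewrite inE uv orbT.
congr (_ ++ _); rewrite tri_swapE /del /=.
case: (triP (vs _ (mem_head _ _))) => [[-> ->]|[-> ->]|[_ _ -> //]];
  by rewrite !label_co !inE !eqxx ?orbT.
Qed.

Let label_ti v : {subset v <= P ++ Q ++ R} -> label x \notin map label (ti v).
Proof.
move=> vs; rewrite tri_swapE; apply/mapP=> -[_ /mapP[t tv ->]].
case: (triP (vs _ tv)) => [[_ ->]|[_ ->]|[+ _ ->]] /eqP; rewrite ?label_co.
- by rewrite (negbTE lxz).
- by rewrite (negbTE lxy).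
by rewrite eq_sym => /negbTE ->.
Qed.

Let sP : {subset P <= P ++ Q ++ R}.
Proof. by move=> t tv; rewrite !mem_cat tv. Qed.
Let sQ : {subset Q <= P ++ Q ++ R}.
Proof. by move=> t tv; rewrite !mem_cat tv !orbT. Qed.
Let sR : {subset R <= P ++ Q ++ R}.
Proof. by move=> t tv; rewrite !mem_cat tv !orbT. Qed.

(** Since [x] is flat, the allowed marks make the two other crossings both flat or both virtual. *)
Let yz : y.2 = z.2.
Proof.
have := triangle_flat T; rewrite /flat_triangle_marks xF /=.
by case: (flat_mark fw yw) => ->; case: (flat_mark fw zw) => ->.
Qed.

Let mem_ti t v : (tri x y z t \in ti v) = (t \in v).
Proof. by rewrite tri_swapE mem_map //; apply: inv_inj (triK U). Qed.

Let tri_co : tri x y z (co z) = co y.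
Proof. by have [_ _ /(_ true)] := TO; rewrite tri_swapE => -[]. Qed.

Let w'E : w' = ti P ++ [:: y; x] ++ ti Q ++ ordered (~~ o2) (co x) z ++ ti R.
Proof.
by rewrite /w' /w !tri_swap_cat; have [/(_ true) -> -> _] := TO.
Qed.

Let xw' : label x \in map label w'.
Proof. by apply: label_mem; rewrite (perm_mem (perm_tri_swap pw T)). Qed.

Let xlw : label x \in map label w. Proof. exact: label_mem. Qed.

Let zco : (y == co z) = false.
Proof. by apply: label_neq. Qed.

Let yco : (co y == z) = false.
Proof. by apply: label_neq. Qed.

Let mem_yz t : t \in [:: y; z] -> t \notin Q /\ t \notin ti Q.
Proof.
move=> tyz; have tQ : t \notin Q.
  apply/negP=> /sQ/notin/negP[]; move: tyz; rewrite !inE => /orP[] -> //; by rewrite !orbT.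
split=> //; apply/negP; rewrite tri_swapE => /mapP[u uQ tu].
case: (triP (sQ uQ)) tyz => [[_ e]|[_ e]|[_ _ e]]; rewrite tu e.
- by rewrite !inE eq_sym zco co_neq.
- by rewrite !inE co_neq yco.
by move: (notin (sQ uQ)); rewrite !inE !negb_or => /and4P[_ /negbTE -> _ /negbTE ->].
Qed.

Let coy_ti v : (co y \in ti v) = (co z \in v).
Proof. by rewrite -[RHS]mem_ti tri_co. Qed.

Let coz_ti v : (co z \in ti v) = (co y \in v).
Proof.
rewrite -[RHS]mem_ti (_ : tri x y z (co y) = co z) //.
by have [_ _ /(_ true)] := TO; rewrite tri_swapE => -[].
Qed.

Let sense_yz : sense z = sense y (+) ~~ o2.
Proof.
by have := triangle_sense2 T; case: (sense y) (sense z) (o2) (o3) => [] [] [] [].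
Qed.

(** Both smoothings contain a bigon with vertices [y] and [z], and deleting it
    gives the same word. Exactly one of these two bigons is antiparallel, so that
    this word is planar. *)
Lemma cls_smooth_vertex_bigon : o2 = true ->
  cls (smooth_word (label x) w) = cls (smooth_word (label x) w').
Proof.
move=> o2T.
have [/mem_yz[yQ yQ'] /mem_yz[zQ zQ']] : y \in [:: y; z] /\ z \in [:: y; z].
  by rewrite !inE !eqxx orbT.
have E1 : w = P ++ x :: (y :: Q) ++ co x :: (z :: R) by rewrite /w o2T.
have E2 : w' = rcons (ti P) y ++ x :: (rcons (ti Q) z) ++ co x :: ti R.
  by rewrite w'E o2T -!cats1 -!catA.
have lP := lx_notin sP; have lP' := label_ti sP.
have lQ : label x \notin map label (y :: Q) by rewrite map_cons inE (negbTE lxy) (lx_notin sQ).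
have lQ' : label x \notin map label (rcons (ti Q) z).
  by rewrite map_rcons mem_rcons inE (negbTE lxz) (label_ti sQ).
have lPy : label x \notin map label (rcons (ti P) y).
  by rewrite map_rcons mem_rcons inE (negbTE lxy) (label_ti sP).
have b1 : loop (label x) w = y :: Q by rewrite E1 loopE.
have b2 : loop (label x) w' = rcons (ti Q) z by rewrite E2 loopE.
have T' := triangle_tri_swap pw T.
have [a1 e1] := smooth_adj pw xlw (triangle_adj3 T) lyx lzx.
have [a2 e2] := smooth_adj pw' xw' (triangle_adj3 T') lyx lzx.
have [yw' zw'] : y \in w' /\ z \in w' by rewrite !(perm_mem (perm_tri_swap pw T)).
have F1 := flat_smooth (label x) fw; have F2 := flat_smooth (label x) fw'.
have fy1 := flips_loop pw xlw yw; have fz1 := flips_loop pw xlw zw.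
have fy2 := flips_loop pw' xw' yw'; have fz2 := flips_loop pw' xw' zw'.
rewrite b1 in a1 e1 fy1 fz1.
(* Adjacent passages of strand 3 are not separated by the smoothed crossing. *)
have bQ : (co z \in Q) = (co y \in Q).
  by move: e1; rewrite !inE co_neq [co z == y]eq_sym zco.
rewrite b2 in a2 e2 fy2 fz2.
have W1 : smooth_word (label x) w = smoothing P (y :: Q) (z :: R) by rewrite E1 smooth_wordE.
have W2 : smooth_word (label x) w' = smoothing (rcons (ti P) y) (rcons (ti Q) z) (ti R).
  by rewrite E2 smooth_wordE.
rewrite W1 in a1 F1 *; rewrite W2 in a2 F2 *.
have yzF : (y == z) = false by apply: label_neq.
rewrite !inE ?mem_rcons ?inE ?co_neq ?[y == co y]eq_sym ?[z == co z]eq_sym ?co_neq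
  ?eqxx ?yco ?[co z == y]eq_sym ?zco ?[z == y]eq_sym ?yzF ?(negbTE yQ) ?(negbTE yQ')
  ?(negbTE zQ) ?(negbTE zQ') ?coy_ti ?coz_ti ?bQ /= in a1 a2 fy1 fz1 fy2 fz2.
set b := co y \in Q in a1 a2 fy1 fz1 fy2 fz2.
have B1 : bigon (smooth_passage (y :: Q) y) (smooth_passage (y :: Q) z) true (o3 (+) b)
    (smoothing P (y :: Q) (z :: R)).
  split=> //.
  - rewrite /smoothing !map_cons rev_cons; exists (map (smooth_passage (y :: Q)) P ++
      rev (map (smooth_passage (y :: Q)) Q)), (map (smooth_passage (y :: Q)) R).
    by rewrite -cats1 -!catA.
  - by rewrite -!smooth_passage_co.
  - by rewrite !sense_smooth fy1 fz1 sense_yz o2T; case: (sense y); case: (b).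
have B2 : bigon (smooth_passage (rcons (ti Q) z) y) (smooth_passage (rcons (ti Q) z) z)
    true (~~ o3 (+) b) (smoothing (rcons (ti P) y) (rcons (ti Q) z) (ti R)).
  split=> //.
  - rewrite /smoothing !map_rcons rev_rcons; set s := smooth_passage _.
    by exists (map s (ti P)), (rev (map s (ti Q)) ++ map s (ti R)); rewrite -cats1 -!catA.
  - by rewrite -!smooth_passage_co.
  - by rewrite !sense_smooth fy2 fz2 sense_yz o2T; case: (sense y); case: (b).
have D1 : del L (smoothing P (y :: Q) (z :: R)) = smoothing (del L P) (del L Q) (del L R).
  by rewrite del_smoothing -[y :: Q]cat1s -[z :: R]cat1s !del_cat /del /= !inE !eqxx orbT.
have D2 : del L (smoothing (rcons (ti P) y) (rcons (ti Q) z) (ti R))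
    = smoothing (del L P) (del L Q) (del L R).
  rewrite del_smoothing -!cats1 !del_cat !del_ti //.
  by rewrite /del /= !inE !eqxx orbT !cats0.
(* In both bigons [y] comes before [z] on one side; on strand 3 the orders are [o3 (+) b] before the
   move and its negation after it. The one that is false gives the antiparallel bigon. *)
have FD : is_flat (smoothing (del L P) (del L Q) (del L R)).
  case ob: (o3 (+) b).
    by rewrite -D2; apply: (flat_del_bigon F2 B2); rewrite addNb ob.
  by rewrite -D1; apply: (flat_del_bigon F1 B1).
have C1 := bigon_cls F1 B1; have C2 := bigon_cls F2 B2.
by rewrite !label_smooth D1 in C1; rewrite !label_smooth D2 in C2; rewrite C1 // C2.
Qed.

(** Here the third strand crosses both arcs created by the smoothing, and the two
    sides of the move differ by exchanging the names of [y] and [z]. *)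
Lemma cls_smooth_vertex_relabel : o2 = false ->
  cls (smooth_word (label x) w) = cls (smooth_word (label x) w').
Proof.
move=> o2F.
have [/mem_yz[yQ yQ'] /mem_yz[zQ zQ']] : y \in [:: y; z] /\ z \in [:: y; z].
  by rewrite !inE !eqxx orbT.
have E1 : w = P ++ x :: (y :: rcons Q z) ++ co x :: R.
  by rewrite /w o2F /= -cats1 -!catA.
have E2 : w' = rcons (ti P) y ++ x :: (ti Q) ++ co x :: (z :: ti R).
  by rewrite w'E o2F -!cats1 -!catA.
have lP := lx_notin sP; have lQ' := label_ti sQ.
have lQ : label x \notin map label (y :: rcons Q z).
  by rewrite map_cons inE map_rcons mem_rcons inE (negbTE lxy) (negbTE lxz) (lx_notin sQ).
have lPy : label x \notin map label (rcons (ti P) y).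
  by rewrite map_rcons mem_rcons inE (negbTE lxy) (label_ti sP).
have b1 : loop (label x) w = y :: rcons Q z by rewrite E1 loopE.
have b2 : loop (label x) w' = ti Q by rewrite E2 loopE.
have [_ e1] := smooth_adj pw xlw (triangle_adj3 T) lyx lzx.
have [yw' zw'] : y \in w' /\ z \in w' by rewrite !(perm_mem (perm_tri_swap pw T)).
have F1 := flat_smooth (label x) fw; have F2 := flat_smooth (label x) fw'.
have fy1 := flips_loop pw xlw yw; have fz1 := flips_loop pw xlw zw.
have fy2 := flips_loop pw' xw' yw'; have fz2 := flips_loop pw' xw' zw'.
rewrite b1 in e1 fy1 fz1; rewrite b2 in fy2 fz2.
have bQ : (co z \in Q) = (co y \in Q).
  move: e1; rewrite !inE !mem_rcons !inE !co_neq [co z == y]eq_sym zco.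
  by rewrite yco.
have W1 : smooth_word (label x) w = smoothing P (y :: rcons Q z) R by rewrite E1 smooth_wordE.
have W2 : smooth_word (label x) w' = smoothing (rcons (ti P) y) (ti Q) (z :: ti R).
  by rewrite E2 smooth_wordE.
rewrite W1 in F1 *; rewrite W2 in F2 *.
have yzF : (y == z) = false by apply: label_neq.
rewrite !inE ?mem_rcons ?inE ?co_neq ?[y == co y]eq_sym ?[z == co z]eq_sym ?co_neq
  ?eqxx ?yco ?[co z == y]eq_sym ?zco ?[z == y]eq_sym ?yzF ?(negbTE yQ)
  ?(negbTE zQ) ?coy_ti ?coz_ti ?bQ /= in fy1 fz1.
rewrite (negbTE yQ') coy_ti bQ /= in fy2; rewrite (negbTE zQ') coz_ti /= in fz2.
set b := co y \in Q in fy1 fz1 fy2 fz2.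
pose f := swp (label y) (label z).
have [fy fz] : f (label y) = label z /\ f (label z) = label y.
  by rewrite /f /swp !eqxx eq_sym (negbTE lyz).
(* Before the move [y] and [z] themselves are in the loop, after it they are not. The extra sense
   change is compensated by [sense_yz], which gives opposite senses when [o2] is false. *)
have yE : relabel f (smooth_passage (y :: rcons Q z) y) = smooth_passage (ti Q) z.
  by rewrite relabel_smooth fy fy1 smooth_passageE fz2 yz sense_yz o2F; case: (sense y); case: (b).
have zE : relabel f (smooth_passage (y :: rcons Q z) z) = smooth_passage (ti Q) y.
  by rewrite relabel_smooth fz fz1 smooth_passageE fy2 yz sense_yz o2F; case: (sense y); case: (b).
have yzco : (co z).2 = (co y).2 by rewrite /= yz.
have vE v : {subset v <= P ++ Q ++ R} ->
    map (relabel f) (map (smooth_passage (y :: rcons Q z)) v) = map (smooth_passage (ti Q)) (ti v).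
  move=> vs; rewrite [ti v]tri_swapE -!map_comp; apply/eq_in_map => t /vs tv.
  rewrite -[LHS]/(relabel f (smooth_passage _ t)) -[RHS]/(smooth_passage _ (tri x y z t)).
  case: (triP tv) => [[-> ->]|[-> ->]|[_ tL ->]].
  - by rewrite smooth_passage_co relabel_co yE smooth_passage_co.
  - by rewrite smooth_passage_co relabel_co zE smooth_passage_co.
  have fb : flips (y :: rcons Q z) (label t) = flips (ti Q) (label t).
    rewrite -(flips_del _ tL) -[in RHS](flips_del _ tL) del_ti // -cats1 -[y :: _]cat1s !del_cat.
    by rewrite /del /= !inE !eqxx orbT cats0.
  rewrite relabel_smooth fb smooth_passageE /f /swp.
  by move: tL; rewrite !inE negb_or => /andP[/negbTE -> /negbTE ->].
have E3 : map (relabel f) (smoothing P (y :: rcons Q z) R)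
    = smoothing (rcons (ti P) y) (ti Q) (z :: ti R).
  rewrite /smoothing !(map_cat, map_cons, map_rcons, map_rev, rev_cons, rev_rcons).
  by rewrite yE zE !vE // -!cats1 /= -!catA.
rewrite -E3 in F2 *; rewrite (cls_relabel F1 F2) // => l l' _ _.
exact: (inv_inj (swpK _ _)).
Qed.

End TriangleVertex.

Lemma tri_swapK x y z w : uniq [:: x; y; co x; z; co y; co z] ->
  tri_swap x y z (tri_swap x y z w) = w.
Proof.
move=> U; rewrite !tri_swapE -map_comp -[RHS]map_id.
by apply: eq_map => t; apply: triK.
Qed.

(** For [o1 = false] the move is read backwards: strand 1 is then in the order [true]. The order
    [o2] is negated as well, which exchanges the bigon case and the relabelling case. *)
Lemma cls_smooth_vertex1 x y z o1 o2 o3 w P Q R : is_flat w -> is_flat (tri_swap x y z w) ->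
  triangle x y z o1 o2 o3 w -> x.2 = Flat ->
  w = P ++ ordered o1 x y ++ Q ++ ordered o2 (co x) z ++ R ->
  cls (smooth_word (label x) w) = cls (smooth_word (label x) (tri_swap x y z w)).
Proof.
move=> fw fw' T xF E; have U := tri_uniq (triangle_labels T).
case: o1 T E => T E.
  case: o2 T E => T E; rewrite E in fw fw' T *.
    exact: (cls_smooth_vertex_bigon fw fw' T).
  exact: (cls_smooth_vertex_relabel fw fw' T).
have T' := triangle_tri_swap (flat_paired fw) T.
have [T1 T2 _] := tri_swap_ordered U.
have E' : tri_swap x y z w = tri_swap x y z P ++ ordered true x y ++ tri_swap x y z Q
    ++ ordered (~~ o2) (co x) z ++ tri_swap x y z R by rewrite E !tri_swap_cat T1 T2.
have wK := tri_swapK w U; rewrite -{1}wK.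
set w' := tri_swap x y z w in fw' T' E' wK *; rewrite -wK in fw.
apply: esym.
case: o2 T T' E E' => _ T' _ E'; rewrite E' in fw fw' T' *.
  exact: (cls_smooth_vertex_relabel fw' fw T').
exact: (cls_smooth_vertex_bigon fw' fw T').
Qed.

Lemma cls_smooth_vertex12 x y z o1 o2 o3 w : is_flat w -> is_flat (tri_swap x y z w) ->
  triangle x y z o1 o2 o3 w -> x.2 = Flat ->
  cls (smooth_word (label x) w) = cls (smooth_word (label x) (tri_swap x y z w)).
Proof.
move=> fw fw' T xF; have U := tri_uniq (triangle_labels T).
have U12 : uniq [:: x; y; co x; z] := mask_uniq U [:: true; true; true; true].
have [P [Q [R [E|E]]]] := two_blocks U12 (triangle_adj1 T) (triangle_adj2 T).
  exact: cls_smooth_vertex1 T xF E.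
have TS := triangle_sym T; have ES := tri_swap_sym T; rewrite -ES in fw' *.
by apply: (cls_smooth_vertex1 fw fw' TS _ _ (P := P) (Q := Q) (R := R)); rewrite ?coK //= xF.
Qed.

(** Renumbering the strands makes the chosen vertex the crossing of strands 1 and 2. *)
Lemma cls_smooth_vertex x y z o1 o2 o3 w u : is_flat w -> is_flat (tri_swap x y z w) ->
  triangle x y z o1 o2 o3 w -> u \in [:: x; y; z] -> u.2 = Flat ->
  cls (smooth_word (label u) w) = cls (smooth_word (label u) (tri_swap x y z w)).
Proof.
move=> fw fw' T; rewrite !inE => /or3P[] /eqP -> uF.
- exact: cls_smooth_vertex12 T uF.
- have T' := triangle_sym23 T; rewrite -(tri_swap_sym23 T) in fw' *.
  exact: cls_smooth_vertex12 T' uF.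
have T' := triangle_sym T; rewrite -(tri_swap_sym T) -(tri_swap_sym23 T') in fw' *.
exact: cls_smooth_vertex12 (triangle_sym23 T') uF.
Qed.

(** * A diagram with one singular crossing *)

(** A labelling [h] of darts that is constant along faces and takes [k] values certifies [k] faces
    by evaluating [turn] on natural numbers. Combined with [euler_bound] it yields planarity without
    enumerating orbits. *)
Lemma leq_n_faces (g : seq side) k (h : nat * bool -> nat) (r : nat -> nat * bool) :
  well_paired g ->
  (forall d, (d.1 <= size g)%N -> h (turn g d) = h d) ->
  (forall i, (i < k)%N -> (r i).1 <= size g /\ h (r i) = i) -> k <= n_faces g.
Proof.
move=> wg hturn hr; rewrite /n_faces (fcard_porbits (face_inj wg)).
set u := perm _; pose R (i : 'I_k) := mk_dart g (r i).
have Rr i : nat_dart (R i) = r i by apply: mk_dartK; case: (hr i (ltn_ord i)).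
have hR i : h (nat_dart (R i)) = i by rewrite Rr; case: (hr i (ltn_ord i)).
have hu n d : h (nat_dart (iter n u d)) = h (nat_dart d).
  elim: n => //= n IH; rewrite permE nat_dart_face // hturn //.
  exact: nat_dart_le.
have inj : injective (fun i => porbit u (R i)).
  move=> i j /eqP; rewrite eq_porbit_mem => /porbitP[n]; rewrite permX => e.
  by apply: val_inj; rewrite /= -hR e hu hR.
rewrite -[k in k <= _]card_ord -(card_imset _ inj).
by apply/subset_leq_card/subsetP => _ /imsetP[i _ ->]; apply: imset_f.
Qed.

(** Without the virtual crossing the labels read 0 1 0 1, with both first passages of positive
    sense: the odd writhe is 2. Smoothing at 0 leaves 1 1 once the virtual crossing is dropped, with
    odd writhe 0. With these senses 0 1 0 1 is not planar; crossing 2 repairs this. *)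
Definition witness_word : seq passage :=
  [:: (0, true, Singular); (1, true, Over); (2, false, Virtual);
      (0, false, Singular); (2, true, Virtual); (1, false, Under)].

Lemma witness_paired : well_paired (sides witness_word).
Proof. by []. Qed.

Lemma witness_planar : planar (sides witness_word).
Proof.
have le4 := euler_bound witness_paired.
suff ge4 : 4 <= n_faces (sides witness_word).
  have /eqP e4 : n_faces (sides witness_word) == 4 by rewrite eqn_leq ge4 andbT; exact: le4.
  by rewrite /planar e4.
(* the entry [d.1.*2 + d.2] numbers the face of the dart [d] *)
pose h (d : nat * bool) := nth 0 [:: 0; 0; 2; 1; 3; 1; 2; 0; 1; 0; 3; 2; 1; 1] (d.1.*2 + d.2).
pose r i := nth (0, true) [:: (0, true); (1, true); (1, false); (2, false)] i.
apply: (@leq_n_faces _ _ h r witness_paired).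
  by case=> e f /=; do 7?[case: e => [|e] //]; case: f.
by do 4?[case=> //].
Qed.

Lemma witness_diagram : is_diagram singular_marks witness_word.
Proof. by rewrite /is_diagram witness_planar. Qed.

Definition witness : singular_diagram := Diagram witness_diagram.

(** * The invariant of singular diagrams *)

(** Unlike [flatten_passage], this also flattens singular crossings, so that a singular diagram and
    both of its resolutions have the same flat word. *)
Definition flat_passage (t : passage) : passage :=
  (t.1, if t.2 == Virtual then Virtual else Flat).

Notation flatw := (map flat_passage).

Lemma flat_passage_co t : flat_passage (co t) = co (flat_passage t).
Proof. by case: t => [[l b] []]. Qed.

Lemma flatw_flat A w : is_diagram A w -> is_flat (flatw w).
Proof.
by apply: map_diagram => // t; [rewrite flat_passage_co | move=> _ /=; case: ifP].
Qed.

Lemma flatw_del L w : flatw (del L w) = del L (flatw w).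
Proof. by rewrite /del filter_map. Qed.

Lemma map_label_flatw w : map label (flatw w) = map label w.
Proof. by rewrite -map_comp; apply: eq_map. Qed.

Lemma smooth_flatw l w : smooth_word l (flatw w) = flatw (smooth_word l w).
Proof.
have sE b t : smooth_passage (flatw b) (flat_passage t) = flat_passage (smooth_passage b t).
  by rewrite !smooth_passageE /flat_passage /flips count_map.
have -> v : smooth_word l v = let i := index l (map label v) in
    let v' := drop i.+1 v in let j := index l (map label v') in
    smoothing (take i v) (take j v') (drop j.+1 v') by [].
cbv zeta.
rewrite map_label_flatw -map_drop map_label_flatw -!map_take -map_drop.
rewrite /= /smoothing !map_cat map_rev -!map_comp.
by congr (_ ++ _); [|congr (rev _ ++ _)]; apply: eq_map => t; apply: sE.
Qed.

Local Open Scope ring_scope.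

Definition jump (W : seq passage) (l : nat) : {freeg flat_knotoid / int} :=
  << cls (smooth_word l W) >> - << cls W >>.

(** [F (D)] is the sum of [sgn c * ([D_c] - [D])]. A singular crossing comes with
    coefficient 2, one for each of its passages. *)
Definition kappa (n : nat) (t : passage) : int :=
  match n with
  | 0%N => if t.2 == Over then crossing_sign t else 0
  | 1%N => (t.2 == Singular)%:R
  | _ => 0
  end.

(** The flat word [W] that determines the jumps is kept apart from the list [v] of summed passages,
    so that the sum can be cut along factors of the word and permuted. *)
Definition wsum (n : nat) (W v : seq passage) : {freeg flat_knotoid / int} :=
  \sum_(t <- v) jump W (label t) *~ kappa n t.

Lemma wsum_cat n W u v : wsum n W (u ++ v) = wsum n W u + wsum n W v.
Proof. by rewrite /wsum big_cat. Qed.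

Lemma wsum_pair n W t u :
  wsum n W [:: t; u] = jump W (label t) *~ kappa n t + jump W (label u) *~ kappa n u.
Proof. by rewrite /wsum !big_cons big_nil addr0. Qed.

Lemma wsum_perm n W u v : perm_eq u v -> wsum n W u = wsum n W v.
Proof. by move=> uv; rewrite /wsum (perm_big _ uv). Qed.

Lemma eq_wsum n W W' v : {in v, forall t, kappa n t != 0 -> jump W (label t) = jump W' (label t)} ->
  wsum n W v = wsum n W' v.
Proof.
move=> e; apply: eq_big_seq => t tv; have [->|nz] := eqVneq (kappa n t) 0.
  by rewrite !mulr0z.
by rewrite e.
Qed.

Lemma kappa_mark n t : kappa n t != 0 -> t.2 != Virtual.
Proof. by apply: contraNneq; rewrite /kappa => ->; case: n => [|[|n]]. Qed.

Lemma flat_passage_mark t : t.2 != Virtual -> (flat_passage t).2 = Flat.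
Proof. by rewrite /= => /negbTE ->. Qed.

Lemma jump_eq W W' l : cls W = cls W' -> cls (smooth_word l W) = cls (smooth_word l W') ->
  jump W l = jump W' l.
Proof. by rewrite /jump => -> ->. Qed.

(** * Invariance of the weighted sum under each move *)

Definition singular_count (w : seq passage) : nat := count (fun t => t.2 == Singular) w.

(** Quantifying over [n] lets a move be checked without knowing how many singular crossings the
    diagram has; the first clause then selects the same [n] on both sides. *)
Definition same_weight (w w' : seq passage) :=
  singular_count w = singular_count w' /\
  forall n, wsum n (flatw w) w = wsum n (flatw w') w'.

Lemma same_weight_Omega1 A p q x : is_diagram A (p ++ [:: x; co x] ++ q) -> is_diagram A (p ++ q) ->
  x.2 != Singular -> same_weight (p ++ [:: x; co x] ++ q) (p ++ q).
Proof.
set w := p ++ _ => dw dw' xs; have pw := diagram_paired dw.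
have fw := flatw_flat dw; have fw' := flatw_flat dw'.
split.
  rewrite /singular_count !count_cat /= (negbTE xs).
  by case: (x.2) xs => [] //=; lia.
have aw : adj true (flat_passage x) (co (flat_passage x)) (flatw w).
  by rewrite -flat_passage_co; apply: adj_map; exists p, q.
have dE : flatw (p ++ q) = del [:: label x] (flatw w).
  by rewrite -flatw_del (@del_monogon true x w p q).
move=> n; rewrite (wsum_perm _ _ (perm_ordered true x (co x) p q)) -[x :: _]/([:: x; co x] ++ _).
rewrite wsum_cat dE; have C := monogon_cls fw aw.
rewrite /wsum !big_cons big_nil label_co /jump.
have -> : cls (smooth_word (label x) (flatw w)) = cls (flatw w).
  by rewrite C -(smooth_monogon (flat_paired fw) aw).
rewrite subrr !mul0rz !add0r; apply: eq_wsum => t tpq _; apply: jump_eq => //.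
have [tw tx] : t \in w /\ label t != label x.
  have := del_monogon pw (erefl w : w = p ++ ordered true x (co x) ++ q).
  move/(congr1 (fun v => t \in v)); rewrite tpq mem_filter /= inE => /andP[-> ->].
  by [].
apply: (cls_smooth_monogon fw aw); last by rewrite eq_sym.
by rewrite map_label_flatw label_mem.
Qed.

Lemma kappa_bigon n x y : x.2 != Singular -> y.2 = x.2 -> sense y = ~~ sense x ->
  kappa n x + kappa n y + (kappa n (co x) + kappa n (co y)) = 0.
Proof.
rewrite /kappa /crossing_sign !sense_co /= => + -> ->.
by case: n => [|[|n]]; case: (x.2) => //=; case: (sense x).
Qed.

Lemma same_weight_Omega2 A p q r x y o (w := p ++ [:: x; y] ++ q ++ ordered o (co x) (co y) ++ r) :
  is_diagram A w -> is_diagram A (p ++ q ++ r) ->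
  x.2 != Singular -> y.2 = x.2 -> sense y = ~~ sense x -> same_weight w (p ++ q ++ r).
Proof.
move=> dw dw' xs yx sy; have pw := diagram_paired dw.
have fw := flatw_flat dw; have fw' := flatw_flat dw'.
have [lxy sw lN dE] := bigon_form pw (erefl w).
have cxs : (co x).2 != Singular by move: xs; rewrite /=; case: (x.2).
have pe : perm_eq w ([:: x; y] ++ [:: co x; co y] ++ p ++ q ++ r).
  have [[+ _ _] _ _ _] := perm_blocks p q r [::] (perm_ordered_pair true x y)
    (perm_ordered_pair o (co x) (co y)) (perm_refl [::]).
  by rewrite /= !cats0.
split.
  rewrite /singular_count (seq.permP pe) /= yx (negbTE xs).
  by rewrite -[dual x.2]/((co x).2) (negbTE cxs).
have B : bigon (flat_passage x) (flat_passage y) true o (flatw w).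
  split=> //; last by rewrite /= yx.
    by apply: adj_map; exists p, (q ++ ordered o (co x) (co y) ++ r).
  rewrite -!flat_passage_co; apply: adj_map; exists (p ++ [:: x; y] ++ q), r.
  by rewrite -!catA.
have fdE : flatw (p ++ q ++ r) = del [:: label x; label y] (flatw w).
  by rewrite -flatw_del dE.
move=> n; rewrite (wsum_perm _ _ pe) !wsum_cat fdE.
rewrite fdE in fw'; have C := bigon_cls fw B fw'.
have z : wsum n (flatw w) [:: x; y] + wsum n (flatw w) [:: co x; co y] = 0.
  rewrite !wsum_pair !label_co.
  have Cv : cls (smooth_word (label x) (flatw w)) = cls (smooth_word (label y) (flatw w)) :=
    cls_smooth_bigon_vertices fw B.
  have -> : jump (flatw w) (label y) = jump (flatw w) (label x) by rewrite /jump Cv.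
  by rewrite -!mulrzDr kappa_bigon // mulr0z.
rewrite addrA z add0r.
rewrite -!wsum_cat; apply: eq_wsum => t tpq _; apply: jump_eq => //.
have := lN _ tpq; rewrite !inE negb_or => /andP[tx ty].
apply: (cls_smooth_bigon fw B fw'); rewrite 1?eq_sym //.
by rewrite map_label_flatw label_mem ?sw.
Qed.

Lemma flat_triangle_marks_flatten m12 m13 m23 : triangle_marks m12 m13 m23 ->
  let f m := if m == Virtual then Virtual else Flat in
  flat_triangle_marks (f m12) (f m13) (f m23).
Proof. by case: m12; case: m13; case: m23. Qed.

Lemma same_weight_Omega3 A p q r u x y z o1 o2 o3
  (w := p ++ ordered o1 x y ++ q ++ ordered o2 (co x) z ++ r ++ ordered o3 (co y) (co z) ++ u)
  (w' := p ++ ordered (~~ o1) x y ++ q ++ ordered (~~ o2) (co x) z ++ r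
     ++ ordered (~~ o3) (co y) (co z) ++ u) :
  is_diagram A w -> is_diagram A w' -> triangle_marks x.2 y.2 z.2 ->
  sense x (+) o1 (+) o2 = sense y (+) o1 (+) o3 ->
  sense y (+) o1 (+) o3 = sense z (+) o2 (+) o3 -> same_weight w w'.
Proof.
move=> dw dw' mk s1 s2; have pw := diagram_paired dw.
have fw := flatw_flat dw; have fw' := flatw_flat dw'.
have pe b1 b2 b3 : perm_eq (p ++ ordered b1 x y ++ q ++ ordered b2 (co x) z ++ r
    ++ ordered b3 (co y) (co z) ++ u) ([:: x; y; co x; z; co y; co z] ++ p ++ q ++ r ++ u).
  by have [[+ _ _] _ _ _] := perm_blocks p q r u (perm_ordered_pair b1 x y)
    (perm_ordered_pair b2 (co x) z) (perm_ordered_pair b3 (co y) (co z)).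
have pww' : perm_eq w w' by rewrite (perm_trans (pe _ _ _)) // perm_sym; apply: pe.
split; first by rewrite /singular_count (seq.permP pww').
have [xw yw zw] : [/\ x \in w, y \in w & z \in w].
  by split; rewrite (perm_mem (pe _ _ _)) !inE eqxx ?orbT.
pose fx := flat_passage x; pose fy := flat_passage y; pose fz := flat_passage z.
have E : flatw w = flatw p ++ ordered o1 fx fy ++ flatw q ++ ordered o2 (co fx) fz
    ++ flatw r ++ ordered o3 (co fy) (co fz) ++ flatw u.
  by rewrite /w !map_cat !ordered_map !flat_passage_co.
have [lab tE] := triangle_form (flat_paired fw) E.
have E' : flatw w' = tri_swap fx fy fz (flatw w).
  by rewrite tE /w' !map_cat !ordered_map !flat_passage_co.
have T : triangle fx fy fz o1 o2 o3 (flatw w).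
  split=> //; first exact: flat_triangle_marks_flatten.
  - by rewrite E; exists (flatw p); eexists.
  - by rewrite E; exists (flatw p ++ ordered o1 fx fy ++ flatw q); eexists; rewrite -!catA.
  - rewrite E; exists (flatw p ++ ordered o1 fx fy ++ flatw q ++ ordered o2 (co fx) fz ++ flatw r).
    by exists (flatw u); rewrite -!catA.
rewrite E' in fw'; have C := triangle_cls fw fw' T.
move=> n; rewrite -(wsum_perm n (flatw w') pww') E'.
apply: eq_wsum => t tw kt; apply: jump_eq => //.
have lt : label t \in map label (flatw w) by rewrite map_label_flatw label_mem.
(* Virtual crossings have weight zero, so a vertex that contributes is flat after flattening, as
   [cls_smooth_vertex] requires. *)
have vert v : v \in w -> flat_passage v \in [:: fx; fy; fz] -> label t = label v ->
    cls (smooth_word (label t) (flatw w))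
    = cls (smooth_word (label t) (tri_swap fx fy fz (flatw w))).
  move=> vw vl tv; have := kappa_mark kt => tV.
  rewrite tv; apply: (cls_smooth_vertex fw fw' T vl); apply: flat_passage_mark.
  by case: (label_eq pw vw tw tv) tV => ->; [|case: (v) => [[? ?] []]].
have [tx|tx] := eqVneq (label t) (label x); first by apply: vert tx => //; rewrite mem_head.
have [ty|ty] := eqVneq (label t) (label y).
  by apply: vert ty => //; rewrite !inE eqxx orbT.
have [tz|tz] := eqVneq (label t) (label z).
  by apply: vert tz => //; rewrite !inE eqxx !orbT.
by apply: (cls_smooth_triangle fw fw' T lt); rewrite eq_sym.
Qed.

Lemma kappa_virtual n t : t.2 = Virtual -> kappa n t = 0.
Proof. by rewrite /kappa => ->; case: n => [|[|n]]. Qed.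

Lemma same_weight_virtual A w w' x : is_diagram A w -> is_diagram A w' -> x \in w ->
  w' = del [:: label x] w -> x.2 = Virtual ->
  cls (flatw w) = cls (flatw w') ->
  (forall l, l \in map label w -> label x != l ->
    cls (smooth_word l (flatw w)) = cls (smooth_word l (flatw w'))) ->
  same_weight w w'.
Proof.
move=> dw dw' xw E vx C Cl; have pw := diagram_paired dw.
have virt t : t \in w -> label t \in [:: label x] -> t.2 = Virtual.
  by move=> tw; rewrite inE => /eqP/(label_eq pw xw tw)[] -> //=; rewrite vx.
split.
  rewrite E /singular_count count_filter; apply: eq_in_count => t tw /=.
  by case: (boolP (label t \in _)) => [/(virt t tw) -> //|_]; rewrite andbT.
move=> n; rewrite [in RHS]E /wsum big_filter [LHS](bigID (fun t => label t \notin [:: label x])) /=.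
rewrite [X in _ + X]big1_seq ?addr0 => [|t /andP[+ tw]]; last first.
  by rewrite negbK => /(virt t tw)/kappa_virtual ->; rewrite mulr0z.
rewrite -E big_seq_cond [RHS]big_seq_cond; apply: eq_bigr => t /andP[tw tx].
rewrite (@jump_eq _ (flatw w')) //; apply: Cl; rewrite ?label_mem //.
by rewrite inE eq_sym in tx.
Qed.

Lemma same_weight_tail A p q x : is_diagram A (x :: p ++ co x :: q) -> is_diagram A (p ++ q) ->
  x.2 = Virtual -> same_weight (x :: p ++ co x :: q) (p ++ q).
Proof.
move=> dw dw' vx; have pw := diagram_paired dw.
have dE := del_tail pw (erefl _).
have fw := flatw_flat dw; have fw' := flatw_flat dw'.
rewrite -dE flatw_del in fw'.
have vfx : (flat_passage x).2 = Virtual by rewrite /= vx.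
apply: (same_weight_virtual dw dw' (mem_head _ _)); rewrite ?dE // -?dE ?flatw_del.
  exact: (virtual_tail_cls fw fw' vfx).
move=> l; rewrite inE => /orP[/eqP -> |lw lx]; first by rewrite eqxx.
by apply: (cls_smooth_tail fw fw' vfx _ lx); rewrite map_label_flatw.
Qed.

Lemma same_weight_head A p q x : is_diagram A (p ++ x :: q ++ [:: co x]) ->
  is_diagram A (p ++ q) -> x.2 = Virtual -> same_weight (p ++ x :: q ++ [:: co x]) (p ++ q).
Proof.
move=> dw dw' vx; have pw := diagram_paired dw.
have dE := del_head pw (erefl _).
have fw := flatw_flat dw; have fw' := flatw_flat dw'.
rewrite -dE flatw_del in fw'.
have vfx : (flat_passage (co x)).2 = Virtual by rewrite /= vx.
have wE : p ++ x :: q ++ [:: co x] = rcons (p ++ x :: q) (co x) by rewrite -cats1 -catA.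
apply: (same_weight_virtual dw dw' (x := x)); rewrite ?dE // -?dE ?flatw_del.
- by rewrite mem_cat mem_head orbT.
- by rewrite wE map_rcons in fw fw' *; apply: (virtual_head_cls fw fw' vfx).
rewrite wE map_rcons in fw fw' *.
move=> l; rewrite map_rcons mem_rcons inE => /orP[/eqP -> |lw lx]; first by rewrite eqxx.
by apply: (cls_smooth_head fw fw' vfx _ lx); rewrite map_label_flatw.
Qed.

Lemma flatw_relabel f w : flatw (map (relabel f) w) = map (relabel f) (flatw w).
Proof. by rewrite -!map_comp; apply: eq_map. Qed.

Lemma label_smooth_word l w : {subset map label (smooth_word l w) <= map label w}.
Proof.
have -> : smooth_word l w = let i := index l (map label w) in
    let v := drop i.+1 w in let j := index l (map label v) in
    smoothing (take i w) (take j v) (drop j.+1 v) by [].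
cbv zeta; move=> l'; rewrite /smoothing !map_cat map_rev !map_label_smooth.
rewrite !mem_cat mem_rev; have sub v u : {subset v <= u} -> {subset map label v <= map label u}.
  by move=> vu _ /mapP[t /vu tu ->]; apply: map_f.
case/or3P; apply: sub => t.
- exact: mem_take.
- by move/mem_take/mem_drop.
by move/mem_drop/mem_drop.
Qed.

Lemma jump_relabel f W l : is_flat W -> is_flat (map (relabel f) W) ->
  {in map label W &, injective f} -> l \in map label W ->
  jump (map (relabel f) W) (f l) = jump W l.
Proof.
move=> fW fW' fi lW; have pW := flat_paired fW.
have F := flat_smooth (f l) fW'; rewrite (smooth_relabel pW lW fi) in F.
have C := cls_relabel fW fW' fi.
have Cl : cls (smooth_word (f l) (map (relabel f) W)) = cls (smooth_word l W).
  rewrite (smooth_relabel pW lW fi); apply: cls_relabel (flat_smooth l fW) F _.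
  by move=> l1 l2 /label_smooth_word h1 /label_smooth_word h2; apply: fi.
by rewrite /jump C Cl.
Qed.

Lemma same_weight_relabel A w w' f : is_diagram A w -> is_diagram A w' ->
  {in map label w &, injective f} -> w' = map (relabel f) w -> same_weight w w'.
Proof.
move=> dw dw' fi E; have fw := flatw_flat dw; have fw' := flatw_flat dw'.
rewrite E in fw' *; split; first by rewrite /singular_count count_map.
rewrite flatw_relabel in fw' *.
move=> n; rewrite /wsum big_map; apply: eq_big_seq => t tw.
by rewrite -(@jump_relabel f) // ?map_label_flatw ?label_mem.
Qed.

(** After flattening, [S2] exchanges the names of the two vertices of a bigon. *)
Lemma same_weight_S2 A p q r i j b m o (s : passage := ((i, b), Singular))
    (s' : passage := ((i, ~~ b), Singular)) (c : passage := ((j, ~~ b), m))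
    (c' : passage := ((j, b), dual m))
    (w := p ++ [:: s; c] ++ q ++ ordered o (co s) (co c) ++ r)
    (w' := p ++ [:: c'; s'] ++ q ++ ordered o (co c') (co s') ++ r) :
  is_diagram A w -> is_diagram A w' -> classical m -> same_weight w w'.
Proof.
move=> dw dw' mc; have pw := diagram_paired dw.
have fw := flatw_flat dw; have fw' := flatw_flat dw'.
have [lij sw lN _] := bigon_form pw (erefl w).
have mV : (m == Virtual) = false by case: (m) mc.
have mV' : (dual m == Virtual) = false by case: (m) mc.
have mV2 : (dual (dual m) == Virtual) = false by case: (m) mc.
have pe b1 b2 x y : perm_eq (p ++ ordered b1 x y ++ q ++ ordered b2 (co x) (co y) ++ r)
    ([:: x; y] ++ [:: co x; co y] ++ p ++ q ++ r).
  have [[+ _ _] _ _ _] := perm_blocks p q r [::] (perm_ordered_pair b1 x y)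
    (perm_ordered_pair b2 (co x) (co y)) (perm_refl [::]).
  by rewrite /= !cats0.
split.
  rewrite /singular_count (seq.permP (pe true o s c)) (seq.permP (pe true o c' s')) /=.
  by case: (m) mc.
have B : bigon (flat_passage s) (flat_passage c) true o (flatw w).
  split=> //; last by rewrite /= mV.
    by apply: adj_map; exists p, (q ++ ordered o (co s) (co c) ++ r).
  rewrite -!flat_passage_co; apply: adj_map; exists (p ++ [:: s; c] ++ q), r.
  by rewrite -!catA.
pose f := swp i j.
have [fi fj] : f i = j /\ f j = i.
  by rewrite /f /swp !eqxx eq_sym (negbTE lij).
have rel v : {subset v <= p ++ q ++ r} -> map (relabel f) (flatw v) = flatw v.
  move=> vs; rewrite -[RHS]map_id; apply/eq_in_map => _ /mapP[[[l b'] m'] tv ->].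
  have := lN _ (vs _ tv); rewrite !inE negb_or /relabel /= /f /swp.
  by case/andP=> /negbTE -> /negbTE ->.
have [sp sq sr] : [/\ {subset p <= p ++ q ++ r}, {subset q <= p ++ q ++ r}
    & {subset r <= p ++ q ++ r}].
  by split=> u uv'; rewrite !mem_cat uv' ?orbT.
have E : flatw w' = map (relabel f) (flatw w).
  rewrite /w /w' !map_cat !ordered_map (rel _ sp) (rel _ sq) (rel _ sr) [map _ [:: s; c]]/=.
  by rewrite /relabel /flat_passage /label /sense /= fi fj mV mV' mV2.
move=> n; rewrite (wsum_perm _ _ (pe true o s c)) (wsum_perm _ _ (pe true o c' s')).
have fi' : {in map label (flatw w) &, injective f} by move=> ? ? _ _; apply: (inv_inj (swpK _ _)).
rewrite E in fw' *.
have lw l : l \in [:: i; j] -> l \in map label (flatw w).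
  rewrite map_label_flatw /w map_cat mem_cat !inE => /orP[] /eqP ->;
    by rewrite /label /= eqxx ?orbT.
have J l : l \in [:: i; j] -> jump (map (relabel f) (flatw w)) (f l) = jump (flatw w) l.
  by move=> ll; apply: jump_relabel => //; apply: lw.
(* The vertices of the bigon have equal jumps, so only the total weight of its four passages has to
   be preserved; this is [K]. *)
have Cv : cls (smooth_word i (flatw w)) = cls (smooth_word j (flatw w)) :=
  cls_smooth_bigon_vertices fw B.
have Jij : jump (flatw w) j = jump (flatw w) i by rewrite /jump Cv.
have Ji : jump (map (relabel f) (flatw w)) i = jump (flatw w) i.
  by rewrite -{1}fj J ?inE ?eqxx ?orbT.
have Jj : jump (map (relabel f) (flatw w)) j = jump (flatw w) i.
  by rewrite -{1}fi J ?inE ?eqxx ?orbT.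
have pair W t u : jump W (label t) = jump (flatw w) i -> jump W (label u) = jump (flatw w) i ->
    wsum n W [:: t; u] = jump (flatw w) i *~ (kappa n t + kappa n u).
  by move=> et eu; rewrite wsum_pair et eu mulrzDr.
have rest : wsum n (flatw w) (p ++ q ++ r)
    = wsum n (map (relabel f) (flatw w)) (p ++ q ++ r).
  apply: eq_wsum => t tv _; have := lN _ tv; rewrite !inE negb_or => /andP[ti tj].
  have ft : f (label t) = label t by rewrite /f /swp (negbTE ti) (negbTE tj).
  by rewrite -[in RHS]ft jump_relabel // map_label_flatw label_mem ?sw.
have K : kappa n s + kappa n c + (kappa n (co s) + kappa n (co c))
    = kappa n c' + kappa n s' + (kappa n (co c') + kappa n (co s')).
  by case: (n) => [|[|k]] //=; rewrite /kappa /crossing_sign /sense /=;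
    case: (m) mc => //= _; case: (b).
have e1 := pair (flatw w) s c erefl Jij.
have e2 := pair (flatw w) (co s) (co c) erefl Jij.
have e3 := pair (map (relabel f) (flatw w)) c' s' Jj Ji.
have e4 := pair (map (relabel f) (flatw w)) (co c') (co s') Jj Ji.
rewrite [LHS]wsum_cat [X in _ + X = _]wsum_cat [RHS]wsum_cat [X in _ = _ + X]wsum_cat.
by rewrite e1 e2 e3 e4 rest addrA -mulrzDr K mulrzDr -addrA.
Qed.

Definition weight (D : singular_diagram) : {freeg flat_knotoid / int} :=
  wsum (n_singular D) (flatw D) D.

Lemma same_weightP (D D' : singular_diagram) : same_weight D D' -> weight D = weight D'.
Proof.
by case=> c E; rewrite /weight E /n_singular -!/(singular_count _) c.
Qed.

Lemma move_same_weight A w w' : is_diagram A w -> is_diagram A w' -> move w w' ->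
  same_weight w w'.
Proof.
move=> dw dw' mv; case: mv dw dw' => {w w'}.
- by move=> p q x xs dw dw'; apply: same_weight_Omega1 dw dw' xs.
- by move=> p q r x y o xs yx sy dw dw'; apply: same_weight_Omega2 dw dw' xs yx sy.
- move=> p q r u x y z o1 o2 o3 mk s1 s2 dw dw'.
  exact: same_weight_Omega3 dw dw' mk s1 s2.
- by move=> p q x vx dw dw'; apply: same_weight_tail dw dw' vx.
- by move=> p q x vx dw dw'; apply: same_weight_head dw dw' vx.
- by move=> p q r i j b m o s s' c c' mc dw dw'; apply: same_weight_S2 dw dw' mc.
Qed.

Lemma weight_step (D D' : singular_diagram) : step D D' -> weight D = weight D'.
Proof.
move=> st; apply: same_weightP; case: st => [mv|[f fi E]].
  exact: move_same_weight (diagramP D) (diagramP D') mv.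
exact: same_weight_relabel (diagramP D) (diagramP D') fi E.
Qed.

Lemma generated_invariant (T : choiceType) (R : T -> T -> Prop) (S : Type) (F : T -> S) :
  (forall x y, R x y -> F x = F y) -> forall x y, generated R x y -> F x = F y.
Proof.
move=> FR x y /asboolP; elim=> [u v /FR //|//|u v _ -> //|u v v' _ -> _ //].
Qed.

Lemma weight_class (D D' : singular_diagram) :
  singular_class D = singular_class D' -> weight D = weight D'.
Proof.
by move=> /eqmodP; apply: generated_invariant => u v; apply: weight_step.
Qed.

Lemma weight_repr (D : singular_diagram) : weight (repr (singular_class D)) = weight D.
Proof. by apply: weight_class; rewrite /singular_class reprK. Qed.

Lemma flatten_cls (D : virtual_diagram) : flat_class (Defs.flatten D) = cls (flatw D).
Proof.
rewrite -cls_diagram /=; congr cls; apply/eq_in_map => t tD.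
have /and4P[_ _ _ /allP/(_ t tD)] := diagramP D.
by case: t {tD} => [[l b] []].
Qed.

Lemma weight_to_singular (D : virtual_diagram) : weight (to_singular D) = smoothing_sum D.
Proof.
have -> : weight (to_singular D) = wsum 0 (flatw D) D.
  rewrite /weight; have -> // : n_singular (to_singular D) = 0%N.
  have /and4P[_ _ _ /allP mD] := diagramP D.
  rewrite /n_singular (@eq_in_count _ _ pred0) ?count_pred0 // => t /mD.
  by case: t => [[l b] []].
rewrite /wsum /smoothing_sum /writhe.
have -> : << \sum_(t <- D | t.2 == Over) crossing_sign t *g flat_class (Defs.flatten D) >>
    = \sum_(t <- D | t.2 == Over) << crossing_sign t *g flat_class (Defs.flatten D) >>
    :> {freeg flat_knotoid / int}.
  elim: (word D) => [|t w IH]; first by rewrite !big_nil freegU0.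
  by rewrite !big_cons -IH; case: ifP => // _; rewrite freegUD.
rewrite -sumrB [RHS]big_mkcond; apply: eq_bigr => t _ /=.
case: eqP => _; last by rewrite mulr0z.
rewrite /jump !flatten_cls smooth_flatw mulrzBl.
have U (k : int) a : << a >> *~ k = << k *g a >> :> {freeg flat_knotoid / int}.
  by rewrite freeg_mulz intz.
by rewrite !U.
Qed.

(** [step] only reads words and [to_singular] keeps the word. Thus the invariance of F is that of
    [weight] on diagrams without singular crossings. *)
Lemma to_singular_step (D D' : virtual_diagram) :
  step D D' -> step (to_singular D) (to_singular D').
Proof. by []. Qed.

Lemma smoothing_sum_class (D D' : virtual_diagram) :
  virtual_class D = virtual_class D' -> smoothing_sum D = smoothing_sum D'.
Proof.
move=> /eqmodP; apply: generated_invariant => u v /to_singular_step/weight_step.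
by rewrite !weight_to_singular.
Qed.

Lemma smoothing_invariantE (D : virtual_diagram) :
  smoothing_invariant (virtual_class D) = smoothing_sum D.
Proof. by apply: smoothing_sum_class; rewrite /virtual_class reprK. Qed.

Lemma flatw_resolve x e (w : seq passage) : flatw (map (resolve_passage x e) w) = flatw w.
Proof.
rewrite -map_comp; apply: eq_map => t; rewrite /= /resolve_passage.
by case: ifP => // /andP[_ /eqP sg]; rewrite /flat_passage sg /=; case: (sense t == e).
Qed.

(** * Resolution of a singular crossing *)

Section Resolution.
Variables (x : nat) (D : singular_diagram).
Hypothesis xD : is_singular_crossing x D.

Let pD : paired D := diagram_paired (diagramP D).

Lemma singular_pair : exists t, [/\ t \in word D, label t = x, t.2 = Singular &
  perm_eq D (t :: co t :: [seq u <- D | label u != x])].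
Proof.
have /hasP[t tD /andP[/eqP tx /eqP ts]] := xD.
have xl : x \in map label D by rewrite -tx label_mem.
have [a [u [b [d [E ux [la lb ld]]]]]] := paired_cut pD xl.
have uD : u \in word D by rewrite E mem_cat mem_head orbT.
exists u; split=> //.
  by case: (label_eq pD tD uD (etrans ux (esym tx))) => -> //=; rewrite ts.
have id v : x \notin map label v -> [seq u <- v | label u != x] = v.
  move=> xv; apply/all_filterP/allP => r rv.
  by apply: contraNneq xv => <-; apply: label_mem.
have -> : [seq u <- D | label u != x] = a ++ b ++ d.
  rewrite E filter_cat /= filter_cat /= !id //.
  by rewrite label_co ux eqxx.
have [[+ _ _] _ _ _] := perm_blocks a b d [::] (perm_refl [:: u]) (perm_refl [:: co u])
  (perm_refl [::]).
by rewrite /= !cats0 -E.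
Qed.

Lemma singular_count_resolve e :
  singular_count D = (singular_count (resolve x e D)).+2.
Proof.
have [t [tD tx ts pe]] := singular_pair.
rewrite /singular_count count_map (seq.permP pe) /= ts /= (seq.permP pe) /=.
rewrite /resolve_passage label_co tx eqxx ts /= ts /= !add1n; congr _.+2.
have -> : ((if sense t == e then Over else Under) == Singular) = false by case: ifP.
have -> : ((if sense (co t) == e then Over else Under) == Singular) = false by case: ifP.
rewrite !add0n; apply: eq_in_count => u; rewrite mem_filter => /andP[/negbTE ux _] /=.
by rewrite ux.
Qed.

(** The bound is on passages: a second singular crossing would bring their number to at least 4. *)
Lemma singular_label : (singular_count D < 4)%N ->
  {in word D, forall t, t.2 == Singular -> label t = x}.
Proof.
have [t [tD tx ts pe]] := singular_pair; rewrite /singular_count (seq.permP pe) /= ts /=.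
rewrite !add1n !ltnS => c1 u uD us; apply/eqP; apply: contraLR c1 => ux.
rewrite -ltnNge; set v := [seq u <- D | _].
have uv : u \in v by rewrite mem_filter ux.
have cuv : co u \in v by rewrite mem_filter label_co ux mem_co.
rewrite -size_filter; apply: (@uniq_leq_size _ [:: u; co u]).
  by rewrite /= inE eq_sym co_neq.
by move=> r; rewrite !inE => /orP[] /eqP ->; rewrite mem_filter ?uv ?cuv /= ?us // (eqP us).
Qed.

(** A passage of positive sense is over, with sign 1, in the positive resolution only; one of
    negative sense is over, with sign -1, in the negative one only. Each passage contributes 1 to
    the difference, whence the coefficient 2 of the crossing. *)
Lemma kappa_resolve t : t.2 == Singular -> label t = x ->
  kappa 0 (resolve_passage x true t) - kappa 0 (resolve_passage x false t) = 1.
Proof.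
rewrite /resolve_passage => ts ->; rewrite eqxx ts /kappa /=.
by rewrite /crossing_sign /sense /=; case: (t.1.2).
Qed.

Lemma weight_resolve : weight D = weight (resolve x true D) - weight (resolve x false D).
Proof.
have [c [cD ct cf]] : exists c, [/\ singular_count D = c.+2,
    singular_count (resolve x true D) = c & singular_count (resolve x false D) = c].
  exists (singular_count (resolve x true D)); split=> //; first exact: singular_count_resolve.
  by have := singular_count_resolve true; rewrite (singular_count_resolve false) => -[].
have nE D' : n_singular D' = (singular_count D')./2 by [].
rewrite /weight !nE cD ct cf /= !flatw_resolve /wsum !big_map -sumrB.
apply: eq_big_seq => t tD.
have lr e : label (resolve_passage x e t) = label t.
  by rewrite /resolve_passage; case: ifP.
rewrite !lr -mulrzBr; congr (_ *~ _).
(* Here [c] counts the singular passages left after resolution, so [c < 2] means that [x] was the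
   only singular crossing. *)
case: (ltnP c 2) => c2.
  have -> : c./2 = 0%N by case: (c) c2 => [|[|]].
  have [ts|ts] := boolP (t.2 == Singular).
    rewrite kappa_resolve //= ?ts //.
    by apply: singular_label => //; rewrite cD.
  by rewrite /resolve_passage (negbTE ts) andbF subrr /= (negbTE ts).
(* Other singular crossings remain: the weight of [D] vanishes, and the resolutions have
   coefficients [kappa 1], blind to the sign chosen at [x], or zero. *)
case: (c) c2 => [|[|k]] //= _; rewrite /resolve_passage; case: ifP => _ /=; last by rewrite subrr.
by case: (k./2) => [|m] //=; case: ifP; case: ifP.
Qed.

End Resolution.

(** * An odd writhe *)

(** Positions of equal parity have an odd number of passages between them. *)
Definition odd_first (v : seq passage) (t : passage) : bool :=
  (index t v < index (co t) v)%N && (odd (index t v) == odd (index (co t) v)).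

(** A flat crossing has no over-strand; its sign is read at its first passage instead, which depends
    on the orientation of the arc. *)
Definition odd_sign (v : seq passage) (t : passage) : int :=
  if odd_first v t then crossing_sign t else 0.

Definition odd_writhe (v : seq passage) : int := \sum_(t <- v) odd_sign v t.

(** Dropping virtual passages makes the virtual moves trivial but loses planarity; the study of
    [odd_writhe] under moves assumes only that words are paired. *)
Definition flats (w : seq passage) := filter (fun t => t.2 == Flat) w.

Lemma flats_paired w : is_flat w -> paired (flats w).
Proof.
move=> fw; have /andP[uw cw] := flat_paired fw; apply/andP; split.
  by apply: subseq_uniq uw; apply/map_subseq/filter_subseq.
apply/allP => t; rewrite !mem_filter => /andP[tF tw].
by rewrite (flat_co fw tw) tF (allP cw).
Qed.

(** Passages behind the deleted pair move by two places, so parities of positions survive. *)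
Lemma index_del (T : eqType) (a b t : T) (p q : seq T) :
  uniq (p ++ [:: a; b] ++ q) -> t \in p ++ q ->
  index t (p ++ [:: a; b] ++ q) = (index t (p ++ q) + (t \notin p).*2)%N.
Proof.
have pe : perm_eq (p ++ [:: a; b] ++ q) ([:: a; b] ++ p ++ q) by rewrite perm_catCA.
rewrite (perm_uniq pe) => /= /and3P[+ bp _] tpq; rewrite inE negb_or => /andP[_ ap].
rewrite index_cat [index t (p ++ q)]index_cat; case: ifP => [_|tp]; first by rewrite addn0.
rewrite /= ![_ == t]eq_sym (negbTE (memPn ap _ tpq)) (negbTE (memPn bp _ tpq)).
by rewrite !addnS addn0.
Qed.

Lemma odd_first_del a b p q t : uniq (p ++ [:: a; b] ++ q) -> t \in p ++ q -> co t \in p ++ q ->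
  odd_first (p ++ [:: a; b] ++ q) t = odd_first (p ++ q) t.
Proof.
move=> U tv cv; rewrite /odd_first !index_del // !oddD !odd_double !addbF; congr andb.
have h u u' : u \in p -> u' \in p ++ q -> u' \notin p -> (index u (p ++ q) < index u' (p ++ q))%N.
  move=> up _ u'p; rewrite !index_cat up (negbTE u'p).
  by apply: (leq_trans (_ : _ <= size p)%N); rewrite ?index_mem ?leq_addr.
case: (boolP (t \in p)) => tp; case: (boolP (co t \in p)) => cp /=; rewrite ?addn0 //.
- by have lt := h _ _ tp cv cp; rewrite lt ltn_addr.
- have le := ltnW (h _ _ cp tv tp).
  by rewrite !ltnNge le (leq_trans le (leq_addr _ _)).
by rewrite ltn_add2r.
Qed.

Lemma odd_sign_del a b p q t : uniq (p ++ [:: a; b] ++ q) -> t \in p ++ q -> co t \in p ++ q ->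
  odd_sign (p ++ [:: a; b] ++ q) t = odd_sign (p ++ q) t.
Proof. by move=> U tv cv; rewrite /odd_sign odd_first_del. Qed.

Lemma index_ordered o x y p q : uniq (p ++ ordered o x y ++ q) ->
  index x (p ++ ordered o x y ++ q) = (size p + ~~ o)%N /\
  index y (p ++ ordered o x y ++ q) = (size p + o)%N.
Proof.
move=> /uniq_ordered[xy]; rewrite !mem_cat => /norP[xp _] /norP[yp _] _.
rewrite !index_cat (negbTE xp) (negbTE yp).
by case: o; rewrite /= !inE !eqxx ?orbT /= ?(negbTE xy) ?[y == x]eq_sym ?(negbTE xy).
Qed.

Lemma odd_writhe_monogon o x p q : paired (p ++ ordered o x (co x) ++ q) -> paired (p ++ q) ->
  odd_writhe (p ++ ordered o x (co x) ++ q) = odd_writhe (p ++ q).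
Proof.
move=> pw pw'; have uw := paired_uniq pw.
rewrite /odd_writhe (perm_big _ (perm_ordered _ _ _ _ _)) !big_cons /=.
have [ix icx] := index_ordered uw.
have -> : odd_sign (p ++ ordered o x (co x) ++ q) x = 0.
  rewrite /odd_sign /odd_first ix icx !oddD.
  by case: (o); rewrite ?andbF //; case: odd; rewrite ?andbF.
have -> : odd_sign (p ++ ordered o x (co x) ++ q) (co x) = 0.
  rewrite /odd_sign /odd_first coK ix icx !oddD.
  by case: (o); rewrite ?andbF //; case: odd; rewrite ?andbF.
rewrite !add0r; apply: eq_big_seq => t tv.
have ctv : co t \in p ++ q by rewrite mem_co.
by case: (o) uw => uw; apply: odd_sign_del.
Qed.

(** By adjacency the distances from [x] to [co x] and from [y] to [co y] have the same parity: both
    crossings count or neither does, and their signs are opposite. *)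
Lemma odd_writhe_bigon o x y p q r :
  paired (p ++ [:: x; y] ++ q ++ ordered o (co x) (co y) ++ r) -> paired (p ++ q ++ r) ->
  sense y = ~~ sense x ->
  odd_writhe (p ++ [:: x; y] ++ q ++ ordered o (co x) (co y) ++ r) = odd_writhe (p ++ q ++ r).
Proof.
set v := p ++ _ => pv pw' sxy; have uv := paired_uniq pv.
have [[pe _ _] _ _ _] := perm_blocks p q r [::] (perm_ordered_pair true x y)
    (perm_ordered_pair o (co x) (co y)) (perm_refl [::]).
rewrite /= !cats0 -/v in pe.
rewrite /odd_writhe (perm_big _ pe) !big_cons /= !addrA.
have vE : v = (p ++ [:: x; y] ++ q) ++ ordered o (co x) (co y) ++ r by rewrite /v -!catA.
have [ix iy] : index x v = size p /\ index y v = (size p).+1.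
  by have [-> ->] := @index_ordered true x y p _ uv; rewrite addn0 addn1.
have [icx icy] : index (co x) v = (size (p ++ [:: x; y] ++ q) + ~~ o)%N /\
    index (co y) v = (size (p ++ [:: x; y] ++ q) + o)%N.
  by have := uv; rewrite vE => /index_ordered.
have sz : (size p + 2 <= size (p ++ [:: x; y] ++ q))%N by rewrite !size_cat /=; lia.
have e1 : odd_sign v x + odd_sign v y = 0.
  rewrite /odd_sign /odd_first ix iy icx icy /crossing_sign sxy.
  move: (size p) (size (p ++ _)) sz => k S kS.
  have -> : (k < S + ~~ o)%N by lia.
  have -> : (k.+1 < S + o)%N by lia.
  rewrite !oddD /=; case: (odd k) (odd S) (o) (sense x) => [] [] [] [] //=;
    by rewrite ?addrN ?addNr.
have e2 : odd_sign v (co x) + odd_sign v (co y) = 0.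
  rewrite /odd_sign /odd_first !coK ix iy icx icy.
  move: (size p) (size (p ++ _)) sz => k S kS.
  have -> : (S + ~~ o < k)%N = false by lia.
  have -> : (S + o < k.+1)%N = false by lia.
  by rewrite addr0.
rewrite e1 add0r -addrA addrA e2 add0r; apply: eq_big_seq => t tv.
have ctv : co t \in p ++ q ++ r by rewrite mem_co.
have mid u : u \in p ++ q ++ r -> u \in (p ++ [:: x; y] ++ q) ++ r.
  by rewrite !mem_cat => /or3P[] ->; rewrite ?orbT.
have E1 : odd_sign v t = odd_sign ((p ++ [:: x; y] ++ q) ++ r) t.
  have := uv; rewrite vE; case: (o) => U; apply: odd_sign_del => //; exact: mid.
have U : uniq (p ++ [:: x; y] ++ (q ++ r)).
  by have := uv; rewrite vE => /uniq_ordered[_ _ _]; rewrite -!catA.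
by rewrite E1 -[_ ++ r]catA -[(_ ++ q) ++ r]catA odd_sign_del.
Qed.

Lemma index_swap (T : eqType) (f : T -> T) v t : involutive f ->
  index t (map f v) = index (f t) v.
Proof. by move=> fK; rewrite -[in LHS](fK t) index_map //; apply: inv_inj. Qed.

Lemma adj_index o x y v : uniq v -> adj o x y v ->
  index y v = (index x v).+1 \/ index x v = (index y v).+1.
Proof.
move=> uv [p [q E]]; rewrite E in uv *; have [-> ->] := index_ordered uv.
by case: (o); rewrite addn0 addn1; [left | right].
Qed.

(** Each of the six passages moves by one place. The two passages of a crossing both move, which
    keeps the parity of their distance, and they belong to different adjacent pairs, which keeps
    their order. *)
Lemma odd_writhe_triangle x y z o1 o2 o3 v : paired v -> triangle x y z o1 o2 o3 v ->
  odd_writhe (tri_swap x y z v) = odd_writhe v.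
Proof.
move=> pv T; have uv := paired_uniq pv; have U := tri_uniq (triangle_labels T).
rewrite /odd_writhe (perm_big _ (perm_tri_swap pv T)); apply: eq_big_seq => t tv.
have [xv yv] := adj_mem (triangle_adj1 T); have [cxv zv] := adj_mem (triangle_adj2 T).
have [cyv czv] := adj_mem (triangle_adj3 T).
have i1 := adj_index uv (triangle_adj1 T).
have i2 := adj_index uv (triangle_adj2 T).
have i3 := adj_index uv (triangle_adj3 T).
have [i1' i2' i3'] := And3 ((or_comm _ _).1 i1) ((or_comm _ _).1 i2) ((or_comm _ _).1 i3).
rewrite /odd_sign; suff -> : odd_first (tri_swap x y z v) t = odd_first v t by [].
rewrite /odd_first tri_swapE !index_swap; try exact: triK.
have [T1 T2 T3] := tri_swap_ordered U.
have [tx ty] : tri x y z x = y /\ tri x y z y = x.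
  by have := T1 true; rewrite tri_swapE => -[].
have [tcx tz] : tri x y z (co x) = z /\ tri x y z z = co x.
  by have := T2 true; rewrite tri_swapE => -[].
have [tcy tcz] : tri x y z (co y) = co z /\ tri x y z (co z) = co y.
  by have := T3 true; rewrite tri_swapE => -[].
(* [a] and [b] are the positions of a passage and its [co], [a'] and [b'] those of their neighbours;
   since the pairs are disjoint, exchanging neighbours preserves the comparison. *)
have key (a b a' b' : nat) : a != b -> a != b' -> b != a' -> a' != b' ->
    (a' = a.+1 \/ a = a'.+1) -> (b' = b.+1 \/ b = b'.+1) ->
    (a' < b')%N && (odd a' == odd b') = (a < b)%N && (odd a == odd b).
  move=> ab ab' ba' a'b' h1 h2; have -> : (odd a' == odd b') = (odd a == odd b).
    by case: h1 h2 => -> [] -> /=; case: odd; case: odd.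
  by congr andb; lia.
have UI : uniq [seq index u v | u <- [:: x; y; co x; z; co y; co z]].
  rewrite map_inj_in_uniq // => a b; rewrite !inE => av bv e.
  have mv u : [|| u == x, u == y, u == co x, u == z, u == co y | u == co z] -> u \in v.
    by do 5!(case/orP => [/eqP->//|]); move/eqP->.
  by rewrite -(nth_index a (mv a av)) e nth_index ?mv.
move: UI; rewrite /= !inE !negb_or -!andbA; do 14!(case/andP=> ?); case/andP=> ? _.
case: (boolP (t \in [:: x; y; co x; z; co y; co z])) => [|tL].
  rewrite !inE => /orP[/eqP->|/orP[/eqP->|/orP[/eqP->|/orP[/eqP->|/orP[/eqP->|/eqP->]]]]];
    rewrite ?coK ?tx ?ty ?tcx ?tz ?tcy ?tcz; apply: key => //; by rewrite eq_sym.
have ctL : co t \notin [:: x; y; co x; z; co y; co z].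
  apply: contra tL; rewrite !inE -!(inj_eq (inv_inj coK) (co t)) !coK.
  by move=> /orP[/eqP->|/orP[/eqP->|/orP[/eqP->|/orP[/eqP->|/orP[/eqP->|/eqP->]]]]];
    rewrite ?eqxx ?orbT.
have id u : u \notin [:: x; y; co x; z; co y; co z] -> tri x y z u = u.
  rewrite !inE !negb_or => /and5P[/negbTE ux /negbTE uy /negbTE ucx /negbTE uz].
  by case/andP=> /negbTE ucy /negbTE ucz; rewrite /tri /swp ucy ucz ucx uz ux uy.
by rewrite !id.
Qed.

Lemma index_map_in (T T' : eqType) (f : T -> T') v t : {in t :: v &, injective f} ->
  index (f t) (map f v) = index t v.
Proof.
elim: v => //= u v IH fi; rewrite IH => [|a b av bv]; last first.
  by apply: fi; [move: av | move: bv]; rewrite !inE => /orP[] ->; rewrite ?orbT.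
rewrite (_ : (f u == f t) = (u == t)) //.
by apply/eqP/eqP => [|-> //]; apply: fi; rewrite !inE eqxx ?orbT.
Qed.

Lemma odd_writhe_relabel f v : paired v -> {in map label v &, injective f} ->
  odd_writhe (map (relabel f) v) = odd_writhe v.
Proof.
move=> pv fi; rewrite /odd_writhe big_map; apply: eq_big_seq => t tv.
have ri : {in v &, injective (relabel f)}.
  move=> [[l b] m] [[l' b'] m'] tv' tv'' [].
  rewrite /label /sense /= => e -> ->.
  by rewrite (fi l l') //; [apply: (label_mem tv') | apply: (label_mem tv'')].
have iE u : u \in v -> index (relabel f u) (map (relabel f) v) = index u v.
  move=> uv; apply: index_map_in => a b av bv; apply: ri.
    by move: av; rewrite inE => /predU1P[->|].
  by move: bv; rewrite inE => /predU1P[->|].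
by rewrite /odd_sign /odd_first -relabel_co !iE ?mem_co.
Qed.

Lemma index_rev (T : eqType) (v : seq T) t : uniq v -> t \in v ->
  (index t (rev v) + index t v).+1%N = size v.
Proof.
move=> uv tv; case/splitPr: tv uv => p q uv; rewrite rev_cat rev_cons cat_rcons !index_cat.
move: uv; rewrite cat_uniq /= negb_or => /and4P[_ /andP[tp _] tq _].
rewrite !mem_rev (negbTE tp) (negbTE tq) /= eqxx !addn0 size_rev size_cat /=; lia.
Qed.

(** Reversal makes the second passage of a crossing the first one, of opposite sense, and keeps the
    parity of distances. This is why only the absolute value descends to unoriented classes. *)
Lemma odd_writhe_rev v : paired v -> odd_writhe (rev v) = - odd_writhe v.
Proof.
move=> pv; have uv := paired_uniq pv.
have pc : perm_eq (map co v) v.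
  apply: uniq_perm; rewrite ?map_inj_uniq //; try exact: (inv_inj coK).
  move=> t; apply/mapP/idP => [[u uv' ->]|tv]; first by rewrite mem_co.
  by exists (co t); rewrite ?mem_co ?coK.
rewrite /odd_writhe (perm_big v) ?perm_rev // -(perm_big _ pc) big_map -sumrN.
apply: eq_big_seq => t tv; rewrite /odd_sign /odd_first coK.
have ctv : co t \in v by rewrite mem_co.
have h1 := index_rev uv tv; have h2 := index_rev uv ctv.
rewrite /crossing_sign sense_co.
move: h1 h2; move: (index t (rev v)) (index (co t) (rev v)) (index t v) (index (co t) v) (size v).
move=> a b c d n <- h2; have -> : (b < a)%N = (c < d)%N by lia.
have -> : (odd b == odd a) = (odd c == odd d) by lia.
by case: ifP => _; case: (sense t); rewrite ?oppr0 ?opprK.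
Qed.

Lemma flats_cat v w : flats (v ++ w) = flats v ++ flats w.
Proof. exact: filter_cat. Qed.

Lemma flats_ordered o x y : flats (ordered o x y) =
  if x.2 == Flat then if y.2 == Flat then ordered o x y else [:: x]
  else if y.2 == Flat then [:: y] else [::].
Proof. by rewrite /flats; case: o => /=; case: (x.2 == _) (y.2 == _) => [] []. Qed.

Lemma odd_writhe_move w w' : is_flat w -> is_flat w' -> move w w' ->
  odd_writhe (flats w) = odd_writhe (flats w').
Proof.
move=> fw fw' mv; have pw := flats_paired fw; have pw' := flats_paired fw'.
case: mv fw pw pw' => {w w' fw'}.
- move=> p q x xs fw pw pw'.
  have cx : (co x).2 = x.2 by apply: (flat_co fw); rewrite mem_cat mem_head orbT.
  rewrite !flats_cat (flats_ordered true) cx in pw pw' *; case: eqP pw => xF pw.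
    exact: (@odd_writhe_monogon true).
  by [].
- move=> p q r x y o xs yx sxy fw pw pw'.
  have cx : (co x).2 = x.2 by apply: (flat_co fw); rewrite mem_cat mem_head orbT.
  have cy : (co y).2 = x.2 by rewrite /= yx.
  rewrite !flats_cat (flats_ordered true) flats_ordered cx cy yx in pw pw' *.
  case: eqP pw => xF pw; last by [].
  exact: odd_writhe_bigon.
- move=> p q r u x y z o1 o2 o3 mk s1 s2 fw pw pw'.
  have [[pe _ _] _ _ _] := perm_blocks p q r u (perm_ordered_pair o1 x y)
    (perm_ordered_pair o2 (co x) z) (perm_ordered_pair o3 (co y) (co z)).
  have mw t : t \in [:: x; y; z] -> t \in p ++ ordered o1 x y ++ q ++ ordered o2 (co x) z
      ++ r ++ ordered o3 (co y) (co z) ++ u.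
    by rewrite (perm_mem pe) /= !inE => /or3P[] ->; rewrite ?orbT.
  have xw := mw x (mem_head _ _).
  have/mw yw : y \in [:: x; y; z] by rewrite !inE eqxx orbT.
  have/mw zw : z \in [:: x; y; z] by rewrite !inE eqxx !orbT.
  have cx := flat_co fw xw; have cy := flat_co fw yw; have cz := flat_co fw zw.
  have [fx fy fz] := And3 (flat_mark fw xw) (flat_mark fw yw) (flat_mark fw zw).
  rewrite !flats_cat !flats_ordered cx cy cz in pw pw' *.
  (* With at least two virtual crossings every strand keeps at most one flat passage, so its order
     is immaterial; one virtual crossing alone is excluded by [mk]. There remain three flat
     crossings, a triangle in the reduced word. *)
  case: fx fy fz mk pw => ex [] ey [] ez mk pw; rewrite ex ey ez /= in mk pw *; try by [].
  have [lab tE] := triangle_form pw erefl.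
  rewrite -tE; apply/esym/(@odd_writhe_triangle _ _ _ o1 o2 o3) => //.
  split=> //; first by rewrite ex ey ez.
  + by exists (flats p); eexists.
  + by exists (flats p ++ ordered o1 x y ++ flats q); eexists; rewrite -!catA.
  + exists (flats p ++ ordered o1 x y ++ flats q ++ ordered o2 (co x) z ++ flats r), (flats u).
    by rewrite -!catA.
- move=> p q x vx fw pw pw'; rewrite -cat1s -[co x :: q]cat1s !flats_cat /flats /= vx /=.
  by [].
- move=> p q x vx fw pw pw'; rewrite -[x :: _]cat1s !flats_cat /flats /= vx /=.
  by rewrite cats0.
move=> p q r i j b m o s s' c c' mc fw pw pw'.
have sw : s \in p ++ [:: s; c] ++ q ++ ordered o (co s) (co c) ++ r.
  by rewrite mem_cat mem_head orbT.
by case: (flat_mark fw sw).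
Qed.

Lemma odd_writhe_step (D D' : flat_diagram) : unoriented_step D D' ->
  `|odd_writhe (flats D)| = `|odd_writhe (flats D')|.
Proof.
have fD := diagramP D; have fD' := diagramP D'; case=> [[mv|[f fi E]]|E].
- by rewrite (odd_writhe_move fD fD' mv).
- have -> : flats D' = map (relabel f) (flats D) by rewrite /flats E filter_map.
  rewrite odd_writhe_relabel //; first exact: flats_paired.
  move=> l l' /mapP[t + ->] /mapP[t' + ->]; rewrite !mem_filter => /andP[_ tD] /andP[_ tD'].
  by apply: fi; apply: label_mem.
by rewrite E /flats filter_rev odd_writhe_rev ?Num.Theory.normrN //; apply: (flats_paired fD).
Qed.

Lemma flat_class_odd_writhe (D D' : flat_diagram) : flat_class D = flat_class D' ->
  `|odd_writhe (flats D)| = `|odd_writhe (flats D')|.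
Proof.
move=> /eqmodP.
exact: (@generated_invariant _ _ _ (fun u : flat_diagram => `|odd_writhe (flats u)|)
  odd_writhe_step).
Qed.

Lemma cls_odd_writhe w w' : is_flat w -> is_flat w' -> cls w = cls w' ->
  `|odd_writhe (flats w)| = `|odd_writhe (flats w')|.
Proof.
move=> fw fw'; rewrite (cls_diagram (Diagram fw)) (cls_diagram (Diagram fw')).
exact: flat_class_odd_writhe.
Qed.

(** * The order is not zero *)

Lemma witness_classes : cls (smooth_word 0 (flatw witness)) <> cls (flatw witness).
Proof.
have fw := flatw_flat witness_diagram.
move/(cls_odd_writhe (flat_smooth 0 fw) fw) => /eqP.
(* Unlocking the big sums lets them compute: the absolute values are 0 for the smoothing and 2 for
   the witness. *)
rewrite /odd_writhe unlock.
by vm_compute.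
Qed.

Lemma resolve_virtual e : is_diagram virtual_marks (resolve 0 e witness).
Proof.
have /and4P[wp pl cl _] := diagramP (resolve 0 e witness).
by apply/and4P; split=> //; case: (e).
Qed.

Lemma weight_witness : weight witness <> 0.
Proof.
have key F : wsum 1 F witness_word = jump F 0 *+ 2.
  rewrite /wsum; move: (jump F) => J.
  rewrite !big_cons big_nil /kappa /= /label /= !mulr0z !add0r !addr0.
  by rewrite mulr2n.
have -> : weight witness = wsum 1 (flatw witness) witness_word by [].
rewrite {}key /jump; move: witness_classes; move: (cls _) (cls _) => a b /eqP/negbTE ne.
move/(congr1 (coeff a)).
rewrite coeffMn coeffB !coeffU coeff0 eqxx ne.
by [].
Qed.

Lemma Vassiliev_order_le1 : Vassiliev_order_le smoothing_invariant 1.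
Proof.
exists (fun K => weight (repr K)); first split.
- by move=> D; rewrite weight_repr weight_to_singular smoothing_invariantE.
- by move=> D x xD; rewrite !weight_repr; apply: weight_resolve.
move=> D; rewrite weight_repr /weight; case: (n_singular D) => [|[|n]] // _.
by rewrite /wsum big1 // => t _; rewrite mulr0z.
Qed.

(** Both resolutions of the witness are virtual diagrams, where any extension [W] is prescribed. So
    [W] takes the value [weight witness], which is not zero, on a diagram with one singular
    crossing. *)
Lemma not_Vassiliev_order_le0 : ~ Vassiliev_order_le smoothing_invariant (1 - 1).
Proof.
case=> W [Wv Wr] W0; apply: weight_witness.
have xD : is_singular_crossing 0 witness by [].
have WE e : W (singular_class (resolve 0 e witness)) = weight (resolve 0 e witness).
  have E : resolve 0 e witness = to_singular (Diagram (resolve_virtual e)) by apply: val_inj.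
  by rewrite E Wv smoothing_invariantE weight_to_singular.
rewrite (weight_resolve xD) -!WE -Wr //; apply: W0.
by [].
Qed.

Theorem theorem3p4 :
  (forall D : virtual_diagram,
     smoothing_invariant (virtual_class D) = smoothing_sum D) /\
  Vassiliev_of_order smoothing_invariant 1.
Proof.
split; first exact: smoothing_invariantE.
by split; [apply: Vassiliev_order_le1 | apply: not_Vassiliev_order_le0].
Qed.
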